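(* Let $1\le p,q^*,q,\zeta<\infty$, $\alpha\in\mathbb R$, $\alpha^*<0$ satisfy $$\frac1{q^*}+\frac{\alpha^*}{Q}=\frac1q+\frac{\alpha}{Q}.$$ Suppose that $\omega\in A_\zeta(\mathbb H^n)$ with finite critical index $r_\omega$ for the reverse Hölder condition, $q^*>q\zeta r_\omega/(r_\omega-1)$, $\Omega\in L^{(q^*/\zeta)'}(S_{Q-1})$ and $\delta\in(1,r_\omega)$. (i) If $\frac1{q^*}+\frac{\alpha^*}{Q}\ge0$ and $$\mathcal C_{4.1}=\int_0^{1/2}\frac{\Phi(t)}{t^{1-Q\frac{(\delta-1)}{\delta}\left(\frac1{q^*}+\frac{\alpha^*}{Q}\right)}}\,dt+\int_{1/2}^\infty\frac{\Phi(t)}{t^{1-Q\zeta\left(\frac1{q^*}+\frac{\alpha^*}{Q}\right)}}\,dt<\infty,$$ then $\mathcal H_{\Phi,\Omega}$ is bounded from $\dot K^{\alpha^*,p}_{q^*,\omega}(\mathbb H^n)$ to $\dot K^{\alpha,p}_{q,\omega}(\mathbb H^n)$. (ii) If $\frac1{q^*}+\frac{\alpha^*}{Q}<0$ and $$\mathcal C_{4.2}=\int_0^{1/2}\frac{\Phi(t)}{t^{1-Q\zeta\left(\frac1{q^*}+\frac{\alpha^*}{Q}\right)}}\,dt+\int_{1/2}^\infty\frac{\Phi(t)}{t^{1-Q\frac{(\delta-1)}{\delta}\left(\frac1{q^*}+\frac{\alpha^*}{Q}\right)}}\,dt<\infty,$$ then $\mathcal H_{\Phi,\Omega}$ is bounded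 from $\dot K^{\alpha^*,p}_{q^*,\omega}(\mathbb H^n)$ to $\dot K^{\alpha,p}_{q,\omega}(\mathbb H^n)$.
   Context: Heisenberg group. $\mathbb H^n$ is $\mathbb R^{2n}\times\mathbb R$ with Lebesgue measure ($|E|$ is the measure of $E$) and group law $x\cdot y=\big(x_1+y_1,\dots,x_{2n}+y_{2n},\,x_{2n+1}+y_{2n+1}+2\sum_{j=1}^n(y_jx_{n+j}-x_jy_{n+j})\big)$; the identity is $0$ and $x^{-1}=-x$. Dilations: $\delta_rx=(rx_1,\dots,rx_{2n},r^2x_{2n+1})$, $r>0$. $Q=2n+2$. Norm: $|x|_h=\big((\sum_{i=1}^{2n}x_i^2)^2+x_{2n+1}^2\big)^{1/4}$; distance $d(x,y)=|y^{-1}\cdot x|_h$; balls $B(x,r)=\{y:d(x,y)<r\}$. $S_{Q-1}=\{x:|x|_h=1\}$ carries the measure $dy'$ for which $\int_{\mathbb H^n}f(x)dx=\int_0^\infty\int_{S_{Q-1}}f(\delta_ry')r^{Q-1}dy'dr$. $U_k=\{x\in\mathbb H^n:|x|_h\le2^k\}$, $C_k=U_k\setminus U_{k-1}$, $\chi_k=\chi_{C_k}$ for $k\in\mathbb Z$. Operator. $\Phi:\mathbb H^n\to[0,\infty)$ is a radial measurable function (so $\Phi(x)$ depends only on $|x|_h$, and one writes $\Phi(t)$ for its value when $|x|_h=t$); $\Omega:S_{Q-1}\to\mathbb C$ is measurable with $\Omega(y)\ne0$ for almost every $y$. The rough Hausdorff operator is $$\mathcal H_{\Phi,\Omega}(f)(x)=\int_{\mathbb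 H^n}\frac{\Phi(\delta_{|y|_h^{-1}}x)}{|y|_h^{Q}}\Omega(\delta_{|y|_h^{-1}}y)f(y)\,dy=\int_0^\infty\int_{S_{Q-1}}\frac{\Phi(t)}{t}\Omega(y')f(\delta_{t^{-1}|x|_h}y')\,dy'dt .$$ Weights. A weight is a non-negative measurable function on $\mathbb H^n$; $\omega(K)=\int_K\omega(x)dx$. For $1<p<\infty$, $\omega\in A_p(\mathbb H^n)$ if there is $C$ with $\big(\frac1{|B|}\int_B\omega\big)\big(\frac1{|B|}\int_B\omega^{-1/(p-1)}\big)^{p-1}\le C$ for all balls $B$; $\omega\in A_1(\mathbb H^n)$ if $\frac1{|B|}\int_B\omega\le C\operatorname{ess\,inf}_{B}\omega$ for all balls $B$. For $r>1$, $\omega\in RH_r(\mathbb H^n)$ if there is $C$ with $\big(\frac1{|B|}\int_B\omega^r\big)^{1/r}\le\frac C{|B|}\int_B\omega$ for all balls $B$. The critical index is $r_\omega=\sup\{r>1:\omega\in RH_r(\mathbb H^n)\}$. Spaces. $\|f\|_{L^q_\omega(\mathbb H^n)}=\big(\int_{\mathbb H^n}|f|^q\omega\,dx\big)^{1/q}$, and $L^q_{\omega,\mathrm{loc}}(\mathbb H^n\setminus\{0\})$ is the set of measurable $f$ with $\int_K|f|^q\omega\,dx<\infty$ for every compact $K\subset\mathbb H^n\setminus\{0\}$. For $\alpha\in\mathbb R$, $0<p,q<\infty$, the weighted Herz space $\dot K^{\alpha,p}_{q,\omega}(\mathbb H^n)$ consists of $f\in L^q_{\omega,\mathrm{loc}}(\mathbb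 H^n\setminus\{0\})$ with $$\|f\|_{\dot K^{\alpha,p}_{q,\omega}(\mathbb H^n)}=\Big(\sum_{k=-\infty}^\infty\omega(U_k)^{\alpha p/Q}\|f\chi_k\|^p_{L^q_\omega(\mathbb H^n)}\Big)^{1/p}<\infty .$$ Conventions. $s'$ is the conjugate exponent of $s$. An operator $T$ is bounded from $X$ to $Y$ if for every $f\in X$ the integral defining $Tf(x)$ converges absolutely for a.e. $x$ and $\|Tf\|_Y\le C\|f\|_X$ with $C$ independent of $f$. *)

(* Defs.v *)
From HB Require Import structures.
From mathcomp Require Import all_boot all_order all_algebra.
From mathcomp Require Import all_classical all_reals all_analysis.
From mathcomp Require Import measurable_realfun complex.

Set Implicit Arguments.
Unset Strict Implicit.
Unset Printing Implicit Defensive.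

Import Order.TTheory GRing.Theory Num.Theory.
Import numFieldNormedType.Exports.

Local Open Scope classical_set_scope.
Local Open Scope ring_scope.

Lemma product_sigma_finite d1 d2 (T1 : measurableType d1)
    (T2 : measurableType d2) (R : realType)
    (m1 : {sigma_finite_measure set T1 -> \bar R})
    (m2 : {sigma_finite_measure set T2 -> \bar R}) :
  sigma_finite setT (m1 \x m2)%E.
Proof.
have /sigma_finiteP[F [TF ndF Foo]] := sigma_finiteT m1.
have /sigma_finiteP[G [TG ndG Goo]] := sigma_finiteT m2.
exists (fun n => F n `*` G n).
  rewrite -setXTT TF TG predeqE => -[x y]; split.
    move=> [/= [n _ Fnx] [k _ Gky]]; exists (maxn n k) => //; split.
    - by move: x Fnx; exact/subsetPset/ndF/leq_maxl.
    - by move: y Gky; exact/subsetPset/ndG/leq_maxr.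
  by move=> [n _ []/= ? ?]; split; exists n.
move=> k; have [? ?] := Foo k; have [? ?] := Goo k.
split; first exact: measurableX.
by rewrite product_measure1E// lte_mul_pinfty// ge0_fin_numE.
Qed.

(* Lebesgue measure on R^m, carried by the library's m-tuples with their product
   sigma-algebra: R^0 has unit mass, and the measure on R^(m+1) is the image of
   (Lebesgue on R) x (Lebesgue on R^m) under (x, t) |-> x :: t. *)
Section cons_measure.
Context (R : realType) (m : nat).
Local Notation RR := (measurableTypeR R).
Variable mu : {sigma_finite_measure set (m.-tuple RR) -> \bar R}.

Definition tuple_cons (z : RR * m.-tuple RR) : m.+1.-tuple RR :=
  [the m.+1.-tuple RR of z.1 :: z.2].

Lemma measurable_tuple_cons : measurable_fun setT tuple_cons.
Proof. exact: measurable_cons. Qed.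

Definition cons_measure : set (m.+1.-tuple RR) -> \bar R :=
  pushforward (@lebesgue_measure R \x mu)%E tuple_cons.

Let pm := [the measure _ _ of
  measure_function_pushforward__canonical__measure_function_Measure
    (@lebesgue_measure R \x mu)%E measurable_tuple_cons].

HB.instance Definition _ := isMeasure.Build _ _ _ cons_measure
  (measure0 pm) (measure_ge0 pm) (@measure_semi_sigma_additive _ _ _ pm).

Lemma cons_measure_sigma_finite : sigma_finite setT cons_measure.
Proof.
have [F FT Foo] := product_sigma_finite (@lebesgue_measure R) mu.
pose u (t : m.+1.-tuple RR) : RR * m.-tuple RR :=
  (tnth t ord0, [tuple of behead t]).
have tupleK : cancel tuple_cons u by case=> x t; congr pair; apply/val_inj.
have mu' : measurable_fun setT u.
  by apply/measurable_fun_pair; [exact: measurable_tnth|exact: measurable_behead].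
exists (fun i => u @^-1` F i).
  by rewrite -preimage_bigcup -FT preimage_setT.
move=> i; split.
  by rewrite -[X in measurable X]setTI; apply: mu' => //; exact: (Foo i).1.
rewrite /cons_measure /pushforward -comp_preimage.
rewrite (_ : u \o tuple_cons = id); last exact/funext.
exact: (Foo i).2.
Qed.

HB.instance Definition _ :=
  Measure_isSigmaFinite.Build _ _ _ cons_measure cons_measure_sigma_finite.

End cons_measure.

Fixpoint tuple_lebesgue (R : realType) (m : nat) :
    {sigma_finite_measure set (m.-tuple (measurableTypeR R)) -> \bar R} :=
  match m with
  | 0 => \d_([tuple] : 0.-tuple (measurableTypeR R))
  | m'.+1 => cons_measure (tuple_lebesgue R m')
  end.

Section heisenberg.
Context (R : realType) (n : nat).

Definition heis : Type :=
  ((n + n).-tuple (measurableTypeR R) * measurableTypeR R)%type.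
HB.instance Definition _ := Measurable.on heis.

Definition heis_lebesgue : set heis -> \bar R :=
  (tuple_lebesgue R (n + n) \x @lebesgue_measure R)%E.
HB.instance Definition _ := Measure.on heis_lebesgue.
HB.instance Definition _ := Measure_isSigmaFinite.Build _ _ _ heis_lebesgue
  (product_sigma_finite (tuple_lebesgue R (n + n)) (@lebesgue_measure R)).

(* For j : 'I_n, the coordinates x_j, x_(n+j) and x_(2n+1) of x are
   hcoord x (lshift n j), hcoord x (rshift n j) and hlast x. *)
Definition hcoord (x : heis) (i : 'I_(n + n)) : R := tnth x.1 i.
Definition hlast (x : heis) : R := x.2.
Definition hmk (v : 'I_(n + n) -> R) (z : R) : heis := ([tuple v i | i < n + n], z).

Definition hzero : heis := hmk (fun=> 0) 0.
Definition hopp (x : heis) : heis := hmk (fun i => - hcoord x i) (- hlast x).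
Definition hmul (x y : heis) : heis :=
  hmk (fun i => hcoord x i + hcoord y i)
      (hlast x + hlast y + 2 * \sum_(j < n)
        (hcoord y (lshift n j) * hcoord x (rshift n j)
         - hcoord x (lshift n j) * hcoord y (rshift n j))).
Definition hdil (r : R) (x : heis) : heis :=
  hmk (fun i => r * hcoord x i) (r ^+ 2 * hlast x).

Definition hdim : nat := (2 * n + 2)%N.

Definition hnorm (x : heis) : R :=
  ((\sum_(i < n + n) hcoord x i ^+ 2) ^+ 2 + hlast x ^+ 2) `^ 4^-1.
Definition hdist (x y : heis) : R := hnorm (hmul (hopp y) x).
Definition hball (x : heis) (r : R) : set heis := [set y | hdist x y < r].
Definition hsphere : set heis := [set x | hnorm x = 1].

(* U_k and C_k, for k in Z. *)
Definition dyadic_ball (k : int) : set heis := [set x | hnorm x <= 2 ^ k].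
Definition dyadic_shell (k : int) : set heis :=
  dyadic_ball k `\` dyadic_ball (k - 1).

(* Tuples carry no topology in the library, so compactness is read through the
   identification with the topological space R^(2n) x R. *)
Definition heis_top (x : heis) : 'rV[R]_(n + n) * R :=
  (\row_i hcoord x i, hlast x).
Definition hcompact (K : set heis) : Prop := compact (heis_top @` K).

(* The surface measure dy', seen as a Borel measure on H^n carried by the unit
   sphere; the polar coordinate formula determines it. *)
Definition polar_measure (sigma : {measure set heis -> \bar R}) : Prop :=
  sigma (~` hsphere) = 0%E /\
  forall f : heis -> \bar R, measurable_fun [set: heis] f -> (forall x, 0 <= f x)%E ->
    (\int[heis_lebesgue]_x f x =
     \int[@lebesgue_measure R]_(r in `]0%R, +oo[)
       \int[sigma]_(y in hsphere) (f (hdil r y) * (r ^+ hdim.-1)%:E))%E.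

(* Measurability for the completion of mu (Lebesgue measurability when mu is
   Lebesgue measure): equality mu-a.e. with a Borel function. On nonnegative such
   functions the library's integral, being the supremum over the Borel simple
   functions below, is the integral for the completed measure. *)
Definition ae_measurable (mu : {measure set heis -> \bar R}) (f : heis -> R) :
    Prop :=
  exists2 g : heis -> R, measurable_fun [set: heis] g & {ae mu, forall x, f x = g x}.
Definition ae_measurableC (mu : {measure set heis -> \bar R})
    (f : heis -> R[i]) : Prop :=
  ae_measurable mu (fun x => complex.Re (f x)) /\
  ae_measurable mu (fun x => complex.Im (f x)).

Definition abs_integrable (f : heis -> R[i]) : Prop :=
  ae_measurableC heis_lebesgue f /\
  (\int[heis_lebesgue]_y (ComplexField.Normc.normc (f y))%:E < +oo)%E.
Definition cintegral (f : heis -> R[i]) : R[i] :=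
  (\int[heis_lebesgue]_y complex.Re (f y)
   +i* \int[heis_lebesgue]_y complex.Im (f y))%C.

Definition weight (w : heis -> R) : Prop :=
  ae_measurable heis_lebesgue w /\ forall x, 0 <= w x.
Definition wmeasure (w : heis -> R) (K : set heis) : \bar R :=
  (\int[heis_lebesgue]_(x in K) (w x)%:E)%E.

Definition average (B : set heis) (f : heis -> \bar R) : \bar R :=
  ((heis_lebesgue B)^-1 * \int[heis_lebesgue]_(x in B) f x)%E.
Definition ess_inf_on (B : set heis) (f : heis -> \bar R) : \bar R :=
  ereal_sup [set y | {ae heis_lebesgue, forall x, B x -> (y <= f x)%E}].

(* The inverse of the weight is taken in \bar R, where 0^-1 = +oo (on R the power
   0 `^ (- s) would be 0). *)
Definition muckenhoupt_gt1 (p : R) (w : heis -> R) : Prop :=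
  exists C : R, forall (x : heis) (r : R), 0 < r ->
    (average (hball x r) (fun y => (w y)%:E) *
     (average (hball x r) (fun y => ((w y)%:E)^-1 `^ (p - 1)^-1)) `^ (p - 1)
     <= C%:E)%E.
Definition muckenhoupt1 (w : heis -> R) : Prop :=
  exists C : R, forall (x : heis) (r : R), 0 < r ->
    (average (hball x r) (fun y => (w y)%:E)
     <= C%:E * ess_inf_on (hball x r) (fun y => (w y)%:E))%E.
Definition muckenhoupt (p : R) (w : heis -> R) : Prop :=
  if p == 1 then muckenhoupt1 w else muckenhoupt_gt1 p w.

Definition reverse_hoelder (r : R) (w : heis -> R) : Prop :=
  exists C : R, forall (x : heis) (rho : R), 0 < rho ->
    ((average (hball x rho) (fun y => (w y `^ r)%:E)) `^ r^-1
     <= C%:E * average (hball x rho) (fun y => (w y)%:E))%E.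
Definition critical_index (w : heis -> R) : \bar R :=
  ereal_sup [set r%:E | r in [set r : R | 1 < r /\ reverse_hoelder r w]].

Definition wLnorm (q : R) (w : heis -> R) (f : heis -> R[i]) : \bar R :=
  ((\int[heis_lebesgue]_x (ComplexField.Normc.normc (f x) `^ q * w x)%:E) `^ q^-1)%E.
Definition wLloc (q : R) (w : heis -> R) (f : heis -> R[i]) : Prop :=
  ae_measurableC heis_lebesgue f /\
  forall K : set heis, hcompact K -> ~ K hzero ->
    (\int[heis_lebesgue]_(x in K) (ComplexField.Normc.normc (f x) `^ q * w x)%:E < +oo)%E.

Definition herz_norm (a p q : R) (w : heis -> R) (f : heis -> R[i]) : \bar R :=
  ((\esum_(k in [set: int])
     ((wmeasure w (dyadic_ball k)) `^ (a * p / hdim%:R) *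
      (wLnorm q w (patch (fun=> 0%R) (dyadic_shell k) f)) `^ p)) `^ p^-1)%E.
Definition herz (a p q : R) (w : heis -> R) (f : heis -> R[i]) : Prop :=
  wLloc q w f /\ (herz_norm a p q w f < +oo)%E.

Definition hausdorff_integrand (Phi : heis -> R) (Omega f : heis -> R[i])
    (x y : heis) : R[i] :=
  (Phi (hdil (hnorm y)^-1 x) / hnorm y ^+ hdim)%:C%C
  * Omega (hdil (hnorm y)^-1 y) * f y.
Definition hausdorff (Phi : heis -> R) (Omega f : heis -> R[i]) (x : heis) :
    R[i] :=
  cintegral (hausdorff_integrand Phi Omega f x).

Definition hausdorff_bounded (Phi : heis -> R) (Omega : heis -> R[i])
    (w : heis -> R) (a1 p1 q1 a2 p2 q2 : R) : Prop :=
  exists C : R, forall f : heis -> R[i], herz a1 p1 q1 w f ->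
    [/\ {ae heis_lebesgue, forall x,
          abs_integrable (hausdorff_integrand Phi Omega f x)},
        herz a2 p2 q2 w (hausdorff Phi Omega f) &
        (herz_norm a2 p2 q2 w (hausdorff Phi Omega f)
         <= C%:E * herz_norm a1 p1 q1 w f)%E].

(* sigma stands for the measure of the unit sphere, extended by 0 to H^n (see
   polar_measure), so this is membership in L^s(S_(Q-1)). *)
Definition sphere_Lp (sigma : {measure set heis -> \bar R}) (s : \bar R)
    (Omega : heis -> R[i]) : Prop :=
  ae_measurableC sigma Omega /\
  (Lnorm sigma s (fun y => (ComplexField.Normc.normc (Omega y))%:E) < +oo)%E.

End heisenberg.

(* Main.v *)
Require Import Defs.
From HB Require Import structures.
From mathcomp Require Import all_boot all_order all_algebra.
From mathcomp Require Import all_classical all_reals all_analysis.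
From mathcomp Require Import measurable_realfun complex.
From mathcomp Require Import ring lra zify.

Set Implicit Arguments.
Unset Strict Implicit.
Unset Printing Implicit Defensive.

Import Order.TTheory GRing.Theory Num.Theory.
Import numFieldNormedType.Exports.

Local Open Scope classical_set_scope.
Local Open Scope ring_scope.

(** Write beta for the common value of 1/qs + alphas/Q and 1/q + alpha/Q, let
    m = qs/zeta, and write V_k and W_k for the volume and the weight of the ball
    of radius 2^k.  In polar coordinates the image of f is dominated by a constant
    times F(x), the integral over t in (0, oo) of phi(t)/t times the spherical
    integral of |Omega(y) f(delta_(|x|/t) y)| (hausdorff_polar).

    The norm of F on the shell C_k is estimated in four steps.
    - The hypothesis on qs says that the conjugate exponent of m/q is below the
      critical index, so the reverse Hoelder inequality for that exponent turns
      the weighted L^q norm into an L^m norm, with the factor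
      V_k^(-1/m) W_k^(1/q) (weighted_norm_le).
    - Minkowski's inequality moves the L^m norm inside the integral over t
      (minkowski_integral).
    - For each t, Hoelder's inequality on the sphere, where Omega is integrable to
      the power m', and dilation bound the L^m norm on C_k of the spherical
      integral by that of f on the set where |x| lies between 2^(k-1)/t and 2^k/t
      (sphere_hoelder_shell).  If 2^(j-1) < t <= 2^j, this set is covered by the
      two shells of index k - j and k - j + 1.
    - The A_zeta condition, in the form (average of g)^zeta <= C (weighted average
      of g^zeta), turns this L^m norm back into a weighted L^qs norm
      (unweighted_norm_le).

    All powers of volumes and of t cancel, and a power beta of the ratio of the
    weights of two balls, whose radii have ratio about t, remains.  The weight of
    a ball grows at most like the power Q zeta of the radius by the A_zeta
    condition (wball_doubling), and at least like the power Q (delta - 1)/delta by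
    the reverse Hoelder inequality (wball_decay).  So that factor is at most a
    constant times theta(t), the power of t that occurs in the constant of the
    theorem; which growth property acts for small t and which for large t depends
    on the sign of beta, and this is the difference between the two parts of the
    theorem (ratio_kernel_power_ge0, ratio_kernel_power_lt0).

    Hence the k-th term of the Herz norm of F is at most a constant times the
    integral of phi(t) theta(t)/t times b_(k-j) + b_(k-j+1), where b is the
    sequence of the terms of the Herz norm of f and j depends on t
    (hausdorff_shell_bound).  This is a convolution with a finite measure, so
    Jensen's inequality and summation over k conclude (convolution_sum).

    The given functions are only almost everywhere equal to Borel functions.  Null
    sets of points, of directions and of radii are all carried to null sets by
    polar coordinates, so that each of the functions can be replaced by a Borel
    version; for phi this version is a spherical mean (radial_ae_measurable).
    The finiteness of the critical index excludes a weight that vanishes almost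
    everywhere; thus balls have positive weight and the weight is positive almost
    everywhere, which yields the finiteness of F almost everywhere. *)

(** * Integrals of functions that are almost everywhere measurable *)

Section integral_without_measurability.
Local Open Scope ereal_scope.
Context d (T : measurableType d) (R : realType).
Variable mu : {measure set T -> \bar R}.

(** The integral of a nonnegative function is the supremum of the integrals of
    the simple functions below it, and a larger function has more of them. *)
Lemma le_integral_pointwise (D : set T) (f g : T -> \bar R) :
  (forall x, D x -> 0 <= f x) -> (forall x, D x -> f x <= g x) ->
  \int[mu]_(x in D) f x <= \int[mu]_(x in D) g x.
Proof.
move=> f0 fg.
have g0 x : D x -> 0 <= g x by move=> Dx; exact: le_trans (f0 _ Dx) (fg _ Dx).
rewrite !ge0_integralE//; apply: ge_ereal_sup => _ [h/= hf] <-.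
apply: ereal_sup_ubound; exists h => //= x; apply: (le_trans (hf x)).
by rewrite !patchE; case: ifPn => // /set_mem; exact: fg.
Qed.

(** The integral of f is squeezed between those of g plus infinity times the
    indicator of the null set and of g restricted to the complement of that set,
    which are both measurable and have the integral of g. *)
Lemma ge0_ae_eq_integral_measurable_r (D : set T) (f g : T -> \bar R) :
  measurable D -> measurable_fun D g ->
  (forall x, D x -> 0 <= f x) -> (forall x, D x -> 0 <= g x) ->
  {ae mu, forall x, D x -> f x = g x} ->
  \int[mu]_(x in D) f x = \int[mu]_(x in D) g x.
Proof.
move=> mD mg f0 g0 [N [mN N0 subN]].
have fgN x : D x -> ~ N x -> f x = g x.
  by move=> Dx Nx; apply: contrapT => fgx; apply: Nx; apply: subN => /(_ Dx).
apply/eqP; rewrite eq_le; apply/andP; split.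
- pose g' := fun x => g x + (if x \in N then +oo else 0).
  have mg' : measurable_fun D g'.
    apply: emeasurable_funD => //.
    rewrite -[X in measurable_fun _ X]/((cst +oo : T -> \bar R) \_ N).
    apply: (measurable_funS measurableT) => //.
    exact/(measurable_restrictT _ mN)/measurable_cst.
  have g'0 x : D x -> 0 <= g' x.
    by move=> Dx; rewrite adde_ge0 ?g0//; case: ifPn.
  rewrite (ge0_ae_eq_integral (g:=g') mD mg mg' g0 g'0); last first.
    exists N; split => // x /= /not_implyP[Dx gg']; apply: contrapT => Nx.
    by apply: gg'; rewrite /g' memNset// adde0.
  apply: le_integral_pointwise => // x Dx; rewrite /g'.
  case: ifPn => [_|/negP xN]; first by rewrite addey ?leey// gt_eqF// (lt_le_trans _ (g0 _ Dx)).
  by rewrite adde0 fgN// => Nx; apply: xN; rewrite inE.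
- rewrite (ge0_negligible_integral mN mD mg g0 N0).
  rewrite [leRHS]integral_mkcond [leLHS]integral_mkcond.
  apply: le_integral_pointwise => x _; rewrite !patchE.
    by case: ifPn => // /set_mem[Dx _]; exact: g0.
  case: ifPn => [/set_mem[Dx Nx]|_]; first by rewrite mem_set// fgN.
  by case: ifPn => // /set_mem; exact: f0.
Qed.

Lemma ge0_integral_eq0_ae (D : set T) (f : T -> \bar R) :
  measurable D -> measurable_fun D f -> (forall x, D x -> 0 <= f x) ->
  \int[mu]_(x in D) f x = 0 -> {ae mu, forall x, D x -> f x = 0}.
Proof.
move=> mD mf f0 If.
have /(ae_eq_integral_abs mu mD mf) : \int[mu]_(x in D) `|f x| = 0.
  by rewrite -If; apply: eq_integral => x /set_mem Dx; rewrite gee0_abs// f0.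
by [].
Qed.

Lemma ge0_integral_ae0 (D : set T) (f : T -> \bar R) :
  measurable D -> (forall x, D x -> 0 <= f x) ->
  {ae mu, forall x, D x -> f x = 0} -> \int[mu]_(x in D) f x = 0.
Proof.
move=> mD f0 fae; rewrite -(integral0 mu D).
exact: (ge0_ae_eq_integral_measurable_r mD (measurable_cst _) f0).
Qed.

(** The maximum of f and g is almost everywhere g, and it dominates f. *)
Lemma ae_le_integral_measurable_r (f g : T -> \bar R) :
  measurable_fun setT g -> (forall x, 0 <= f x) -> (forall x, 0 <= g x) ->
  {ae mu, forall x, f x <= g x} -> \int[mu]_x f x <= \int[mu]_x g x.
Proof.
move=> mg f0 g0 fg.
rewrite -(@ge0_ae_eq_integral_measurable_r setT
  (fun x => maxe (f x) (g x)) g measurableT mg) => //; last 2 first.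
- by move=> x _; rewrite le_max f0.
- by apply: filterS fg => x fgx _; apply/max_idPr.
by apply: le_integral_pointwise => x _; [exact: f0|rewrite le_max lexx].
Qed.

Lemma ae_eq_integral_measurable_r (f g : T -> \bar R) :
  measurable_fun setT g -> {ae mu, forall x, f x = g x} ->
  \int[mu]_x f x = \int[mu]_x g x.
Proof.
move=> mg fg; rewrite integralE [RHS]integralE; congr (_ - _).
- apply: ge0_ae_eq_integral_measurable_r => //; first exact: measurable_funepos.
  by apply: filterS fg => x fgx _; rewrite !unlock fgx.
- apply: ge0_ae_eq_integral_measurable_r => //; first exact: measurable_funeneg.
  by apply: filterS fg => x fgx _; rewrite !unlock fgx.
Qed.

End integral_without_measurability.

(** * Tonelli's theorem on products of subsets *)

Section tonelli_on_sets.
Local Open Scope ereal_scope.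
Context d1 d2 (X : measurableType d1) (Y : measurableType d2) (R : realType).
Variables (mu : {sigma_finite_measure set X -> \bar R})
  (nu : {sigma_finite_measure set Y -> \bar R}).
Variables (D : set X) (E : set Y) (f : X * Y -> \bar R).
Hypotheses (mD : measurable D) (mE : measurable E)
  (mf : measurable_fun setT f) (f0 : forall z, 0 <= f z).

Let mfR : measurable_fun setT (f \_ (D `*` E)).
Proof.
exact/(measurable_restrictT _ (measurableX mD mE))/measurable_funTS.
Qed.

Let fR0 z : 0 <= (f \_ (D `*` E)) z.
Proof. by rewrite patchE; case: ifPn. Qed.

Lemma tonelli_on_sets :
  \int[mu]_(x in D) \int[nu]_(y in E) f (x, y) =
  \int[nu]_(y in E) \int[mu]_(x in D) f (x, y).
Proof.
transitivity (\int[mu]_x \int[nu]_y (f \_ (D `*` E)) (x, y)).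
  rewrite integral_mkcond; apply: eq_integral => x _; rewrite patchE.
  case: ifPn => [/set_mem Dx|xD].
    rewrite integral_mkcond; apply: eq_integral => y _.
    by rewrite !patchE in_setX (mem_set Dx).
  by rewrite integral0_eq// => y _; rewrite patchE in_setX (negbTE xD).
rewrite fubini_tonelli// [RHS]integral_mkcond.
apply: eq_integral => y _; rewrite patchE.
case: ifPn => [/set_mem Ey|yE].
  rewrite [RHS]integral_mkcond; apply: eq_integral => x _.
  by rewrite !patchE in_setX (mem_set Ey) andbT.
by rewrite integral0_eq// => x _; rewrite patchE in_setX (negbTE yE) andbF.
Qed.

End tonelli_on_sets.

Lemma measurable_fun_integral2 d1 d2 (X : measurableType d1)
    (Y : measurableType d2) (R : realType)
    (nu : {sigma_finite_measure set Y -> \bar R})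
    (E : set Y) (f : X * Y -> \bar R) :
  measurable E -> measurable_fun setT f -> (forall z, 0 <= f z)%E ->
  measurable_fun setT (fun x => \int[nu]_(y in E) f (x, y))%E.
Proof.
move=> mE mf f0.
have mfR : measurable_fun setT (f \_ (setT `*` E)).
  exact/(measurable_restrictT _ (measurableX measurableT mE))/measurable_funTS.
have -> : (fun x => \int[nu]_(y in E) f (x, y))%E =
    fubini_F nu (f \_ (setT `*` E)).
  apply/funext => x; rewrite /fubini_F [LHS]integral_mkcond.
  by apply: eq_integral => y _; rewrite !patchE in_setX in_setT.
by apply: measurable_fun_fubini_tonelli_F => // z; rewrite patchE; case: ifPn.
Qed.


(** * The inequalities of Jensen, Hoelder and Minkowski *)

Section jensen_hoelder_minkowski.
Local Open Scope ereal_scope.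
Context (R : realType).

(** Young's inequality for a and l ^ (p - 1): by convexity of the power, its
    graph lies above the tangent line at l. *)
Lemma powR_tangent (p l a : R) : (1 < p)%R -> (0 <= l)%R -> (0 <= a)%R ->
  (p * l `^ (p - 1) * a <= a `^ p + (p - 1) * l `^ p)%R.
Proof.
move=> p1 l0 a0.
have p0 : (0 < p)%R by exact: lt_trans p1.
have pm1 : (0 < p - 1)%R by rewrite subr_gt0.
have q0 : (0 < p / (p - 1))%R by rewrite divr_gt0.
have := @conjugate_powR R a (l `^ (p - 1))%R p (p / (p - 1))%R a0 (powR_ge0 _ _) p0 q0.
have -> : (p^-1 + (p / (p - 1))^-1 = 1)%R.
  by rewrite invf_div; field; rewrite (gt_eqF p0).
move=> /(_ erefl).
have pE : ((p - 1) * (p / (p - 1)) = p)%R by rewrite mulrC divfK// gt_eqF.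
rewrite -powRrM mulrC pE.
rewrite -(ler_pM2l p0) mulrDr invf_div.
rewrite (_ : p * (l `^ p * ((p - 1) / p)) = (p - 1) * l `^ p)%R; last first.
  by field; rewrite gt_eqF.
rewrite (_ : p * (a `^ p / p) = a `^ p)%R; last by field; rewrite gt_eqF.
by rewrite mulrA.
Qed.

Lemma poweR_tangent (p l : R) (a : \bar R) : (1 < p)%R -> (0 <= l)%R -> 0 <= a ->
  (p * l `^ (p - 1))%:E * a <= a `^ p + ((p - 1) * l `^ p)%:E.
Proof.
move=> p1 l0; case: a => [a a0|_|//].
  by rewrite poweR_EFin -EFinM -EFinD lee_fin powR_tangent.
by rewrite poweRyr ?gt_eqF ?(lt_trans _ p1)// addye// leey.
Qed.

Section jensen.
Context d (T : measurableType d) (mu : {measure set T -> \bar R}).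
Variables (D : set T) (mD : measurable D).

(** Integrating the tangent inequality at the mean value of h with respect to
    the weight m is Jensen's inequality. *)
Lemma jensen_poweR (p : R) (m : T -> R) (h : T -> \bar R) :
  (1 <= p)%R -> measurable_fun D m -> measurable_fun D h ->
  (forall x, D x -> (0 <= m x)%R) -> (forall x, D x -> 0 <= h x) ->
  (\int[mu]_(x in D) ((m x)%:E * h x)) `^ p <=
  (\int[mu]_(x in D) (m x)%:E) `^ (p - 1) *
  \int[mu]_(x in D) ((m x)%:E * h x `^ p).
Proof.
move=> p1 mm mh m0 h0.
have mmE : measurable_fun D (EFin \o m) by exact/measurable_EFinP.
have mhp : measurable_fun D (fun x => h x `^ p).
  exact: (measurableT_comp (measurable_poweR _)).
move: p1; rewrite le_eqVlt => /predU1P[<-|p1].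
  rewrite subrr poweRe0 mul1e poweRe1; last first.
    by apply: integral_ge0 => x Dx; rewrite mule_ge0 ?lee_fin ?m0 ?h0.
  apply: le_integral_pointwise => x Dx; first by rewrite mule_ge0 ?lee_fin ?m0 ?h0.
  by rewrite poweRe1// h0.
set I := \int[mu]_(x in D) ((m x)%:E * h x).
set M := \int[mu]_(x in D) (m x)%:E.
set J := \int[mu]_(x in D) ((m x)%:E * h x `^ p).
have p0 : (0 < p)%R by exact: lt_trans p1.
have pm1 : (0 < p - 1)%R by rewrite subr_gt0.
have I0 : 0 <= I by apply: integral_ge0 => x Dx; rewrite mule_ge0 ?lee_fin ?m0 ?h0.
have M0 : 0 <= M by apply: integral_ge0 => x Dx; rewrite lee_fin m0.
have J0 : 0 <= J.
  by apply: integral_ge0 => x Dx; rewrite mule_ge0 ?lee_fin ?m0 ?poweR_ge0.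
have key l : (0 <= l)%R ->
    (p * l `^ (p - 1))%:E * I <= J + ((p - 1) * l `^ p)%:E * M.
  move=> l0; rewrite /I -ge0_integralZl//; last 3 first.
  - exact: emeasurable_funM.
  - by move=> x Dx; rewrite mule_ge0 ?lee_fin ?m0 ?h0.
  - by rewrite lee_fin mulr_ge0 ?powR_ge0 ?ltW.
  rewrite /M -ge0_integralZl//; last by rewrite lee_fin mulr_ge0 ?powR_ge0 ?ltW.
  rewrite /J -ge0_integralD//; last 4 first.
  - by move=> x Dx; rewrite mule_ge0 ?lee_fin ?m0 ?poweR_ge0.
  - exact: emeasurable_funM.
  - by move=> x Dx; rewrite mule_ge0 ?lee_fin ?m0// mulr_ge0 ?powR_ge0 ?ltW.
  - exact: emeasurable_funM.
  apply: le_integral_pointwise => x Dx.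
    by rewrite !mule_ge0 ?lee_fin ?m0 ?h0// mulr_ge0 ?powR_ge0 ?ltW.
  rewrite muleCA (muleC _%:E (m x)%:E) -ge0_muleDr ?poweR_ge0//; last first.
    by rewrite lee_fin mulr_ge0 ?powR_ge0 ?ltW.
  by rewrite lee_wpmul2l ?lee_fin ?m0// poweR_tangent// h0.
have [M_0|M_neq0] := eqVneq M 0.
  suff -> : I = 0.
    by rewrite M_0 !poweR0r ?gt_eqF// mul0e.
  have m_ae : {ae mu, forall x, D x -> (m x)%:E = 0}.
    by apply: ge0_integral_eq0_ae => // x Dx; rewrite lee_fin m0.
  apply: ge0_integral_ae0 => // [x Dx|]; first by rewrite mule_ge0 ?lee_fin ?m0 ?h0.
  by apply: filterS m_ae => x mx Dx; rewrite mx// mul0e.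
have Mgt0 : 0 < M by rewrite lt0e M_neq0.
have [Moo|M_fin] := eqVneq M +oo.
  have [J_0|J_neq0] := eqVneq J 0; last first.
    by rewrite Moo poweRyr ?gt_eqF// gt0_mulye ?leey// lt0e J_neq0.
  suff -> : I = 0 by rewrite poweR0r ?gt_eqF// mule_ge0// poweR_ge0.
  have mh_ae : {ae mu, forall x, D x -> (m x)%:E * h x `^ p = 0}.
    apply: ge0_integral_eq0_ae => // [|x Dx]; first exact: emeasurable_funM.
    by rewrite mule_ge0 ?lee_fin ?m0 ?poweR_ge0.
  apply: ge0_integral_ae0 => // [x Dx|]; first by rewrite mule_ge0 ?lee_fin ?m0 ?h0.
  apply: filterS mh_ae => x mx Dx; have /eqP := mx Dx.
  rewrite mule_eq0 => /orP[/eqP ->|]; first by rewrite mul0e.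
  by rewrite poweR_eq0 ?h0// => /andP[/eqP -> _]; rewrite mule0.
have Mf : M = (fine M)%:E by rewrite fineK// ge0_fin_numE// ltey.
have [Joo|J_fin] := eqVneq J +oo.
  by rewrite Joo gt0_muley ?leey// poweR_gt0.
have Jf : J = (fine J)%:E by rewrite fineK// ge0_fin_numE// ltey.
have fM0 : (0 < fine M)%R by rewrite fine_gt0// Mgt0 ltey.
have If : I = (fine I)%:E.
  rewrite fineK// ge0_fin_numE//.
  have := key 1%R ler01; rewrite !powR1 !mulr1 => Ile.
  rewrite ltey; apply/eqP => Ioo; move: Ile; rewrite Ioo gt0_muley ?lte_fin//.
  by rewrite Mf Jf -EFinM -EFinD leye_eq.
have fI0 : (0 <= fine I)%R by rewrite fine_ge0.
have := key (fine I / fine M)%R (divr_ge0 fI0 (ltW fM0)).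
move: If Mf Jf fM0 fI0; clearbody I M J.
move: (fine I) (fine M) (fine J) => i M' J' -> -> -> fM0 fI0.
rewrite -?EFinM -?EFinD ?poweR_EFin -?EFinM !lee_fin.
have invE r : ((i / M') `^ r = i `^ r / M' `^ r)%R.
  rewrite powRM ?invr_ge0 ?(ltW fM0)// -(powR_inv1 (ltW fM0)) -powRrM mulN1r.
  by rewrite powRN.
rewrite !invE -(mulr_powRB1 fI0 p0) -(mulr_powRB1 (ltW fM0) p0).
set a := (i `^ (p - 1))%R; set b := (M' `^ (p - 1))%R => H.
have b0 : (0 < b)%R by rewrite powR_gt0.
have -> : (i * a = b * (i * a / b))%R by field; rewrite gt_eqF.
rewrite ler_pM2l//.
have -> : (i * a / b = p * (a / b) * i - (p - 1) * (i * a / (M' * b)) * M')%R.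
  by field; rewrite !gt_eqF.
by rewrite lerBlDr.
Qed.

(** Jensen's inequality for the weight g ^ p' and the function f / g ^ (p' - 1)
    is Hoelder's inequality in power form. *)
Lemma hoelder_poweR (p : R) (f : T -> \bar R) (g : T -> R) :
  (1 < p)%R -> measurable_fun D f -> measurable_fun D g ->
  (forall x, D x -> 0 <= f x) -> (forall x, D x -> (0 <= g x)%R) ->
  (\int[mu]_(x in D) (f x * (g x)%:E)) `^ p <=
  (\int[mu]_(x in D) (g x `^ (p / (p - 1)))%:E) `^ (p - 1) *
  \int[mu]_(x in D) (f x `^ p).
Proof.
move=> p1 mf mg f0 g0.
have p0 : (0 < p)%R by exact: lt_trans p1.
have pm1 : (0 < p - 1)%R by rewrite subr_gt0.
pose q := (p / (p - 1))%R.
have q0 : (0 < q)%R by rewrite divr_gt0.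
pose m x := (g x `^ q)%R.
pose h x := f x * (g x `^ (1 - q))%:E.
have mm : measurable_fun D m.
  exact: (measurableT_comp (measurable_powR _)).
have mh : measurable_fun D h.
  apply: emeasurable_funM => //; apply/measurable_EFinP.
  exact: (measurableT_comp (measurable_powR _)).
have mfp : measurable_fun D (fun x => f x `^ p).
  exact: (measurableT_comp (measurable_poweR _)).
have m0 x : D x -> (0 <= m x)%R by move=> _; exact: powR_ge0.
have h0 x : D x -> 0 <= h x by move=> Dx; rewrite mule_ge0 ?f0 ?lee_fin ?powR_ge0.
have := jensen_poweR (ltW p1) mm mh m0 h0.
have -> : \int[mu]_(x in D) ((m x)%:E * h x) = \int[mu]_(x in D) (f x * (g x)%:E).
  apply: eq_integral => x /set_mem Dx; rewrite /h /m muleCA -EFinM; congr (_ * _%:E).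
  have [->|gx0] := eqVneq (g x) 0%R; first by rewrite (@powR0 _ q) ?mul0r// gt_eqF.
  by rewrite -powRD ?gx0 ?implybT// subrKC powRr1// g0.
move=> /le_trans; apply.
rewrite lee_wpmul2l ?poweR_ge0//; apply: le_integral_pointwise => x Dx.
  by rewrite mule_ge0 ?lee_fin ?powR_ge0 ?poweR_ge0.
rewrite /h poweRM ?f0 ?lee_fin ?powR_ge0// poweR_EFin muleCA -EFinM -powRrM.
have -> : ((1 - q) * p = - q)%R by rewrite /q; field; rewrite gt_eqF.
have [gx0|gx0] := eqVneq (g x) 0%R.
  by rewrite /m gx0 powR0 ?gt_eqF// mul0r mule0 poweR_ge0.
by rewrite -powRD ?gx0 ?implybT// subrr powRr0 mule1.
Qed.

End jensen.
End jensen_hoelder_minkowski.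

Lemma le_poweR (R : realType) (r : R) (x y : \bar R) :
  0 <= r -> (0 <= x)%E -> (x <= y)%E -> (x `^ r <= y `^ r)%E.
Proof.
move=> r0 x0 xy; apply: gt0_ler_poweR => //; rewrite in_itv/= leey andbT//.
exact: le_trans xy.
Qed.

Section minkowski.
Local Open Scope ereal_scope.
Context (R : realType) d1 d2 (X : measurableType d1) (Y : measurableType d2).
Variables (mu : {sigma_finite_measure set X -> \bar R})
  (nu : {sigma_finite_measure set Y -> \bar R}).
Variables (D : set X) (E : set Y) (mD : measurable D) (mE : measurable E).

(* Jensen's inequality for the density phi * d and the function H / d, followed
   by Tonelli's theorem. *)
Let minkowski_pos (p : R) (phi d : Y -> R) (H : X * Y -> \bar R) :
  (1 <= p)%R -> measurable_fun setT phi -> measurable_fun setT d ->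
  measurable_fun setT H ->
  (forall y, (0 <= phi y)%R) -> (forall y, (0 < d y)%R) -> (forall z, 0 <= H z) ->
  (forall y, E y -> \int[mu]_(x in D) (H (x, y) `^ p) <= (d y `^ p)%:E) ->
  \int[mu]_(x in D) ((\int[nu]_(y in E) ((phi y)%:E * H (x, y))) `^ p) <=
  (\int[nu]_(y in E) (phi y * d y)%:E) `^ p.
Proof.
move=> p1 mphi md mH phi0 d0 H0 Hd.
have p0 : (0 < p)%R by exact: lt_le_trans p1.
set A := \int[nu]_(y in E) (phi y * d y)%:E.
have A0 : 0 <= A by apply: integral_ge0 => y _; rewrite lee_fin mulr_ge0// ltW.
pose m y := (phi y * d y)%R.
pose h x y := H (x, y) * ((d y)^-1)%:E.
have mm : measurable_fun setT m by exact: measurable_funM.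
have mdV : measurable_fun setT (fun y => (d y)^-1)%R.
  rewrite (_ : (fun y => _) = (fun y => (d y) `^ (-1))%R); last first.
    by apply/funext => y; rewrite powR_inv1// ltW.
  exact: (measurableT_comp (measurable_powR _)).
pose K (z : X * Y) := (phi z.2 * d z.2 `^ (1 - p))%:E * (H z `^ p).
have mK : measurable_fun setT K.
  apply: emeasurable_funM.
    apply/measurable_EFinP; apply: measurable_funM.
      exact: (measurableT_comp mphi).
    apply: (measurableT_comp (measurable_powR _)).
    exact: (measurableT_comp md).
  exact: (measurableT_comp (measurable_poweR _)).
have K0 z : 0 <= K z by rewrite mule_ge0 ?poweR_ge0 ?lee_fin ?mulr_ge0 ?powR_ge0.
have mHx x : measurable_fun setT (fun y => H (x, y)).
  by apply: (measurableT_comp mH); exact: measurable_pair1.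
have mHy y : measurable_fun setT (fun x => H (x, y)).
  by apply: (measurableT_comp mH); exact: measurable_pair2.
have step1 x : (\int[nu]_(y in E) ((phi y)%:E * H (x, y))) `^ p <=
    A `^ (p - 1) * \int[nu]_(y in E) K (x, y).
  have := @jensen_poweR R _ Y nu E mE p m (h x) p1.
  have -> : \int[nu]_(y in E) ((m y)%:E * h x y) =
      \int[nu]_(y in E) ((phi y)%:E * H (x, y)).
    apply: eq_integral => y _; rewrite /m /h muleCA -EFinM muleC.
    by rewrite mulfK ?gt_eqF.
  have -> : \int[nu]_(y in E) ((m y)%:E * h x y `^ p) =
      \int[nu]_(y in E) K (x, y).
    apply: eq_integral => y _; rewrite /m /h /K poweRM//; last first.
      by rewrite lee_fin invr_ge0 ltW.
    rewrite muleCA -EFinM [RHS]muleC/=; congr (_ * _%:E).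
    rewrite -mulrA; congr (_ * _)%R.
    rewrite -(powR_inv1 (ltW (d0 y))) -powRrM mulN1r.
    by rewrite -{1}(powRr1 (ltW (d0 y))) -powRD ?(gt_eqF (d0 y)) ?implybT.
  apply.
  - exact: measurable_funTS.
  - apply: measurable_funTS; apply: emeasurable_funM => //.
    exact/measurable_EFinP.
  - by move=> y _; rewrite mulr_ge0// ltW.
  - by move=> y _; rewrite mule_ge0// lee_fin invr_ge0 ltW.
have [Aoo|Aoo] := eqVneq A +oo; first by rewrite Aoo poweRyr ?leey// gt_eqF.
have Af : A \is a fin_num by rewrite ge0_fin_numE// ltey.
have mIK : measurable_fun setT (fun x => \int[nu]_(y in E) K (x, y)).
  exact: measurable_fun_integral2.
apply: (@le_trans _ _ (\int[mu]_(x in D)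
    (A `^ (p - 1) * \int[nu]_(y in E) K (x, y)))).
  by apply: le_integral_pointwise => x _; [exact: poweR_ge0|exact: step1].
rewrite ge0_integralZl ?poweR_ge0//; last 2 first.
  - exact: measurable_funTS.
  - by move=> x _; exact: integral_ge0.
rewrite tonelli_on_sets//.
have -> : A `^ p = A `^ (p - 1) * A.
  rewrite -{3}(poweRe1 A0) -poweRD ?subrK// add_neq0_poweRD_def//.
  by rewrite subrK gt_eqF.
rewrite lee_wpmul2l ?poweR_ge0//.
apply: le_integral_pointwise => y Ey; first exact: integral_ge0.
rewrite /K/= ge0_integralZl ?lee_fin ?mulr_ge0 ?powR_ge0//; last 2 first.
- apply: measurable_funTS.
  by apply: (measurableT_comp (measurable_poweR _)).
- by move=> x _; exact: poweR_ge0.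
apply: (le_trans (lee_wpmul2l _ (Hd _ Ey))).
  by rewrite lee_fin mulr_ge0// powR_ge0.
rewrite -EFinM lee_fin -mulrA ler_wpM2l// -powRD; last first.
  by rewrite (gt_eqF (d0 y)) implybT.
by rewrite subrK powRr1// ltW.
Qed.

(** If the bounds d of the norms of the sections are positive, then Jensen's
    inequality for the measure with density phi * d gives Minkowski's integral
    inequality.  A small constant added to d, of total weight at most e, reduces
    the general case to this one. *)
Lemma minkowski_integral (p : R) (phi d : Y -> R) (H : X * Y -> \bar R) :
  (1 <= p)%R -> measurable_fun setT phi -> measurable_fun setT d ->
  measurable_fun setT H ->
  (forall y, (0 <= phi y)%R) -> (forall y, (0 <= d y)%R) -> (forall z, 0 <= H z) ->
  \int[nu]_(y in E) (phi y)%:E < +oo ->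
  (forall y, E y -> \int[mu]_(x in D) (H (x, y) `^ p) <= (d y `^ p)%:E) ->
  \int[mu]_(x in D) ((\int[nu]_(y in E) ((phi y)%:E * H (x, y))) `^ p) <=
  (\int[nu]_(y in E) (phi y * d y)%:E) `^ p.
Proof.
move=> p1 mphi md mH phi0 d0 H0 phioo Hd.
have p0 : (0 < p)%R by exact: lt_le_trans p1.
set I := \int[mu]_(x in D) _; set A := \int[nu]_(y in E) (phi y * d y)%:E.
set B := \int[nu]_(y in E) (phi y)%:E.
have I0 : 0 <= I by apply: integral_ge0 => x _; exact: poweR_ge0.
have B0 : 0 <= B by apply: integral_ge0 => y _; rewrite lee_fin.
have BE : B = (fine B)%:E by rewrite fineK// ge0_fin_numE.
have fB0 : (0 <= fine B)%R by rewrite fine_ge0.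
have -> : I = (I `^ p^-1) `^ p by rewrite -poweRrM mulVf ?gt_eqF// poweRe1.
apply: le_poweR; [exact: ltW|exact: poweR_ge0|].
apply/lee_addgt0Pr => e e0.
pose e' := (e / (fine B + 1))%R.
have e'0 : (0 < e')%R by rewrite divr_gt0// ltr_wpDl.
have IAe : I <= (A + e'%:E * B) `^ p.
  have := @minkowski_pos p phi (fun y => d y + e')%R H p1 mphi.
  have -> : \int[nu]_(y in E) (phi y * (d y + e'))%:E = A + e'%:E * B.
    rewrite -ge0_integralZl//; last 3 first.
    - exact/measurable_EFinP/measurable_funTS.
    - by move=> y _; rewrite lee_fin.
    - by rewrite lee_fin ltW.
    rewrite -ge0_integralD//.
    - by apply: eq_integral => y _; rewrite -EFinM -EFinD mulrDr (mulrC e').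
    - by move=> y _; rewrite lee_fin mulr_ge0.
    - by apply/measurable_EFinP/measurable_funTS; exact: measurable_funM.
    - by move=> y _; rewrite -EFinM lee_fin mulr_ge0// ltW.
    - by apply: emeasurable_funM => //; exact/measurable_EFinP/measurable_funTS.
  apply => //.
  - exact: measurable_funD.
  - by move=> y; rewrite ltr_wpDl.
  - move=> y Ey; apply: (le_trans (Hd y Ey)); rewrite lee_fin.
    by apply: ge0_ler_powR; rewrite ?nnegrE ?lerDl ?addr_ge0// ltW.
have A0 : 0 <= A by apply: integral_ge0 => y _; rewrite lee_fin mulr_ge0.
have AB0 : 0 <= A + e'%:E * B by rewrite adde_ge0// mule_ge0// lee_fin ltW.
apply: (@le_trans _ _ (A + e'%:E * B)).
  rewrite -[leRHS]poweRe1// -[X in _ <= _ `^ X](@mulfV _ p) ?gt_eqF// poweRrM.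
  by apply: le_poweR => //; rewrite invr_ge0 ltW.
rewrite leeD2l// BE -EFinM lee_fin /e' mulrAC ler_pdivrMr ?ltr_wpDl//.
by rewrite ler_wpM2l ?(ltW e0)// lerDl.
Qed.

End minkowski.

(** * The measure dt/t on the half-line *)

Lemma measurable_invr (R : realType) : measurable_fun setT (fun x : R => x^-1).
Proof.
rewrite (_ : (fun x => _) = (fun x : R => x * (x ^+ 2) `^ (-1))); last first.
  apply/funext => x; rewrite powR_inv1 ?sqr_ge0//.
  have [->|x0] := eqVneq x 0; first by rewrite invr0 mul0r.
  by rewrite expr2 invfM mulrA mulfV// mul1r.
apply: measurable_funM => //.
by apply: (measurableT_comp (measurable_powR _)); exact: measurable_funX.
Qed.

Section multiplicative_haar.
Context (R : realType).
Local Open Scope ereal_scope.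
Local Notation leb := (@lebesgue_measure R).
Local Notation RR := (measurableTypeR R).

(** Lebesgue measure and c times its image under the dilation agree on
    intervals. *)
Lemma integral_pos_dilation (c : R) (f : R -> \bar R) : (0 < c)%R ->
  measurable_fun setT f -> (forall x, 0 <= f x) ->
  \int[leb]_(r in `]0%R, +oo[) f (c * r)%R =
  (c^-1)%:E * \int[leb]_(r in `]0%R, +oo[) f r.
Proof.
move=> c0 mf f0.
have mc : measurable_fun setT (fun r : RR => (c * r)%R : RR).
  exact: measurable_funM.
pose nu : {measure set RR -> \bar R} :=
  measure_function_pushforward__canonical__measure_function_Measure leb mc.
have cN : (0 <= c)%R by exact: ltW.
pose nuc : {measure set RR -> \bar R} := [the measure _ _ of mscale (NngNum cN) nu].
have nuE (A : set RR) : measurable A -> leb A = nuc A.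
  apply: lebesgue_measure_unique => _ [[a b]] _ <-.
  rewrite /nuc/= /mscale/= /pushforward.
  have -> : (fun r => (c * r)%R) @^-1` [set` `]a, b]] =
      [set` `](a / c)%R, (b / c)%R]].
    by apply/seteqP; split=> x /=; rewrite !in_itv/=
      ltr_pdivrMr// ler_pdivlMr// (mulrC x).
  rewrite !lebesgue_measure_itv/= !lte_fin ltr_pM2r ?invr_gt0//.
  case: ifPn => ab; last by rewrite mule0.
  by rewrite -!EFinB -EFinM -mulrBl mulrC divfK ?gt_eqF.
rewrite [in RHS](eq_measure_integral nuc)/=; last by move=> A mA _; exact: nuE.
rewrite ge0_integral_mscale//=; last exact: measurable_funTS.
rewrite (ge0_integral_pushforward mc)//; last exact: measurable_funTS.
rewrite muleA -EFinM mulVf ?gt_eqF// mul1e.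
congr integral; apply/seteqP; split=> x /=; rewrite !in_itv/= !andbT.
  by move=> x0; rewrite mulr_gt0.
by rewrite pmulr_rgt0.
Qed.

Local Notation haar f := (\int[leb]_(t in `]0%R, +oo[) (f t * (t^-1)%:E)).

Let mV : measurable_fun setT (fun t : R => (t^-1)%:E : \bar R).
Proof. by apply/measurable_EFinP; exact: measurable_invr. Qed.

Let haar_dilation (c : R) (f : R -> \bar R) : (0 < c)%R ->
  measurable_fun setT f -> (forall x, 0 <= f x) ->
  haar (fun t => f (c * t)%R) = haar f.
Proof.
move=> c0 mf f0.
pose f' t := f t * (`|t|^-1)%:E.
have mf' : measurable_fun setT f'.
  apply: emeasurable_funM => //; apply/measurable_EFinP.
  by apply: (measurableT_comp (@measurable_invr R)).
have f'0 t : 0 <= f' t by rewrite mule_ge0// lee_fin invr_ge0.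
have -> : haar f = \int[leb]_(t in `]0%R, +oo[) f' t.
  apply: eq_integral => t; rewrite inE/= in_itv/= andbT => t0.
  by rewrite /f' gtr0_norm.
have := integral_pos_dilation c0 mf' f'0.
move=> /(congr1 (fun z => c%:E * z)); rewrite muleA -EFinM mulfV ?gt_eqF// mul1e.
move=> <-; rewrite -ge0_integralZl//; last 2 first.
- apply: measurable_funTS; apply: (measurableT_comp mf').
  exact: measurable_funM.
- by rewrite lee_fin ltW.
apply: eq_integral => t; rewrite inE/= in_itv/= andbT => t0.
rewrite /f' gtr0_norm ?mulr_gt0// muleCA -EFinM; congr (_ * _%:E).
by field; rewrite !gt_eqF.
Qed.

Let haar_swap (F : RR * RR -> \bar R) :
  measurable_fun setT F -> (forall z, 0 <= F z) ->
  haar (fun y => haar (fun x => F (y, x))) = haar (fun x => haar (fun y => F (y, x))).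
Proof.
move=> mF F0.
have mVabs (h : RR * RR -> R) : measurable_fun setT h ->
    measurable_fun setT (fun z => (`|h z|^-1)%:E : \bar R).
  move=> mh; apply/measurable_EFinP; apply: (measurableT_comp (@measurable_invr R)).
  exact: measurableT_comp.
pose G (z : RR * RR) := F z * (`|z.2|^-1)%:E * (`|z.1|^-1)%:E.
have mG : measurable_fun setT G.
  apply: emeasurable_funM; last exact: (mVabs _ measurable_fst).
  by apply: emeasurable_funM => //; exact: (mVabs _ measurable_snd).
have G0 z : 0 <= G z by rewrite !mule_ge0// lee_fin invr_ge0.
have pos (h : RR -> \bar R) : (forall t, 0 <= h t) ->
    forall t, `]0%R, +oo[%classic t -> 0 <= h t * (t^-1)%:E.
  by move=> h0 t; rewrite /= in_itv/= andbT => t0; rewrite mule_ge0// lee_fin invr_ge0 ltW.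
have mpos (h : RR -> \bar R) : measurable_fun setT h ->
    measurable_fun (`]0%R, +oo[%classic : set R) (fun t => h t * (t^-1)%:E).
  by move=> mh; apply: measurable_funTS; exact: emeasurable_funM.
have mFx x : measurable_fun setT (fun y => F (y, x)).
  exact: (measurableT_comp mF (measurable_pair2 x)).
have mFy y : measurable_fun setT (fun x => F (y, x)).
  exact: (measurableT_comp mF (measurable_pair1 y)).
transitivity (\int[leb]_(y in `]0%R, +oo[) \int[leb]_(x in `]0%R, +oo[) G (y, x)).
  apply: eq_integral => y; rewrite inE/= in_itv/= andbT => y0.
  rewrite -ge0_integralZr//; last 3 first.
  - exact: mpos.
  - exact: pos.
  - by rewrite lee_fin invr_ge0 ltW.
  apply: eq_integral => x; rewrite inE/= in_itv/= andbT => x0.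
  by rewrite /G/= !gtr0_norm.
rewrite tonelli_on_sets//; apply: eq_integral => x; rewrite inE/= in_itv/= andbT => x0.
rewrite -ge0_integralZr//; last 3 first.
- exact: (mpos (fun y => F (y, x))).
- exact: (pos (fun y => F (y, x))).
- by rewrite lee_fin invr_ge0 ltW.
apply: eq_integral => y; rewrite inE/= in_itv/= andbT => y0.
by rewrite /G/= !gtr0_norm// muleAC.
Qed.

(** Uniqueness of Haar measure on the multiplicative group: dt/t and its image
    under inversion are both dilation invariant, and comparing them through a
    double integral against one fixed test function shows them equal. *)
Lemma haar_inversion (g : R -> \bar R) :
  measurable_fun setT g -> (forall x, 0 <= g x) ->
  haar (fun t => g (t^-1)%R) = haar g.
Proof.
move=> mg g0.
pose chi (t : R) : \bar R := (\1_(`[1%R, 2%R]%classic : set R) t)%:E.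
have mchi : measurable_fun setT chi.
  by apply/measurable_EFinP; exact: measurable_indic.
have chi0 t : 0 <= chi t by rewrite lee_fin.
have mP : measurable (`]0%R, +oo[%classic : set R) by [].
have m1 : measurable_fun setT (fun z : RR * RR => z.1) by exact: measurable_fst.
have m2 : measurable_fun setT (fun z : RR * RR => z.2) by exact: measurable_snd.
have mgV : measurable_fun setT (fun t : R => g (t^-1)%R).
  exact: (measurableT_comp mg (@measurable_invr R)).
have mgx x : measurable_fun setT (fun t : R => g (x * t)%R).
  by apply: (measurableT_comp mg); exact: measurable_funM.
set I := haar chi.
have I0 : 0 <= I.
  apply: integral_ge0 => t; rewrite /= in_itv/= andbT => t0.
  by rewrite mule_ge0// lee_fin invr_ge0 ltW.
have gh0 (h : R -> \bar R) : (forall t, 0 <= h t) ->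
    forall t : R, `]0%R, +oo[%classic t -> 0 <= h t * (t^-1)%:E.
  move=> h0 t; rewrite /= in_itv/= andbT => t0.
  by rewrite mule_ge0// lee_fin invr_ge0 ltW.
have haar0 (h : R -> \bar R) : (forall t, 0 <= h t) -> 0 <= haar h.
  by move=> h0; apply: integral_ge0; exact: gh0.
have mh (h : R -> \bar R) : measurable_fun setT h ->
    measurable_fun (`]0%R, +oo[%classic : set R)
    (fun t : R => h t * (t^-1)%:E).
  by move=> ?; apply: measurable_funTS; exact: emeasurable_funM.
have E1 : I * haar (fun t => g (t^-1)%R) = I * haar g.
  transitivity (haar (fun y => haar (fun x => chi (y * x)%R * g (y^-1)%R))).
    rewrite -ge0_integralZl//; last 2 first.
    - exact: mh.
    - by apply: gh0.
    apply: eq_integral => y; rewrite inE/= in_itv/= andbT => y0.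
    rewrite muleA; congr (_ * _).
    under [in RHS]eq_integral do rewrite muleAC.
    rewrite ge0_integralZr//; last 2 first.
    - apply: mh; apply: (measurableT_comp mchi); exact: measurable_funM.
    - by apply: (gh0 (fun x => chi (y * x)%R)).
    by rewrite haar_dilation.
  transitivity (haar (fun x => haar (fun y => chi (y * x)%R * g (y^-1)%R))).
    apply: (haar_swap (F := fun z => chi (z.1 * z.2)%R * g ((z.1)^-1)%R)).
      apply: emeasurable_funM.
        by apply: (measurableT_comp mchi); exact: measurable_funM.
      by apply: (measurableT_comp mg); exact: (measurableT_comp (@measurable_invr R)).
    by move=> z; rewrite mule_ge0.
  transitivity (haar (fun x => haar (fun y => chi y * g (x / y)%R))).
    apply: eq_integral => x; rewrite inE/= in_itv/= andbT => x0.
    congr (_ * _).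
    rewrite -[RHS](@haar_dilation x (fun y => chi y * g (x / y)%R) x0)//; last 2 first.
    - apply: emeasurable_funM => //; apply: (measurableT_comp mg).
      by apply: measurable_funM => //; exact: measurable_invr.
    - by move=> y; rewrite mule_ge0.
    apply: eq_integral => y; rewrite inE/= in_itv/= andbT => y0.
    by rewrite (mulrC y x) invfM [in RHS]mulrA mulfV ?gt_eqF// mul1r.
  transitivity (haar (fun y => haar (fun x => chi y * g (x / y)%R))).
    apply/esym; apply: (haar_swap (F := fun z => chi z.1 * g (z.2 / z.1)%R)).
      apply: emeasurable_funM; first exact: (measurableT_comp mchi).
      apply: (measurableT_comp mg); apply: measurable_funM => //.
      exact: (measurableT_comp (@measurable_invr R)).
    by move=> z; rewrite mule_ge0.
  rewrite -ge0_integralZr//; last 3 first.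
  - exact: mh.
  - by apply: gh0.
  - by apply: haar0.
  apply: eq_integral => y; rewrite inE/= in_itv/= andbT => y0.
  rewrite muleAC; congr (_ * _).
  rewrite -(haar_dilation (c := y^-1) (f := g)) ?invr_gt0//.
  rewrite -ge0_integralZl//; last 2 first.
  - exact: mh.
  - by apply: (gh0 (fun x => g (y^-1 * x)%R)).
  by apply: eq_integral => x _; rewrite muleA (mulrC x).
have Ipos : 0 < I.
  apply: (@lt_le_trans _ _ (\int[leb]_(t in `[1%R, 2%R]) (2^-1)%:E)).
    rewrite integral_cst//= lebesgue_measure_itv/= lte_fin ltr1n -EFinB -EFinM lte_fin.
    by rewrite mulr_gt0// subr_gt0 ltr1n.
  rewrite integral_mkcond [leRHS]integral_mkcond.
  apply: le_integral_pointwise => t _; rewrite !patchE.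
    by case: ifPn.
  case: ifPn => [|_]; last first.
    case: ifPn => //; rewrite inE/= in_itv/= andbT => t0.
    by rewrite mule_ge0// lee_fin invr_ge0 ltW.
  rewrite inE/= in_itv/= => /andP[t1 t2].
  have t0 : (0 < t)%R by exact: lt_le_trans t1.
  rewrite mem_set/= ?in_itv/= ?t0// /chi indicE mem_set/= ?in_itv/= ?t1//.
  by rewrite mul1e lee_fin lef_pV2// posrE.
have Ifin : I < +oo.
  apply: (@le_lt_trans _ _ (\int[leb]_(t in `[1%R, 2%R]) 1)).
    rewrite [leLHS]integral_mkcond [leRHS]integral_mkcond.
    apply: le_integral_pointwise => t _; rewrite !patchE.
      case: ifPn => //; rewrite inE/= in_itv/= andbT => t0.
      by rewrite mule_ge0// lee_fin invr_ge0 ltW.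
    rewrite /chi indicE; case: (boolP (t \in `[1%R, 2%R]%classic)) => [|_].
      rewrite inE/= in_itv/= => /andP[t1 t2].
      have t0 : (0 < t)%R by exact: lt_le_trans t1.
      rewrite mem_set/= ?in_itv/= ?t0// mul1e lee_fin.
      by rewrite invr_le1// unitfE gt_eqF.
    by case: ifPn => _; rewrite ?mul0e.
  rewrite integral_cst//= lebesgue_measure_itv/= lte_fin ltr1n -EFinB mul1e.
  exact: ltry.
move: E1; have -> : I = (fine I)%:E by rewrite fineK// ge0_fin_numE.
have fI : (0 < fine I)%R by rewrite fine_gt0// Ipos.
move=> /(congr1 (fun z => ((fine I)^-1)%:E * z)).
by rewrite !muleA -EFinM mulVf ?gt_eqF// !mul1e.
Qed.

End multiplicative_haar.

(** * Norm and dilations *)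

Section heisenberg_norm.
Context (R : realType) (n : nat).
Local Notation H := (heis R n).
Implicit Types x y : H.

Lemma measurable_hcoord i : measurable_fun setT (fun x : H => hcoord x i).
Proof.
exact: (measurableT_comp (measurable_tnth i) measurable_fst).
Qed.

Lemma measurable_hlast : measurable_fun setT (fun x : H => hlast x).
Proof. exact: measurable_snd. Qed.

Lemma measurable_hmk d (T : measurableType d) (v : 'I_(n + n) -> T -> R)
    (z : T -> R) :
  (forall i, measurable_fun setT (v i)) -> measurable_fun setT z ->
  measurable_fun setT (fun t => hmk (v^~ t) (z t) : H).
Proof.
move=> mv mz; apply/measurable_fun_pair => //.
apply/measurable_fun_tnthP => i.
by apply: (eq_measurable_fun (v i)) => // t _ /=; rewrite tnth_mktuple.
Qed.

Lemma measurable_hnorm : measurable_fun setT (fun x : H => hnorm x).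
Proof.
apply: (measurableT_comp (measurable_powR _)).
apply: measurable_funD; apply: measurable_funX.
  by apply: measurable_sum => i; apply: measurable_funX; exact: measurable_hcoord.
exact: measurable_hlast.
Qed.

Lemma measurable_hdil2 :
  measurable_fun setT (fun z : measurableTypeR R * H => hdil z.1 z.2).
Proof.
apply: (@measurable_hmk _ (measurableTypeR R * H)%type
  (fun i z => z.1 * hcoord z.2 i)
  (fun z => z.1 ^+ 2 * hlast z.2)).
  move=> i; apply: measurable_funM; first exact: measurable_fst.
  by apply: (measurableT_comp (measurable_hcoord i)); exact: measurable_snd.
apply: measurable_funM; first by apply: measurable_funX; exact: measurable_fst.
by apply: (measurableT_comp measurable_hlast); exact: measurable_snd.
Qed.

Lemma measurable_hdil (r : R) : measurable_fun setT (@hdil R n r).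
Proof.
exact: (measurableT_comp measurable_hdil2 (measurable_pair1 r)).
Qed.

Lemma hcoord_hmk v z i : hcoord (hmk v z : H) i = v i.
Proof. by rewrite /hcoord/= tnth_mktuple. Qed.

Lemma hlast_hmk v z : hlast (hmk v z : H) = z. Proof. by []. Qed.

Lemma heisP x y : (forall i, hcoord x i = hcoord y i) -> hlast x = hlast y -> x = y.
Proof.
case: x => x1 x2; case: y => y1 y2 xy1 xy2; congr pair => //.
exact: eq_from_tnth.
Qed.

Lemma hnorm_ge0 x : 0 <= hnorm x. Proof. exact: powR_ge0. Qed.

Lemma hnorm_hdil r x : 0 <= r -> hnorm (hdil r x) = r * hnorm x.
Proof.
move=> r0; rewrite /hnorm.
under eq_bigr do rewrite hcoord_hmk exprMn.
rewrite -mulr_sumr hlast_hmk !(exprMn 2 (r ^+ 2)) -mulrDr powRM ?addr_ge0 ?sqr_ge0//.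
congr (_ * _); rewrite -exprM -powR_mulrn// -powRrM.
by rewrite (_ : _ * _ = 1) ?powRr1//= mulfV// pnatr_eq0.
Qed.

Lemma hdilM r s x : hdil r (hdil s x) = hdil (r * s) x.
Proof.
apply: heisP => [i|]; first by rewrite !hcoord_hmk mulrA.
by rewrite !hlast_hmk mulrA exprMn.
Qed.

Lemma hdil1 x : hdil 1 x = x.
Proof.
apply: heisP => [i|]; first by rewrite !hcoord_hmk mul1r.
by rewrite !hlast_hmk expr1n mul1r.
Qed.

Lemma hnorm_eq0 x : hnorm x = 0 -> x = @hzero R n.
Proof.
move/powR_eq0_eq0/eqP; rewrite paddr_eq0 ?sqr_ge0// !sqrf_eq0 => /andP[].
rewrite psumr_eq0; last by move=> i _; exact: sqr_ge0.
move=> /allP x0 /eqP z0; apply: heisP => [i|]; last exact: z0.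
rewrite hcoord_hmk; apply/eqP; rewrite -sqrf_eq0.
by have := x0 i; rewrite mem_index_enum => /(_ erefl).
Qed.

(** The open ball centred at the identity is the sublevel set of the norm,
    because the inverse has the same norm. *)
Lemma hball0E (r : R) : hball (@hzero R n) r = [set y | hnorm y < r].
Proof.
apply/seteqP; split=> y; rewrite /hball/= /hdist.
all: suff -> : hnorm (hmul (hopp y) (@hzero R n)) = hnorm y by [].
all: rewrite /hnorm.
all: under eq_bigr do rewrite !hcoord_hmk addr0 sqrrN.
all: rewrite !hlast_hmk [X in 2 * X]big1 ?mulr0 ?addr0 ?sqrrN// => j _.
all: by rewrite !hcoord_hmk mul0r mulr0 subr0.
Qed.

Lemma hnorm_surj (t : R) : 0 <= t -> exists x : H, hnorm x = t.
Proof.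
move=> t0; exists (hmk (fun=> 0) (t ^+ 2)); rewrite /hnorm hlast_hmk big1.
  rewrite expr0n add0r -exprM -powR_mulrn// -powRrM.
  by rewrite (_ : _ * _ = 1) ?powRr1//= mulfV// pnatr_eq0.
by move=> i _; rewrite hcoord_hmk expr0n.
Qed.

Lemma hnorm_radius (r : R) y : 0 <= r -> hsphere y -> hnorm (hdil r y) = r.
Proof. by move=> r0 y1; rewrite hnorm_hdil// y1 mulr1. Qed.

Lemma hdil_direction (r : R) y : 0 < r -> hsphere y ->
  hdil (hnorm (hdil r y))^-1 (hdil r y) = y.
Proof.
by move=> r0 y1; rewrite hnorm_radius ?ltW// hdilM mulVf ?gt_eqF// hdil1.
Qed.

Lemma measurable_hnorm_eq (c : R) : measurable [set x : H | hnorm x = c].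
Proof.
rewrite (_ : [set x | _] = (fun x : H => hnorm x) @^-1` [set c])//.
by rewrite -[X in measurable X]setTI; apply: measurable_hnorm.
Qed.

Lemma measurable_hsphere : measurable (@hsphere R n).
Proof. exact: measurable_hnorm_eq. Qed.

Lemma measurable_direction :
  measurable_fun setT (fun x : H => hdil (hnorm x)^-1 x).
Proof.
have mp : measurable_fun setT
    (fun x : H => ((hnorm x)^-1, x)%R : measurableTypeR R * H).
  apply/measurable_fun_pair => //.
  exact: (measurableT_comp (@measurable_invr R) measurable_hnorm).
exact: (measurableT_comp measurable_hdil2 mp).
Qed.

End heisenberg_norm.

(** * Finite measures and cubes *)

(** Finiteness turns a measure into a finite measure with the same underlying
    structure, so the product theory becomes available for it. *)
Definition as_finite d (T : measurableType d) (R : realType)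
  (mu : {measure set T -> \bar R}) (fin : fin_num_fun mu) : set T -> \bar R := mu.

Section as_finite.
Context d (T : measurableType d) (R : realType)
  (mu : {measure set T -> \bar R}) (fin : fin_num_fun mu).

HB.instance Definition _ := Measure.on (as_finite fin).
HB.instance Definition _ := Measure_isFinite.Build _ _ _ (as_finite fin) fin.

End as_finite.

Lemma finite_measure_pack d (T : measurableType d) (R : realType)
    (mu : {measure set T -> \bar R}) : fin_num_fun mu ->
  exists nu : {finite_measure set T -> \bar R},
    (nu : {measure set T -> \bar R}) = mu.
Proof.
case: mu => f c fin.
by exists (as_finite fin : {finite_measure set T -> \bar R}).
Qed.

Section tuple_lebesgue_boxes.
Context (R : realType).
Local Open Scope ereal_scope.

(** The mass of the whole space and of cubes is found by induction on the
    dimension; it gives the positivity and the finiteness of the volume of the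
    unit ball, hence of the mass of the unit sphere. *)
Lemma tuple_lebesgue_setT_gt0 m : 0 < tuple_lebesgue R m setT.
Proof.
elim: m => [|m IHm] /=; first by rewrite diracE in_setT lte01.
rewrite /cons_measure /pushforward preimage_setT.
have -> : [set: measurableTypeR R * m.-tuple (measurableTypeR R)] = setT `*` setT.
  by rewrite setXTT.
rewrite product_measure1E// mule_gt0//.
apply: (@lt_le_trans _ _ (@lebesgue_measure R `[0%R, 1%R]%classic)).
  by rewrite lebesgue_measure_itv/= lte_fin ltr01 oppr0 adde0 lte_fin.
by apply: le_measure; rewrite ?inE.
Qed.

Definition cube m : set (m.-tuple (measurableTypeR R)) :=
  [set t | forall i, (-1 <= tnth t i <= 1)%R].

Lemma measurable_cube m : measurable (@cube m).
Proof.
have -> : @cube m = \bigcap_(i in [set: 'I_m])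
    ((fun t : m.-tuple (measurableTypeR R) => tnth t i) @^-1`
      (`[(-1)%R, 1%R]%classic : set R)).
  apply/seteqP; split=> t /=.
    by move=> ht i _ /=; rewrite in_itv/=.
  by move=> ht i; have := ht i I; rewrite /= in_itv.
apply: fin_bigcap_measurable => //.
move=> i _; rewrite -[X in measurable X]setTI.
exact: (measurable_tnth i).
Qed.

Lemma tuple_lebesgue_cube_lty m : tuple_lebesgue R m (@cube m) < +oo.
Proof.
elim: m => [|m IHm] /=; first by rewrite diracE; case: (_ \in _); exact: ltry.
rewrite /cons_measure /pushforward.
have -> : @tuple_cons R m @^-1` @cube m.+1 = `[(-1)%R, 1%R]%classic `*` @cube m.
  apply/seteqP; split=> -[x t] /=.
    move=> h; split=> [|i]/=.
      by rewrite in_itv/=; have := h ord0; rewrite (tnth_nth 0%R).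
    by have := h (lift ord0 i); rewrite !(tnth_nth 0%R).
  rewrite in_itv/= => -[h0 h] i.
  have [j ->|->] := unliftP ord0 i; last by rewrite (tnth_nth 0%R).
  by have := h j; rewrite !(tnth_nth 0%R).
rewrite product_measure1E//; last exact: measurable_cube.
have fin : @lebesgue_measure R `[(-1)%R, 1%R]%classic \is a fin_num.
  by rewrite lebesgue_measure_itv/=; case: ifP.
by apply: lte_mul_pinfty.
Qed.

End tuple_lebesgue_boxes.

(** * Consequences of the polar coordinate formula *)

Lemma integral_indicT d (T : measurableType d) (R : realType)
    (mu : {measure set T -> \bar R}) (A : set T) :
  measurable A -> (\int[mu]_x (\1_A x)%:E = mu A)%E.
Proof. by move=> mA; rewrite integral_indic// setIT. Qed.

Section radial_integration.
Context (R : realType) (n : nat).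
Local Open Scope ereal_scope.
Local Notation H := (heis R n).
Local Notation leb := (@lebesgue_measure R).
Local Notation L := (@heis_lebesgue R n).
Local Notation Q := (hdim n).
Variable sigma : {measure set H -> \bar R}.
Hypothesis hsigma : polar_measure sigma.
Local Notation S := (@hsphere R n).

Lemma radial_integral (g : R -> \bar R) :
  measurable_fun setT g -> (forall r, 0 <= g r) ->
  \int[L]_x g (hnorm x) =
  (\int[leb]_(r in `]0%R, +oo[) (g r * (r ^+ Q.-1)%:E)) * sigma S.
Proof.
move=> mg g0; rewrite (hsigma.2 (fun x => g (hnorm x)))//; last first.
  exact: (measurableT_comp mg (@measurable_hnorm R n)).
rewrite -ge0_integralZr//.
- apply: eq_integral => r; rewrite inE/= in_itv/= andbT => r0.
  rewrite (eq_integral (cst (g r * (r ^+ Q.-1)%:E))); last first.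
    by move=> y /set_mem yS; rewrite hnorm_radius ?ltW.
  by rewrite integral_cst//; exact: measurable_hsphere.
- apply: measurable_funTS; apply: emeasurable_funM => //.
  by apply/measurable_EFinP; exact: measurable_funX.
- move=> r; rewrite /= in_itv/= andbT => r0.
  by rewrite mule_ge0// lee_fin exprn_ge0// ltW.
Qed.

Lemma measurable_hnorm_itv (i : interval R) :
  measurable [set x : H | hnorm x \in i].
Proof.
rewrite (_ : [set x | _] = (fun x : H => hnorm x) @^-1` [set` i])//.
by rewrite -[X in measurable X]setTI; apply: measurable_hnorm.
Qed.

(** The unit ball lies in a bounded box. *)
Lemma unit_ball_lty : L [set x | (hnorm x <= 1)%R] < +oo.
Proof.
pose box : set H := @cube R (n + n) `*` (`[(-1)%R, 1%R]%classic : set R).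
have mbox : measurable box.
  by apply: measurableX => //; exact: measurable_cube.
apply: (@le_lt_trans _ _ (L box)).
  apply: le_measure; rewrite ?inE//.
    exact: (measurable_hnorm_itv `]-oo, 1%R]).
  move=> x /= x1.
  have N1 : ((\sum_(i < n + n) hcoord x i ^+ 2) ^+ 2 + hlast x ^+ 2 <= 1)%R.
    set N := (X in (X <= 1)%R).
    have N0 : (0 <= N)%R by rewrite addr_ge0// sqr_ge0.
    have -> : N = (hnorm x ^+ 4)%R.
      rewrite -powR_mulrn ?hnorm_ge0// /hnorm -/N -powRrM mulVf ?pnatr_eq0//.
      by rewrite powRr1.
    by rewrite exprn_ile1// hnorm_ge0.
  have sq1 (a : R) : (a ^+ 2 <= 1 -> -1 <= a <= 1)%R.
    by move=> a1; rewrite -ler_norml -(@ler_pXn2r _ 2) ?nnegrE// expr1n real_normK ?num_real.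
  have S0 : (0 <= \sum_(i < n + n) hcoord x i ^+ 2)%R.
    by apply: sumr_ge0 => i _; exact: sqr_ge0.
  split=> /=; last first.
    rewrite in_itv/=; apply/sq1; apply: le_trans N1.
    by rewrite lerDr sqr_ge0.
  move=> i; apply/sq1.
  apply: (@le_trans _ _ (\sum_(i < n + n) hcoord x i ^+ 2)%R).
    rewrite (bigD1 i)//= lerDl; apply: sumr_ge0 => j _; exact: sqr_ge0.
  have /sq1/andP[] // : ((\sum_(i < n + n) hcoord x i ^+ 2) ^+ 2 <= 1)%R.
  by apply: le_trans N1; rewrite lerDl sqr_ge0.
rewrite /heis_lebesgue/= /box product_measure1E//; last exact: measurable_cube.
have fin : @lebesgue_measure R `[(-1)%R, 1%R]%classic \is a fin_num.
  by rewrite lebesgue_measure_itv/=; case: ifP.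
have fin2 : tuple_lebesgue R (n + n) (@cube R (n + n)) \is a fin_num.
  by rewrite ge0_fin_numE// tuple_lebesgue_cube_lty.
by rewrite ltey_eq fin_numM.
Qed.

(* The annulus between the radii 1/2 and 1 lies in the unit ball, and polar
   coordinates compare its volume with the mass of the sphere. *)
Let annulus_mass : exists2 c : R, (0 < c)%R &
  c%:E * sigma S <= L [set x | (hnorm x <= 1)%R].
Proof.
pose g (r : R) : \bar R := (\1_(`[2^-1%R, 1%R]%classic : set R) r)%:E.
have mg : measurable_fun setT g.
  by apply/measurable_EFinP; exact: measurable_indic.
have g0 r : 0 <= g r by rewrite lee_fin.
pose a : R := (2^-1 ^+ Q.-1)%R.
have a0 : (0 < a)%R by rewrite exprn_gt0// invr_gt0.
exists (a * (1 - 2^-1))%R.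
  by rewrite mulr_gt0// subr_gt0 invf_lt1// ltr1n.
apply: (@le_trans _ _ (\int[L]_x g (hnorm x))).
  rewrite radial_integral// lee_wpmul2r//.
  have -> : (a * (1 - 2^-1))%:E = \int[leb]_(r in `[2^-1%R, 1%R]) a%:E.
    rewrite integral_cst//= lebesgue_measure_itv/= lte_fin invf_lt1// ltr1n.
    by rewrite -EFinB.
  rewrite integral_mkcond [leRHS]integral_mkcond.
  apply: le_integral_pointwise => r _; rewrite !patchE.
    by case: ifPn => // _; rewrite lee_fin ltW.
  case: ifPn => [|_]; last first.
    case: ifPn => //; rewrite inE/= in_itv/= andbT => r0.
    by rewrite mule_ge0// lee_fin exprn_ge0// ltW.
  rewrite inE/= in_itv/= => /andP[r1 r2].
  have r0 : (0 < r)%R by apply: lt_le_trans r1; rewrite invr_gt0.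
  rewrite mem_set/= ?in_itv/= ?r0// /g indicE mem_set/= ?in_itv/= ?r1//.
  by rewrite mul1e lee_fin lerXn2r// nnegrE ?invr_ge0// ltW.
rewrite -[leRHS]integral_indicT; last exact: (measurable_hnorm_itv `]-oo, 1%R]).
apply: le_integral_pointwise => x _; first exact: g0.
rewrite /g lee_fin !indicE ler_nat.
case: (boolP (hnorm x \in (`[2^-1%R, 1%R]%classic : set R))) => //.
rewrite inE/= in_itv/=.
by move=> /andP[_ x1]; rewrite mem_set.
Qed.

Lemma polar_sphere_lty : sigma setT < +oo.
Proof.
have -> : sigma setT = sigma S.
  have mS := @measurable_hsphere R n.
  have := measureU sigma (measurableC mS) mS (setICl S).
  by rewrite setvU => ->; rewrite [X in X + _ = _]hsigma.1 add0e.
have [c c0 cle] := annulus_mass.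
have := le_lt_trans cle unit_ball_lty.
rewrite ltey => /eqP H1; rewrite ltey; apply/eqP => H2; apply: H1.
by rewrite H2 gt0_muley// lte_fin.
Qed.

(** Otherwise, by polar coordinates, the whole space would be a null set. *)
Lemma polar_sphere_gt0 : 0 < sigma S.
Proof.
rewrite lt0e measure_ge0 andbT; apply/eqP => S0.
have := @radial_integral (cst 1) (measurable_cst _) (fun _ => lee01).
rewrite S0 mule0 integral_cst// mul1e.
apply/eqP; rewrite gt_eqF//.
suff : 0 < tuple_lebesgue R (n + n) setT * leb setT.
  by rewrite -product_measure1E// setXTT.
rewrite mule_gt0 ?tuple_lebesgue_setT_gt0//.
apply: (@lt_le_trans _ _ (@lebesgue_measure R `[0%R, 1%R]%classic)).
  by rewrite lebesgue_measure_itv/= lte_fin ltr01 oppr0 adde0 lte_fin.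
by apply: le_measure; rewrite ?inE.
Qed.

Lemma unit_ball_gt0 : 0 < L [set x | (hnorm x <= 1)%R].
Proof.
have [c c0 cle] := annulus_mass; apply: lt_le_trans cle.
by rewrite mule_gt0// polar_sphere_gt0.
Qed.

(** In polar coordinates the volume of the set swept out by a set of radii is an
    integral over that set. *)
Lemma radial_negligible (N : set R) :
  measurable N -> (forall r, N r -> 0 < r)%R -> leb N = 0 ->
  L [set x | N (hnorm x)] = 0.
Proof.
move=> mN N0 leb0.
have mNx : measurable [set x : H | N (hnorm x)].
  rewrite (_ : [set x | _] = (fun x : H => hnorm x) @^-1` N)//.
  by rewrite -[X in measurable X]setTI; apply: measurable_hnorm.
rewrite -integral_indicT//.
rewrite (_ : (fun x : H => _) = (fun x => (\1_N (hnorm x))%:E)); last first.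
  by apply/funext => x; rewrite !indicE; congr (_%:R%:E).
rewrite (@radial_integral (fun r => (\1_N r)%:E))//; last first.
  by apply/measurable_EFinP; exact: measurable_indic.
rewrite [X in X * _](_ : _ = 0) ?mul0e//.
apply: ge0_integral_ae0 => //.
- move=> r; rewrite /= in_itv/= andbT => r0.
  by rewrite mule_ge0// lee_fin exprn_ge0// ltW.
- exists N; split => // r /= /not_implyP[_ rN]; apply: contrapT => nN; apply: rN.
  by rewrite indicE memNset ?mul0e.
Qed.

Lemma sphere_negligible (c : R) : (0 < c)%R -> L [set x | hnorm x = c] = 0.
Proof.
move=> c0; apply: (@radial_negligible [set c]) => //; first by move=> r ->.
exact: lebesgue_measure_set1.
Qed.

Lemma origin_negligible : L [set x | hnorm x = 0%R] = 0.
Proof.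
have m0 := @measurable_hnorm_eq R n 0%R.
rewrite -integral_indicT//.
rewrite hsigma.2//; last by apply/measurable_EFinP; exact: measurable_indic.
rewrite integral0_eq// => r; rewrite /= in_itv/= andbT => r0.
rewrite integral0_eq// => y yS; rewrite indicE memNset ?mul0e//=.
by rewrite hnorm_radius ?ltW// => r0'; rewrite r0' ltxx in r0.
Qed.

Lemma ae_hnorm_gt0 (P : H -> Prop) : (forall x, (0 < hnorm x)%R -> P x) ->
  {ae L, forall x, P x}.
Proof.
move=> hP; exists [set y | hnorm y = 0%R]; split.
- exact: measurable_hnorm_eq.
- exact: origin_negligible.
- move=> x /= nP; apply: contrapT => h; apply/nP/hP.
  by rewrite lt0r hnorm_ge0 andbT; apply/eqP.
Qed.

(** Each spherical integral of the indicator of the cone over M is the mass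
    of M. *)
Lemma direction_negligible (M : set H) :
  measurable M -> sigma M = 0 -> L [set x | M (hdil (hnorm x)^-1 x)] = 0.
Proof.
move=> mM M0.
have mdir := @measurable_direction R n.
have mMx : measurable [set x : H | M (hdil (hnorm x)^-1 x)].
  rewrite (_ : [set x | _] = (fun x : H => hdil (hnorm x)^-1 x) @^-1` M)//.
  by rewrite -[X in measurable X]setTI; apply: mdir.
rewrite -integral_indicT//.
rewrite hsigma.2//; last by apply/measurable_EFinP; exact: measurable_indic.
rewrite integral0_eq// => r; rewrite /= in_itv/= andbT => r0.
rewrite (eq_integral (fun y : H => (r ^+ Q.-1)%:E * (\1_M y)%:E)); last first.
  move=> y /set_mem yS; rewrite muleC; congr (_ * _%:E).
  rewrite !indicE; congr (nat_of_bool _)%:R.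
  by apply/idP/idP; rewrite !inE/= hdil_direction.
rewrite ge0_integralZl//.
- rewrite integral_indic//; last exact: measurable_hsphere.
  by rewrite (subset_measure0 _ _ _ M0) ?mule0//; exact: measurableI (@measurable_hsphere R n).
- exact: measurable_hsphere.
- by apply/measurable_EFinP; exact: measurable_indic.
- by rewrite lee_fin exprn_ge0// ltW.
Qed.

End radial_integration.

(** * Polar coordinates and dilations *)

Section polar_integration.
Context (R : realType) (n : nat).
Local Open Scope ereal_scope.
Local Notation H := (heis R n).
Local Notation leb := (@lebesgue_measure R).
Local Notation L := (@heis_lebesgue R n).
Local Notation Q := (hdim n).
Variable sigma : {finite_measure set H -> \bar R}.
Hypothesis hsigma : polar_measure sigma.
Local Notation S := (@hsphere R n).

Let mS : measurable S := @measurable_hsphere R n.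

Let measurable_comp_hdil (h : H -> \bar R) : measurable_fun setT h ->
  measurable_fun setT (fun z : measurableTypeR R * H => h (hdil z.1 z.2)).
Proof. by move=> mh; exact: (measurableT_comp mh (@measurable_hdil2 R n)). Qed.

Let measurable_comp_hdilr (h : H -> \bar R) (r : R) : measurable_fun setT h ->
  measurable_fun setT (fun y : H => h (hdil r y)).
Proof. by move=> mh; exact: (measurableT_comp mh (measurable_hdil r)). Qed.

Definition sphere_integral (h : H -> \bar R) (s : R) : \bar R :=
  \int[sigma]_(y in S) h (hdil s y).

Lemma measurable_sphere_integral (h : H -> \bar R) :
  measurable_fun setT h -> (forall x, 0 <= h x) ->
  measurable_fun setT (sphere_integral h).
Proof.
move=> mh h0.
exact: (@measurable_fun_integral2 _ _ (measurableTypeR R) H R sigma S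
  (fun z => h (hdil z.1 z.2)) mS (measurable_comp_hdil mh)).
Qed.

Lemma sphere_integral_ge0 (h : H -> \bar R) s : (forall x, 0 <= h x) ->
  0 <= sphere_integral h s.
Proof. by move=> h0; exact: integral_ge0. Qed.

Lemma polar_integral (h : H -> \bar R) :
  measurable_fun setT h -> (forall x, 0 <= h x) ->
  \int[L]_x h x =
  \int[leb]_(r in `]0%R, +oo[) (sphere_integral h r * (r ^+ Q.-1)%:E).
Proof.
move=> mh h0; rewrite hsigma.2//; apply: eq_integral => r.
rewrite inE/= in_itv/= andbT => r0; rewrite ge0_integralZr//.
- apply: measurable_funTS; exact: measurable_comp_hdilr.
- by rewrite lee_fin exprn_ge0// ltW.
Qed.

(** In polar coordinates a dilation of the group is a dilation of the radius, and
    r ^ (Q - 1) dr scales by t ^ Q. *)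
Lemma heis_dilation (t : R) (f : H -> \bar R) : (0 < t)%R ->
  measurable_fun setT f -> (forall x, 0 <= f x) ->
  \int[L]_x f (hdil t x) = ((t ^+ Q)^-1)%:E * \int[L]_x f x.
Proof.
move=> t0 mf f0.
have tE : ((t ^+ Q)^-1 = t^-1 * (t ^+ Q.-1)^-1)%R.
  by rewrite -invfM -exprS prednK// /hdim addnS.
rewrite polar_integral//; last exact: measurable_comp_hdilr.
rewrite [in RHS]polar_integral//.
pose K r := sphere_integral f r * (`|r| ^+ Q.-1)%:E.
have mK : measurable_fun setT K.
  apply: emeasurable_funM; first exact: measurable_sphere_integral.
  by apply/measurable_EFinP; exact: measurable_funX.
have K0 r : 0 <= K r by rewrite mule_ge0 ?sphere_integral_ge0// lee_fin exprn_ge0.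
have -> : \int[leb]_(r in `]0%R, +oo[) (sphere_integral f r * (r ^+ Q.-1)%:E) =
    \int[leb]_(r in `]0%R, +oo[) K r.
  by apply: eq_integral => r; rewrite inE/= in_itv/= andbT => r0; rewrite /K gtr0_norm.
rewrite tE EFinM (muleC (t^-1)%:E) -muleA -(integral_pos_dilation t0 mK K0).
rewrite -ge0_integralZl//; last 2 first.
- by apply: measurable_funTS; apply: (measurableT_comp mK); exact: measurable_funM.
- by rewrite lee_fin invr_ge0 exprn_ge0// ltW.
apply: eq_integral => r; rewrite inE/= in_itv/= andbT => r0.
rewrite /K gtr0_norm ?mulr_gt0// exprMn [RHS]muleCA -EFinM mulKf; last first.
  by rewrite expf_neq0// gt_eqF.
by congr (_ * _); apply: eq_integral => y _; rewrite hdilM.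
Qed.

Lemma ball_volume (rho : R) : (0 < rho)%R ->
  L [set x | (hnorm x <= rho)%R] =
  (rho ^+ Q)%:E * L [set x | (hnorm x <= 1)%R].
Proof.
move=> rho0.
have mB (r : R) : measurable [set x : H | (hnorm x <= r)%R].
  exact: (@measurable_hnorm_itv R n `]-oo, r]).
pose f (x : H) : \bar R := (\1_[set x | (hnorm x <= rho)%R] x)%:E.
have mf : measurable_fun setT f.
  by apply/measurable_EFinP; exact: measurable_indic.
have f0 x : 0 <= f x by rewrite lee_fin.
have := heis_dilation rho0 mf f0.
rewrite [X in _ = _ * X -> _]integral_indicT//.
have -> : (fun x => f (hdil rho x)) =
    (fun x : H => (\1_[set x0 | (hnorm x0 <= 1)%R] x)%:E : \bar R).
  apply/funext => x; rewrite /f !indicE; congr (nat_of_bool _)%:R%:E.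
  have e : (hnorm (hdil rho x) <= rho)%R = (hnorm x <= 1)%R.
    by rewrite (hnorm_hdil _ (ltW rho0)) -[X in (_ <= X)%R](mulr1 rho) ler_pM2l.
  by apply/idP/idP; rewrite !inE/= e.
rewrite integral_indicT// => ->.
by rewrite muleA -EFinM mulfV ?mul1e// expf_neq0// gt_eqF.
Qed.

(** Averaging a function over the sphere of radius |x|/t and then over x amounts
    to integrating the function itself, by polar coordinates and dilation. *)
Lemma integral_sphere_integral (t : R) (g : R -> \bar R) (h : H -> \bar R) :
  (0 < t)%R -> measurable_fun setT g -> (forall r, 0 <= g r) ->
  measurable_fun setT h -> (forall x, 0 <= h x) ->
  \int[L]_x (g (hnorm x) * sphere_integral h (hnorm x / t)%R) =
  sigma S * ((t ^+ Q)%:E * \int[L]_x (g (t * hnorm x)%R * h x)).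
Proof.
move=> t0 mg g0 mh h0.
have mdiv : measurable_fun setT (fun r : R => r / t)%R by exact: measurable_funM.
rewrite (radial_integral hsigma (g := fun r => g r * sphere_integral h (r / t)%R));
  last 2 first.
- apply: emeasurable_funM => //.
  by apply: (measurableT_comp _ mdiv); exact: measurable_sphere_integral.
- by move=> r; rewrite mule_ge0// sphere_integral_ge0.
rewrite muleC; congr (_ * _).
pose f x := g (hnorm x) * h (hdil t^-1 x).
have mf : measurable_fun setT f.
  apply: emeasurable_funM; last exact: measurable_comp_hdilr.
  exact: (measurableT_comp mg (@measurable_hnorm R n)).
have f0 x : 0 <= f x by rewrite mule_ge0.
have := heis_dilation t0 mf f0.
rewrite /f; under eq_integral.
  move=> x _; rewrite hnorm_hdil ?ltW// hdilM mulVf ?gt_eqF// hdil1; over.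
move=> ->; rewrite muleA -EFinM mulfV ?expf_neq0 ?gt_eqF// mul1e.
rewrite [RHS]polar_integral//; apply: eq_integral => r.
rewrite inE/= in_itv/= andbT => r0; congr (_ * _).
rewrite /sphere_integral -ge0_integralZl//; last first.
  by apply: measurable_funTS; exact: measurable_comp_hdilr.
by apply: eq_integral => y /set_mem yS; rewrite hnorm_radius ?ltW// hdilM mulrC.
Qed.

(** In polar coordinates, the substitution t = rho / |y| gives the second form of
    the rough Hausdorff integral, because dt/t is invariant under dilations and
    under inversion. *)
Lemma hausdorff_polar (rho : R) (phi : R -> R) (O f : H -> R) :
  (0 < rho)%R -> measurable_fun setT phi -> (forall t, 0 <= phi t)%R ->
  measurable_fun setT O -> (forall y, 0 <= O y)%R ->
  measurable_fun setT f -> (forall y, 0 <= f y)%R ->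
  \int[L]_y (phi (rho / hnorm y) / hnorm y ^+ Q *
             O (hdil (hnorm y)^-1 y) * f y)%:E =
  \int[leb]_(t in `]0%R, +oo[) ((phi t / t)%:E *
     \int[sigma]_(y in S) (O y * f (hdil (rho / t) y))%:E).
Proof.
move=> rho0 mphi phi0 mO O0 mf f0.
have minv := @measurable_invr R.
have mdir := @measurable_direction R n.
have mrho : measurable_fun setT (fun r : R => rho / r)%R by exact: measurable_funM.
have mprho : measurable_fun setT (fun r : R => phi (rho / r))%R.
  exact: measurableT_comp.
rewrite polar_integral//; last 2 first.
- apply/measurable_EFinP; repeat apply: measurable_funM => //.
  + exact: (measurableT_comp mprho (@measurable_hnorm R n)).
  + apply: (measurableT_comp minv); apply: measurable_funX.
    exact: measurable_hnorm.
  + exact: (measurableT_comp mO mdir).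
- by move=> x; rewrite lee_fin !mulr_ge0// invr_ge0 exprn_ge0// hnorm_ge0.
pose G s := \int[sigma]_(y in S) (O y * f (hdil s y))%:E.
have mG : measurable_fun setT G.
  apply: (@measurable_fun_integral2 _ _ (measurableTypeR R) H R sigma S
    (fun z => (O z.2 * f (hdil z.1 z.2))%:E)) => //.
  - apply/measurable_EFinP; apply: measurable_funM.
      exact: (measurableT_comp mO measurable_snd).
    exact: (measurableT_comp mf (@measurable_hdil2 R n)).
  - by move=> z; rewrite lee_fin mulr_ge0.
have G0 s : 0 <= G s by apply: integral_ge0 => y _; rewrite lee_fin mulr_ge0.
pose g t := (phi t)%:E * G (rho / t)%R.
have mg : measurable_fun setT g.
  apply: emeasurable_funM; first exact/measurable_EFinP.
  exact: (measurableT_comp mG mrho).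
have g0 t : 0 <= g t by rewrite mule_ge0// lee_fin.
have grho0 t : 0 <= g (rho * t)%R by [].
have mgrho : measurable_fun setT (fun t => g (rho * t)%R).
  by apply: (measurableT_comp mg); exact: measurable_funM.
transitivity (\int[leb]_(t in `]0%R, +oo[) (g (rho * t^-1)%R * (t^-1)%:E)).
  apply: eq_integral => r; rewrite inE/= in_itv/= andbT => r0.
  rewrite /g invfM invrK mulrA mulfV ?gt_eqF// mul1r.
  rewrite [X in X * _ = _](_ : _ = (phi (rho / r) / r ^+ Q)%:E * G r); last first.
    rewrite /sphere_integral /G -ge0_integralZl//; last 3 first.
    - apply/measurable_EFinP/measurable_funTS; apply: measurable_funM => //.
      exact: (measurableT_comp mf (measurable_hdil r)).
    - by move=> y _; rewrite lee_fin mulr_ge0.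
    - by rewrite lee_fin mulr_ge0// invr_ge0 exprn_ge0// ltW.
    apply: eq_integral => y /set_mem yS.
    by rewrite hnorm_radius ?ltW// hdilM mulVf ?gt_eqF// hdil1 -EFinM mulrA.
  rewrite muleAC [RHS]muleAC -!EFinM; congr (_%:E * _).
  rewrite (_ : r ^+ Q = r * r ^+ Q.-1)%R; last first.
    by rewrite -exprS prednK// /hdim addnS.
  by field; rewrite expf_neq0 gt_eqF.
rewrite (haar_inversion (g := fun t => g (rho * t)%R))//.
have := integral_pos_dilation rho0.
pose f' t := g t * (`|t|^-1)%:E.
have mf' : measurable_fun setT f'.
  by apply: emeasurable_funM => //; apply/measurable_EFinP; exact: (measurableT_comp minv).
have f'0 t : 0 <= f' t by rewrite mule_ge0// lee_fin invr_ge0.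
move=> /(_ f' mf' f'0)/(congr1 (fun z => rho%:E * z)).
rewrite muleA -EFinM mulfV ?gt_eqF// mul1e -ge0_integralZl//; last 2 first.
- by apply: measurable_funTS; apply: (measurableT_comp mf'); exact: measurable_funM.
- by rewrite lee_fin ltW.
move=> E; transitivity (\int[leb]_(t in `]0%R, +oo[) f' t).
  rewrite -E; apply: eq_integral => t; rewrite inE/= in_itv/= andbT => t0.
  rewrite /f' gtr0_norm ?mulr_gt0// muleCA -EFinM; congr (_ * _%:E).
  by field; rewrite !gt_eqF.
apply: eq_integral => t; rewrite inE/= in_itv/= andbT => t0.
by rewrite /f' /g gtr0_norm// muleAC -EFinM.
Qed.

End polar_integration.

(** * Null sets of radii *)

Section null_sets_of_radii.
Context (R : realType) (n : nat).
Local Open Scope ereal_scope.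
Local Notation H := (heis R n).
Local Notation leb := (@lebesgue_measure R).
Local Notation L := (@heis_lebesgue R n).
Local Notation Q := (hdim n).
Variable sigma : {finite_measure set H -> \bar R}.
Hypothesis hsigma : polar_measure sigma.
Local Notation S := (@hsphere R n).

(** A radial function that is almost everywhere equal to a Borel function is,
    off a null set of radii, a Borel function of the radius: its value at r is
    the spherical mean of the Borel version. *)
Lemma radial_ae_measurable (Phi : H -> R) (phi : R -> R) :
  ae_measurable L Phi -> (forall x, 0 <= Phi x)%R ->
  (forall x, Phi x = phi (hnorm x)) ->
  exists phi' : R -> R, [/\ measurable_fun setT phi', (forall t, 0 <= phi' t)%R &
    exists N : set R, [/\ measurable N, (forall r, N r -> 0 < r)%R,
      leb N = 0 & forall r, (0 < r)%R -> ~ N r -> phi r = phi' r]].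
Proof.
move=> [g mg [A [mA A0 subA]]] Phi0 PhiE.
have mS := @measurable_hsphere R n.
have sS0 := polar_sphere_gt0 hsigma.
have sSfin : sigma S \is a fin_num by exact: fin_num_measure.
pose s := fine (sigma S).
have s0 : (0 < s)%R by rewrite fine_gt0// sS0 ltey_eq sSfin.
pose g' x := (Num.max (g x) 0)%:E : \bar R.
have mg' : measurable_fun setT g'.
  by apply/measurable_EFinP; exact: measurable_maxr.
have g'0 x : 0 <= g' x by rewrite lee_fin le_max lexx orbT.
pose iA (x : H) : \bar R := (\1_A x)%:E.
have miA : measurable_fun setT iA.
  by apply/measurable_EFinP; exact: measurable_indic.
have iA0 x : 0 <= iA x by rewrite lee_fin.
have mI := measurable_sphere_integral sigma miA iA0.
have mrQ : measurable_fun setT (fun r : R => (r ^+ Q.-1)%:E : \bar R).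
  by apply/measurable_EFinP; exact: measurable_funX.
have ae0 : {ae leb, forall r, `]0%R, +oo[%classic r ->
    sphere_integral sigma iA r * (r ^+ Q.-1)%:E = 0}.
  apply: ge0_integral_eq0_ae => //.
  - by apply: measurable_funTS; exact: emeasurable_funM.
  - move=> r; rewrite /= in_itv/= andbT => r0.
    by rewrite mule_ge0 ?sphere_integral_ge0// lee_fin exprn_ge0// ltW.
  - by rewrite -polar_integral// integral_indicT.
pose N := `]0%R, +oo[%classic `&` [set r | sphere_integral sigma iA r != 0].
have mN : measurable N.
  apply: measurableI => //.
  rewrite (_ : [set r | _] = sphere_integral sigma iA @^-1` (~` [set 0])); last first.
    by apply/seteqP; split=> r /= /eqP.
  by rewrite -[X in measurable X]setTI; apply: mI => //; exact: measurableC.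
have N0 r : N r -> (0 < r)%R by move=> [] /=; rewrite in_itv/= andbT.
exists (fun r => fine (sphere_integral sigma g' r) / s)%R; split.
- apply: measurable_funM => //; apply: (measurableT_comp (f := fine)) => //.
  exact: (measurable_sphere_integral sigma mg' g'0).
- move=> t; rewrite divr_ge0 ?(ltW s0)// fine_ge0//.
  exact: sphere_integral_ge0.
- exists N; split => //.
    case: ae0 => N1 [mN1 N10 subN1]; apply: (subset_measure0 (mu := leb) mN mN1 _ N10).
    move=> r [r0 Ir]; apply: subN1 => /= /(_ r0)/eqP.
    rewrite mule_eq0 (negbTE Ir)/= eqe expf_eq0; move: r0.
    by rewrite /= in_itv/= andbT => r0; rewrite (gt_eqF r0) andbF.
  move=> r r0 nNr.
  have Ir0 : sphere_integral sigma iA r = 0.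
    by apply/eqP/negPn/negP => h; apply: nNr; split => //=; rewrite in_itv/= r0.
  have ae1 : {ae sigma, forall y, S y -> iA (hdil r y) = 0}.
    apply: ge0_integral_eq0_ae => //.
    by apply: measurable_funTS; exact: (measurableT_comp miA (measurable_hdil r)).
  have -> : sphere_integral sigma g' r = \int[sigma]_(y in S) (phi r)%:E.
    apply: ge0_ae_eq_integral => //.
    - by apply: measurable_funTS; exact: (measurableT_comp mg' (measurable_hdil r)).
    - move=> y yS; rewrite lee_fin -(hnorm_radius (ltW r0) yS) -PhiE.
      exact: Phi0.
    - apply: filterS ae1 => y h yS; have := h yS.
      rewrite /iA indicE; case: (boolP (_ \in A)) => [_ /eqP|yA _].
        by rewrite eqe oner_eq0.
      have Pg : Phi (hdil r y) = g (hdil r y).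
        apply: contrapT => /subA; move/negP: yA; rewrite inE; exact.
      rewrite /g' -Pg max_l// PhiE; congr (phi _)%:E; exact: hnorm_radius (ltW r0) yS.
  rewrite integral_cst//= fineM//= -/s.
  by rewrite mulfK// gt_eqF.
Qed.

(** The map r |-> rho / r preserves the null sets of the half-line, since it
    preserves dt/t. *)
Lemma quotient_negligible (rho : R) (N : set R) : (0 < rho)%R ->
  measurable N -> leb N = 0 ->
  L [set x | (0 < hnorm x)%R /\ N (rho / hnorm x)%R] = 0.
Proof.
move=> rho0 mN N0.
pose N' := `]0%R, +oo[%classic `&` ((fun r : R => rho / r)%R @^-1` N).
have mquot : measurable_fun setT (fun r : R => rho / r)%R.
  by apply: measurable_funM => //; exact: measurable_invr.
have mN' : measurable N'.
  apply: measurableI => //.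
  by rewrite -[X in measurable X]setTI; apply: mquot.
rewrite (_ : [set x | _] = [set x : H | N' (hnorm x)]); last first.
  by apply/seteqP; split=> x /=; rewrite /N'/= in_itv/= andbT.
apply: (radial_negligible hsigma) => //.
  by move=> r [] /=; rewrite in_itv/= andbT.
pose i (r : R) : \bar R := (\1_N r)%:E.
have mi : measurable_fun setT i.
  by apply/measurable_EFinP; exact: measurable_indic.
have i0 x : 0 <= i x by rewrite lee_fin.
have mirho : measurable_fun setT (fun r => i (rho * r)%R).
  by apply: (measurableT_comp mi); exact: measurable_funM.
have mV : measurable_fun setT (fun t : R => (t^-1)%:E : \bar R).
  by apply/measurable_EFinP; exact: measurable_invr.
have ae1 : {ae leb, forall r, `]0%R, +oo[%classic r -> i (rho * r)%R = 0}.
  apply: ge0_integral_eq0_ae => //; first exact: measurable_funTS.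
  rewrite integral_pos_dilation// integral_indic//=.
  by rewrite (subset_measure0 _ _ _ N0) ?mule0//; exact: measurableI.
have E : \int[leb]_(t in `]0%R, +oo[) (i (rho * t^-1)%R * (t^-1)%:E) = 0.
  rewrite (haar_inversion (g := fun t => i (rho * t)%R))//.
  apply: ge0_integral_ae0 => //.
  - move=> r; rewrite /= in_itv/= andbT => r0.
    by rewrite mule_ge0// lee_fin invr_ge0 ltW.
  - case: ae1 => N1 [mN1 N10 s1]; exists N1; split => // r /= hr.
    by apply: s1 => /= h; apply: hr => r0; rewrite h// mul0e.
have : {ae leb, forall t, `]0%R, +oo[%classic t -> i (rho * t^-1)%R * (t^-1)%:E = 0}.
  apply: ge0_integral_eq0_ae => //.
    apply: measurable_funTS; apply: emeasurable_funM => //.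
    exact: (measurableT_comp mi mquot).
  move=> r; rewrite /= in_itv/= andbT => r0.
  by rewrite mule_ge0// lee_fin invr_ge0 ltW.
case=> N1 [mN1 N10 subN1]; apply: (subset_measure0 (mu := leb) mN' mN1 _ N10).
move=> r [r0 Nr]; apply: subN1 => /= /(_ r0)/eqP.
rewrite /i indicE mem_set// mul1e eqe invr_eq0; move: r0.
by rewrite /= in_itv/= andbT => r0; rewrite (gt_eqF r0).
Qed.

End null_sets_of_radii.

(** * Muckenhoupt weights on balls centred at the identity *)

#[local] Opaque heis_lebesgue.

Section weights.
Context (R : realType) (n : nat).
Local Open Scope ereal_scope.
Local Notation H := (heis R n).
Local Notation leb := (@lebesgue_measure R).
Local Notation L := (@heis_lebesgue R n).
Local Notation Q := (hdim n).
Variable sigma : {finite_measure set H -> \bar R}.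
Hypothesis hsigma : polar_measure sigma.

Definition cball (rho : R) : set H := [set x | (hnorm x <= rho)%R].

Lemma measurable_cball rho : measurable (cball rho).
Proof. exact: (@measurable_hnorm_itv R n `]-oo, rho]). Qed.

Lemma cball_subset (r s : R) : (r <= s)%R -> cball r `<=` cball s.
Proof. by move=> rs x /= /le_trans; exact. Qed.

Definition vol (rho : R) : R := (rho ^+ Q * fine (L (cball 1)))%R.

Let c0 : (0 < fine (L (cball 1)))%R.
Proof.
by rewrite fine_gt0//; apply/andP; split; [exact: unit_ball_gt0 hsigma|exact: unit_ball_lty].
Qed.

Lemma vol_gt0 rho : (0 < rho)%R -> (0 < vol rho)%R.
Proof. by move=> rho0; rewrite mulr_gt0// exprn_gt0. Qed.

Lemma cball_vol rho : (0 < rho)%R -> L (cball rho) = (vol rho)%:E.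
Proof.
move=> rho0; rewrite (ball_volume hsigma rho0) EFinM fineK//.
by rewrite ge0_fin_numE//; exact: unit_ball_lty.
Qed.

Lemma vol_ratio r s : (0 < r)%R -> (0 < s)%R ->
  (vol r / vol s = (r / s) ^+ Q)%R.
Proof.
move=> r0 s0; rewrite /vol expr_div_n; field.
by rewrite (gt_eqF c0) expf_neq0// gt_eqF.
Qed.

(** Open and closed balls differ by a null sphere, so that averages over open
    balls can be computed on closed ones and with a Borel version. *)
Lemma integral_hball (rho : R) (f g : H -> \bar R) : (0 < rho)%R ->
  measurable_fun setT g -> (forall x, 0 <= f x) -> (forall x, 0 <= g x) ->
  {ae L, forall x, f x = g x} ->
  \int[L]_(x in hball (@hzero R n) rho) f x = \int[L]_(x in cball rho) g x.
Proof.
move=> rho0 mg f0 g0 fg.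
have mo : measurable [set x : H | (hnorm x < rho)%R].
  exact: (@measurable_hnorm_itv R n `]-oo, rho[).
have mc := measurable_cball rho.
rewrite hball0E (@ge0_ae_eq_integral_measurable_r _ _ _ L _ f g)//; last 2 first.
- exact: measurable_funTS.
- by apply: filterS fg => x fgx _.
rewrite integral_mkcond [RHS]integral_mkcond.
apply: ge0_ae_eq_integral => //.
- exact/(measurable_restrictT _ mo)/measurable_funTS.
- exact/(measurable_restrictT _ mc)/measurable_funTS.
- by move=> x _; rewrite patchE; case: ifPn.
- by move=> x _; rewrite patchE; case: ifPn.
exists [set x | hnorm x = rho]; split.
- exact: measurable_hnorm_eq.
- exact: (sphere_negligible hsigma).
- move=> x /= /not_implyP[_]; rewrite !patchE => h.
  apply: contrapT => xrho; apply: h.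
  rewrite (_ : (x \in [set x0 | (hnorm x0 < rho)%R]) = (x \in cball rho))//.
  apply/idP/idP; rewrite !inE/= /cball/=; first exact: ltW.
  by rewrite le_eqVlt => /predU1P[].
Qed.

Lemma integral_hballE (rho : R) (g : H -> \bar R) : (0 < rho)%R ->
  measurable_fun setT g -> (forall x, 0 <= g x) ->
  \int[L]_(x in hball (@hzero R n) rho) g x = \int[L]_(x in cball rho) g x.
Proof. by move=> rho0 mg g0; apply: integral_hball => //; exact: aeW. Qed.

Lemma average_hball (rho : R) (f g : H -> \bar R) : (0 < rho)%R ->
  measurable_fun setT g -> (forall x, 0 <= f x) -> (forall x, 0 <= g x) ->
  {ae L, forall x, f x = g x} ->
  average (hball (@hzero R n) rho) f =
  ((vol rho)^-1)%:E * \int[L]_(x in cball rho) g x.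
Proof.
move=> rho0 mg f0 g0 fg; rewrite /average (@integral_hball _ f g)//.
congr (_ * _); rewrite -[X in (X)^-1]/(L (hball (@hzero R n) rho)).
have -> : L (hball (@hzero R n) rho) = (vol rho)%:E.
  rewrite -(cball_vol rho0).
  have mo : measurable (hball (@hzero R n) rho).
    by rewrite hball0E; exact: (@measurable_hnorm_itv R n `]-oo, rho[).
  apply: (etrans (esym (mul1e _))); apply: (etrans (esym (integral_cst L mo 1))).
  apply: (etrans _ (mul1e _)).
  apply: (etrans _ (integral_cst L (measurable_cball rho) 1)).
  by apply: integral_hball => //; exact: aeW.
by rewrite inver gt_eqF// vol_gt0.
Qed.

Variables (w u : H -> R).
Hypotheses (w0 : forall x, (0 <= w x)%R) (mu : measurable_fun setT u)
  (u0 : forall x, (0 <= u x)%R) (wu : {ae L, forall x, w x = u x}).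

Let muE : measurable_fun setT (fun x => (u x)%:E : \bar R).
Proof. exact/measurable_EFinP. Qed.

Let u0E x : 0 <= (u x)%:E. Proof. by rewrite lee_fin. Qed.

(** Extended-valued, since the finiteness of the weight of a ball is a
    consequence of the Muckenhoupt condition. *)
Definition eW (rho : R) : \bar R := \int[L]_(x in cball rho) (u x)%:E.

Let eW0 rho : 0 <= eW rho. Proof. exact: integral_ge0. Qed.

Lemma average_weight rho : (0 < rho)%R ->
  average (hball (@hzero R n) rho) (fun y => (w y)%:E) =
  ((vol rho)^-1)%:E * eW rho.
Proof.
by move=> rho0; apply: average_hball => //; apply: filterS wu => x ->.
Qed.

(** The A_zeta condition in the form of a control of the averages of nonnegative
    functions by their weighted averages.  For zeta > 1 it follows from Hoelder's
    inequality applied to g u^(1/zeta) and u^(-1/zeta); for zeta = 1 from the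
    bound of u below by a multiple of its mean value. *)
Definition muckenhoupt_mean (zeta C : R) : Prop :=
  forall (rho : R) (g : H -> R), (0 < rho)%R -> measurable_fun setT g ->
    (forall x, (0 <= g x)%R) ->
    (\int[L]_(x in cball rho) (g x)%:E) `^ zeta * eW rho <=
    (C * vol rho `^ zeta)%:E * \int[L]_(x in cball rho) (g x `^ zeta * u x)%:E.

Let measurable_mean (zeta : R) (g : H -> R) : measurable_fun setT g ->
  measurable_fun setT (fun x => (g x `^ zeta * u x)%:E : \bar R).
Proof.
move=> mg; apply/measurable_EFinP; apply: measurable_funM => //.
exact: (measurableT_comp (measurable_powR _)).
Qed.

(** This turns the essential infimum of the A_1 condition, a supremum of lower
    bounds, into an integral inequality. *)
Lemma ereal_sup_mul_le (Y : set (\bar R)) (I J : \bar R) :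
  Y 0 -> 0 <= I -> 0 <= J -> (forall y, Y y -> y * I <= J) ->
  ereal_sup Y * I <= J.
Proof.
move=> Y0 I0 J0 YJ; set e := ereal_sup Y.
have [->|In0] := eqVneq I 0; first by rewrite mule0.
have Igt0 : 0 < I by rewrite lt0e In0.
have [Ioo|Ifin] := eqVneq I +oo.
  have [e0|e0] := leP e 0.
    by apply: le_trans J0; rewrite Ioo mule_le0_ge0.
  have /ereal_sup_gt[y Yy y0] := e0.
  by have := YJ _ Yy; rewrite Ioo gt0_muley// leye_eq => /eqP ->; rewrite leey.
have If : I \is a fin_num by rewrite ge0_fin_numE// ltey.
have fI0 : (0 < fine I)%R by rewrite fine_gt0// Igt0 ltey.
rewrite -(fineK If) -lee_pdivlMr//; apply: ge_ereal_sup => y Yy.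
by rewrite lee_pdivlMr// fineK// YJ.
Qed.

Let mean_A1 : muckenhoupt1 w -> exists2 C : R, (0 <= C)%R & muckenhoupt_mean 1 C.
Proof.
move=> [C HC]; exists `|C|%R => // rho g rho0 mg g0.
set B := hball (@hzero R n) rho.
have v0 := vol_gt0 rho0.
set I := \int[L]_(x in cball rho) (g x)%:E.
have I0 : 0 <= I by apply: integral_ge0 => x _; rewrite lee_fin.
rewrite poweRe1// powRr1 ?(ltW v0)//.
set J := \int[L]_(x in cball rho) _.
have J0 : 0 <= J by apply: integral_ge0 => x _; rewrite lee_fin mulr_ge0// powR_ge0.
pose e := ess_inf_on B (fun y => (w y)%:E).
have e0 : 0 <= e.
  by apply: ereal_sup_ubound; apply: aeW => x _; rewrite lee_fin.
have eI : e * I <= J.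
  apply: ereal_sup_mul_le => //.
    by apply: aeW => x _; rewrite lee_fin.
  move=> y Yy.
  have [y0|y0] := leP 0 y; last first.
    by apply: le_trans J0; rewrite mule_le0_ge0// ltW.
  have mgE : measurable_fun setT (fun x => (g x)%:E : \bar R) by exact/measurable_EFinP.
  have gE0 x : 0 <= (g x)%:E by rewrite lee_fin.
  have gu0 x : 0 <= (g x `^ 1 * u x)%:E by rewrite lee_fin mulr_ge0// powR_ge0.
  rewrite /I -(integral_hballE rho0 mgE gE0).
  rewrite /J -(integral_hballE rho0 (measurable_mean 1 mg) gu0).
  have mB : measurable B.
    rewrite /B hball0E; exact: (@measurable_hnorm_itv R n `]-oo, rho[).
  have <- := @ge0_integralZl _ H R L B mB _ (measurable_funTS mgE) y
    (fun x _ => gE0 x) y0.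
  apply: ae_ge0_le_integral.
  - exact: mB.
  - by move=> x _; rewrite mule_ge0.
  - by apply: emeasurable_funM => //; exact: measurable_funTS.
  - by move=> x _; exact: gu0.
  - by apply: measurable_funTS; exact: measurable_mean.
  move: Yy wu; apply: filterS2 => x yw wux Bx.
  rewrite powRr1// EFinM muleC -wux; apply: lee_wpmul2l; first by rewrite lee_fin.
  exact: yw.
have {}HC : eW rho <= (`|C| * vol rho)%:E * e.
  have := HC (@hzero R n) rho rho0; rewrite average_weight// -/B -/e => h.
  have : ((vol rho)^-1)%:E * eW rho <= `|C|%:E * e.
    by apply: (le_trans h); rewrite lee_wpmul2r// lee_fin ler_norm.
  move=> /(lee_wpmul2l (x := (vol rho)%:E)); rewrite lee_fin => /(_ (ltW v0)).
  rewrite muleA -EFinM mulfV ?gt_eqF// mul1e => /le_trans; apply.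
  by rewrite muleA -EFinM mulrC.
rewrite muleC; apply: (@le_trans _ _ ((`|C| * vol rho)%:E * e * I)).
  by rewrite lee_wpmul2r.
by rewrite -muleA lee_wpmul2l// lee_fin mulr_ge0// ltW.
Qed.

Let mean_Agt1 (zeta : R) : (1 < zeta)%R -> muckenhoupt_gt1 zeta w ->
  exists2 C : R, (0 <= C)%R & muckenhoupt_mean zeta C.
Proof.
move=> z1 [C HC]; exists `|C|%R => // rho g rho0 mg g0.
have zm1 : (0 < zeta - 1)%R by rewrite subr_gt0.
have z0 : (0 < zeta)%R by exact: lt_trans z1.
have mB := measurable_cball rho.
have v0 := vol_gt0 rho0.
pose s := (zeta - 1)^-1%R.
have s0 : (0 < s)%R by rewrite invr_gt0.
pose vinv x : \bar R := if u x == 0%R then +oo else (u x `^ (- s))%:E.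
have vinv0 x : 0 <= vinv x.
  by rewrite /vinv; case: ifP => // _; rewrite lee_fin powR_ge0.
have mvinv : measurable_fun setT vinv.
  apply: measurable_fun_ifT => //.
    apply: (measurable_fun_bool true).
    rewrite (_ : _ @^-1` _ = u @^-1` [set 0%R]); last first.
      by apply/seteqP; split=> x /= /eqP.
    exact: mu.
  apply/measurable_EFinP; exact: (measurableT_comp (measurable_powR _)).
set Y := \int[L]_(x in cball rho) vinv x.
have Y0 : 0 <= Y by exact: integral_ge0.
have avY : average (hball (@hzero R n) rho) (fun y => ((w y)%:E)^-1 `^ (zeta - 1)^-1) =
    ((vol rho)^-1)%:E * Y.
  apply: average_hball => //; first by move=> x; exact: poweR_ge0.
  apply: filterS wu => x ->; rewrite /vinv inver.
  have [ux0|ux0] := eqVneq (u x) 0%R; first by rewrite poweRyr// gt_eqF.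
  by rewrite poweR_EFin -(powR_inv1 (u0 x)) -powRrM mulN1r.
have {}HC : Y `^ (zeta - 1) * eW rho <= (`|C| * vol rho `^ zeta)%:E.
  have := HC (@hzero R n) rho rho0; rewrite average_weight// avY.
  rewrite poweRM// ?lee_fin ?invr_ge0 ?(ltW v0)// => h.
  have {h} := le_trans h (_ : C%:E <= `|C|%:E); rewrite lee_fin => /(_ (ler_norm _)).
  have vz : (vol rho `^ zeta)%R != 0%R by rewrite gt_eqF// powR_gt0.
  rewrite poweR_EFin muleACA -EFinM.
  have -> : ((vol rho)^-1 * (vol rho)^-1 `^ (zeta - 1) = (vol rho `^ zeta)^-1)%R.
    rewrite mulr_powRB1// ?invr_ge0 ?(ltW v0)// -powR_inv1 ?(ltW v0)//.
    by rewrite -powRrM mulN1r powRN.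
  move=> /(lee_wpmul2l (x := (vol rho `^ zeta)%:E)); rewrite lee_fin.
  move=> /(_ (powR_ge0 _ _)); rewrite muleA -EFinM mulfV// mul1e => h.
  by rewrite mulrC EFinM muleC.
set I := \int[L]_(x in cball rho) (g x)%:E.
set J := \int[L]_(x in cball rho) _.
have I0 : 0 <= I by apply: integral_ge0 => x _; rewrite lee_fin.
have J0 : 0 <= J by apply: integral_ge0 => x _; rewrite lee_fin mulr_ge0// powR_ge0.
have [eW_0|eWn0] := eqVneq (eW rho) 0.
  by rewrite eW_0 mule0 mule_ge0// lee_fin mulr_ge0// powR_ge0.
have Yfin : Y < +oo.
  rewrite ltey; apply/eqP => Yoo; move: HC; rewrite Yoo poweRyr ?gt_eqF//.
  by rewrite gt0_mulye ?leye_eq// lt0e eWn0 eW0.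
(* The weight vanishes only on a null subset of the ball, since otherwise the
   dual average would be infinite. *)
have ae_pos : {ae L, forall x, cball rho x -> u x != 0%R}.
  have Yint : L.-integrable (cball rho) vinv.
    apply/integrableP; split; first exact: measurable_funTS.
    by rewrite (eq_integral vinv)// => x _; rewrite gee0_abs.
  have := integrable_ae mB Yint; apply: filterS => x h /h.
  by rewrite /vinv; case: ifP.
have IJ : I `^ zeta <= Y `^ (zeta - 1) * J.
  pose f x := (g x * u x `^ zeta^-1)%:E.
  pose h x := (u x `^ (- zeta^-1))%R.
  have mf : measurable_fun (cball rho) f.
    apply/measurable_EFinP/measurable_funTS; apply: measurable_funM => //.
    exact: (measurableT_comp (measurable_powR _)).
  have mh : measurable_fun (cball rho) h.
    apply: measurable_funTS; exact: (measurableT_comp (measurable_powR _)).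
  have := @hoelder_poweR R _ H L (cball rho) mB zeta f h z1 mf mh.
  have -> : \int[L]_(x in cball rho) (f x * (h x)%:E) = I.
    apply: ge0_ae_eq_integral => //.
    - by apply: emeasurable_funM => //; exact/measurable_EFinP.
    - exact/measurable_EFinP/measurable_funTS.
    - by move=> x _; rewrite mule_ge0// lee_fin ?mulr_ge0// powR_ge0.
    - by move=> x _; rewrite lee_fin.
    apply: filterS ae_pos => x hx Bx; rewrite /f /h -EFinM -mulrA -powRD.
      by rewrite subrr powRr0 mulr1.
    by rewrite (hx Bx) implybT.
  have f0 x : cball rho x -> 0 <= f x by rewrite lee_fin mulr_ge0// powR_ge0.
  have h0 x : cball rho x -> (0 <= h x)%R by move=> _; exact: powR_ge0.
  move=> /(_ f0 h0)/le_trans; apply.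
  apply: lee_pmul; [exact: poweR_ge0|by apply: integral_ge0 => x _; exact: poweR_ge0| |].
    apply: le_poweR; first exact: ltW.
      by apply: integral_ge0 => x _; rewrite lee_fin powR_ge0.
    apply: le_integral_pointwise => x _; first by rewrite lee_fin powR_ge0.
    rewrite /vinv /h; case: ifP => _; first by rewrite leey.
    rewrite -powRrM lee_fin /s.
    rewrite (_ : - zeta^-1 * (zeta / (zeta - 1)) = - (zeta - 1)^-1)%R//.
    by field; rewrite !gt_eqF.
  apply: le_integral_pointwise => x _; first exact: poweR_ge0.
  rewrite /f poweR_EFin lee_fin powRM ?powR_ge0// -powRrM mulVf ?gt_eqF//.
  by rewrite powRr1.
apply: (@le_trans _ _ (Y `^ (zeta - 1) * J * eW rho)).
  by rewrite lee_wpmul2r.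
by rewrite muleAC lee_wpmul2r.
Qed.

Lemma muckenhoupt_meanP (zeta : R) : (1 <= zeta)%R -> muckenhoupt zeta w ->
  exists2 C : R, (0 <= C)%R & muckenhoupt_mean zeta C.
Proof.
rewrite /muckenhoupt; case: eqVneq => [-> _|z1 zge1]; first exact: mean_A1.
by apply: mean_Agt1; rewrite lt_neqAle eq_sym z1.
Qed.

End weights.

Section weight_growth.
Context (R : realType) (n : nat).
Local Open Scope ereal_scope.
Local Notation H := (heis R n).
Local Notation leb := (@lebesgue_measure R).
Local Notation L := (@heis_lebesgue R n).
Local Notation Q := (hdim n).
Local Notation B rho := (@cball R n rho).
Local Notation v rho := (@vol R n rho).
Variable sigma : {finite_measure set H -> \bar R}.
Hypothesis hsigma : polar_measure sigma.
Variables (w u : H -> R).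
Hypotheses (w0 : forall x, (0 <= w x)%R) (mu : measurable_fun setT u)
  (u0 : forall x, (0 <= u x)%R) (wu : {ae L, forall x, w x = u x}).
Variables (zeta C : R).
Hypotheses (zeta1 : (1 <= zeta)%R) (C0 : (0 <= C)%R)
  (hmean : muckenhoupt_mean u zeta C).
Local Notation eW := (eW u).

Let zeta0 : (0 < zeta)%R. Proof. exact: lt_le_trans zeta1. Qed.

Let mB rho : measurable (B rho). Proof. exact: measurable_cball. Qed.

Let muE : measurable_fun setT (fun x => (u x)%:E : \bar R).
Proof. exact/measurable_EFinP. Qed.

Let eW0 rho : 0 <= eW rho.
Proof. by apply: integral_ge0 => x _; rewrite lee_fin. Qed.

(** For indicator functions the mean inequality compares the volume of a set with
    its weight; the growth properties of the weight come from here. *)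
Lemma muckenhoupt_mean_set (rho : R) (A : set H) : (0 < rho)%R -> measurable A ->
  L (A `&` B rho) `^ zeta * eW rho <=
  (C * v rho `^ zeta)%:E * \int[L]_(x in B rho) (\1_A x * u x)%:E.
Proof.
move=> rho0 mA.
have m1 : measurable_fun setT (\1_A : H -> R) by exact: measurable_indic.
have := @hmean rho (\1_A) rho0 m1 (fun x => ler0n _ _).
rewrite integral_indic//.
have -> // : \int[L]_(x in B rho) (\1_A x `^ zeta * u x)%:E =
    \int[L]_(x in B rho) (\1_A x * u x)%:E.
apply: eq_integral => x _; congr (_ * _)%:E; rewrite indicE.
by case: (x \in A); rewrite ?powR1// powR0// gt_eqF.
Qed.

Let mle (M : R) : measurable [set x | (u x <= M)%R].
Proof.
rewrite (_ : [set x | _] = u @^-1` `]-oo, M]%classic); last first.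
  by apply/seteqP; split=> x /=; rewrite in_itv.
by rewrite -[X in measurable X]setTI; apply: mu.
Qed.

(** If a ball had infinite weight, then the set where the weight is at most M
    would be null in that ball, for every M, although these sets exhaust it. *)
Lemma weight_ball_lty rho : (0 < rho)%R -> eW rho < +oo.
Proof.
move=> rho0; rewrite ltey; apply/eqP => Woo.
have null M : L ([set x | (u x <= M%:R)%R] `&` B rho) = 0.
  have := muckenhoupt_mean_set rho0 (mle M%:R).
  set A := [set x | _]; set l := L _.
  have IM : \int[L]_(x in B rho) (\1_A x * u x)%:E <= (M%:R * v rho)%:E.
    apply: (@le_trans _ _ (\int[L]_(x in B rho) (M%:R)%:E)).
      apply: le_integral_pointwise => x _; first by rewrite lee_fin mulr_ge0.
      rewrite lee_fin indicE; case: (boolP (x \in A)) => [|_]; last by rewrite mul0r.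
      by rewrite inE mul1r.
    rewrite (integral_cst L (mB rho)) [X in _ * X](cball_vol hsigma rho0).
    by rewrite -EFinM lexx.
  move=> h; apply/eqP/negPn/negP => l0.
  have lpos : 0 < l `^ zeta by rewrite poweR_gt0// lt0e l0 measure_ge0.
  have CV : 0 <= (C * v rho `^ zeta)%:E by rewrite lee_fin mulr_ge0// powR_ge0.
  have := le_trans h (lee_wpmul2l CV IM).
  by rewrite Woo gt0_muley// -EFinM leye_eq.
have BE : B rho = \bigcup_M ([set x | (u x <= M%:R)%R] `&` B rho).
  apply/seteqP; split=> x.
    move=> Bx; exists (Num.bound (u x)) => //; split => //=.
    exact/ltW/archi_boundP.
  by move=> [M _ []].
have : L (B rho) = 0.
  apply: measure_negligible => //; rewrite BE; apply: negligible_bigcup => M.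
  exists ([set x | (u x <= M%:R)%R] `&` B rho); split; [|exact: null|by []].
  by apply: measurableI => //; exact: mle.
move=> /(etrans (esym (cball_vol hsigma rho0)))/eqP; rewrite eqe.
by rewrite (gt_eqF (vol_gt0 hsigma rho0)).
Qed.

Hypothesis (rw : R) (hrw : critical_index w = rw%:E).

(** If a ball has zero weight, then so has every larger ball, and the weight
    vanishes almost everywhere.  It then satisfies every reverse Hoelder
    inequality, which contradicts the finiteness of the critical index. *)
Lemma weight_ball_gt0 rho : (0 < rho)%R -> 0 < eW rho.
Proof.
move=> rho0; rewrite lt0e eW0 andbT; apply/eqP => W0.
have W0' s : (rho <= s)%R -> eW s = 0.
  move=> rs; have s0 := lt_le_trans rho0 rs.
  have := muckenhoupt_mean_set s0 (mB rho).
  have -> : B rho `&` B s = B rho by apply/setIidl; exact: cball_subset.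
  rewrite (_ : \int[L]_(x in B s) _ = 0) ?mule0; last first.
    apply/eqP; rewrite eq_le; apply/andP; split; last first.
      by apply: integral_ge0 => x _; rewrite lee_fin mulr_ge0.
    rewrite -[leRHS]W0 [leLHS]integral_mkcond [leRHS]integral_mkcond.
    apply: le_integral_pointwise => x _; rewrite !patchE indicE.
      by case: ifP => // _; rewrite lee_fin mulr_ge0.
    case: (boolP (x \in B rho)) => xB; last first.
      by case: ifP => // _; rewrite mul0r.
    by case: ifP => _; rewrite ?mul1r// lee_fin.
  move=> h; apply/eqP/negPn/negP => Ws; move: h; apply/negP; rewrite -ltNge.
  rewrite mule_gt0//; last by rewrite lt0e Ws eW0.
  apply: poweR_gt0; rewrite [X in 0 < X](cball_vol hsigma rho0) lte_fin.
  exact: (vol_gt0 hsigma).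
have w_ae : {ae L, forall x, w x = 0%R}.
  have u_ae (k : nat) : L.-negligible (B (rho + k%:R) `&` [set x | u x != 0%R]).
    have rk : (rho <= rho + k%:R)%R by rewrite lerDl.
    have : {ae L, forall x, B (rho + k%:R) x -> (u x)%:E = 0}.
      apply: ge0_integral_eq0_ae => //; first exact: measurable_funTS.
        by move=> x _; rewrite lee_fin.
      exact: W0'.
    move=> [N [mN N0 sN]]; exists N; split => // x [Bx /= /eqP ux].
    by apply: sN => /= /(_ Bx) [].
  have := negligibleU wu (negligible_bigcup u_ae); apply: negligibleS => x /= wx.
  have [wux|wux] := pselect (w x = u x); [right|by left].
  exists (Num.bound (hnorm x)) => //; split => /=.
    rewrite /cball/=; apply: (@le_trans _ _ (Num.bound (hnorm x))%:R).
      exact/ltW/archi_boundP/hnorm_ge0.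
    by rewrite lerDr ltW.
  by apply/eqP => ux; apply: wx; rewrite wux.
have rh r : (1 < r)%R -> reverse_hoelder r w.
  move=> r1; exists 0%R => x s s0.
  have r0 : (0 < r)%R by exact: lt_trans r1.
  have int0 (h : H -> R) : (forall x, w x = 0 -> h x = 0)%R -> (forall x, (0 <= h x)%R) ->
      \int[L]_(y in hball x s) (h y)%:E = 0.
    move=> hw h0; apply/eqP; rewrite eq_le integral_ge0 ?andbT; last first.
      by move=> y _; rewrite lee_fin.
    rewrite integral_mkcond; apply: (@le_trans _ _ (\int[L]_y (h y)%:E)).
      apply: le_integral_pointwise => y _; rewrite patchE; case: ifP => //.
        by rewrite lee_fin.
      by rewrite lee_fin.
    rewrite le_eqVlt ge0_integral_ae0 ?eqxx//.
    - by move=> y _; rewrite lee_fin.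
    - by apply: filterS w_ae => y wy _; rewrite hw.
  rewrite /average !int0// ?mule0.
  - by rewrite poweR0r ?invr_eq0 ?gt_eqF.
  - by move=> y ->; rewrite powR0// gt_eqF.
  - by move=> y; exact: powR_ge0.
have : (rw + 1 + `|rw| + 1)%:E <= critical_index w.
  apply: ereal_sup_ubound; exists (rw + 1 + `|rw| + 1)%R => //.
  have h : (1 < rw + 1 + `|rw| + 1)%R.
    have : (- `|rw| <= rw)%R by rewrite lerNl -normrN ler_norm.
    lra.
  by split => //; exact: rh.
rewrite hrw lee_fin.
have : (0 <= `|rw|)%R by []. 
by move=> ? ?; lra.
Qed.

End weight_growth.

(** * Growth rates of the weight *)

#[local] Opaque heis_lebesgue.

Section weight_growth_rates.
Context (R : realType) (n : nat).
Local Open Scope ereal_scope.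
Local Notation H := (heis R n).
Local Notation L := (@heis_lebesgue R n).
Local Notation Q := (hdim n).
Local Notation B rho := (@cball R n rho).
Local Notation v rho := (@vol R n rho).
Variable sigma : {finite_measure set H -> \bar R}.
Hypothesis hsigma : polar_measure sigma.
Variables (w u : H -> R).
Hypotheses (w0 : forall x, (0 <= w x)%R) (mu : measurable_fun setT u)
  (u0 : forall x, (0 <= u x)%R) (wu : {ae L, forall x, w x = u x}).
Variables (zeta C : R).
Hypotheses (zeta1 : (1 <= zeta)%R) (C0 : (0 <= C)%R)
  (hmean : muckenhoupt_mean u zeta C).
Variable rw : R.
Hypothesis hrw : critical_index w = rw%:E.
Local Notation eW := (eW u).

Let zeta0 : (0 < zeta)%R. Proof. exact: lt_le_trans zeta1. Qed.

Let mB rho : measurable (B rho). Proof. exact: measurable_cball. Qed.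

Let muE : measurable_fun setT (fun x => (u x)%:E : \bar R).
Proof. exact/measurable_EFinP. Qed.

Let eW_gt0 rho : (0 < rho)%R -> 0 < eW rho.
Proof. by move=> ?; exact: (weight_ball_gt0 hsigma w0 mu u0 wu zeta1 hmean hrw). Qed.

Let eW_lty rho : (0 < rho)%R -> eW rho < +oo.
Proof. by move=> ?; exact: (weight_ball_lty hsigma mu u0 zeta1 C0 hmean). Qed.

Definition wball (rho : R) : R := fine (eW rho).

Lemma wballE rho : (0 < rho)%R -> eW rho = (wball rho)%:E.
Proof. by move=> r0; rewrite /wball fineK// ge0_fin_numE ?eW_lty// ltW ?eW_gt0. Qed.

Lemma wball_gt0 rho : (0 < rho)%R -> (0 < wball rho)%R.
Proof. by move=> r0; rewrite -lte_fin -wballE ?eW_gt0. Qed.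

(** The set of zeros of u has zero weight, hence zero volume in each ball by the
    mean inequality. *)
Lemma weight_pos_ae : {ae L, forall x, u x != 0%R}.
Proof.
pose A := u @^-1` [set 0%R].
have mA : measurable A by rewrite -[X in measurable X]setTI; apply: mu.
have null (k : nat) : L.-negligible (A `&` B k.+1%:R).
  have mAB : measurable (A `&` B k.+1%:R) by exact: measurableI.
  exists (A `&` B k.+1%:R); split => //.
  have k0 : (0 < k.+1%:R :> R)%R by [].
  have := muckenhoupt_mean_set zeta1 hmean k0 mA.
  rewrite (_ : \int[L]_(x in _) _ = 0) ?mule0; last first.
    apply: integral0_eq => x _; rewrite indicE.
    case: (boolP (x \in A)) => [|_]; last by rewrite mul0r.
    by rewrite inE /A/= => ->; rewrite mulr0.
  move=> h; apply/eqP/negPn/negP => l0; move: h; apply/negP; rewrite -ltNge.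
  by rewrite mule_gt0 ?eW_gt0// poweR_gt0// lt0e l0 measure_ge0.
apply: negligibleS (negligible_bigcup null) => x /= /negP/negPn/eqP ux.
exists (Num.bound (hnorm x)) => //; split => //; rewrite /cball/=.
apply: (@le_trans _ _ (Num.bound (hnorm x))%:R); last by rewrite ler_nat.
exact/ltW/archi_boundP/hnorm_ge0.
Qed.

Let mupow r : measurable_fun setT (fun x => (u x `^ r)%:E : \bar R).
Proof. by apply/measurable_EFinP; exact: (measurableT_comp (measurable_powR _)). Qed.

Let reverse_hoelder_exact (r : R) : (1 < r)%R -> reverse_hoelder r w ->
  exists2 K : R, (0 <= K)%R & forall rho, (0 < rho)%R ->
    \int[L]_(x in B rho) (u x `^ r)%:E <=
    (K * v rho `^ (1 - r) * wball rho `^ r)%:E.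
Proof.
move=> r1 [K hK]; exists (`|K| `^ r)%R; first exact: powR_ge0.
move=> rho rho0; have r0 : (0 < r)%R by exact: lt_trans r1.
have v0 := vol_gt0 hsigma rho0.
have := hK (@hzero R n) rho rho0.
rewrite (average_weight hsigma w0 mu u0 wu rho0) wballE// -EFinM.
have -> : average (hball (@hzero R n) rho) (fun y => (w y `^ r)%:E) =
    ((v rho)^-1)%:E * \int[L]_(x in B rho) (u x `^ r)%:E.
  apply: (average_hball hsigma) => //.
  - by move=> x; rewrite lee_fin powR_ge0.
  - by move=> x; rewrite lee_fin powR_ge0.
  - by apply: filterS wu => x ->.
set I := \int[L]_(x in B rho) _ => h.
have I0 : 0 <= I by apply: integral_ge0 => x _; rewrite lee_fin powR_ge0.
have vI0 : 0 <= ((v rho)^-1)%:E * I by rewrite mule_ge0// lee_fin invr_ge0 ltW.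
have Wv0 : (0 <= (v rho)^-1 * wball rho)%R.
  by rewrite mulr_ge0 ?invr_ge0 ?(ltW v0)// ltW// wball_gt0.
have {}h : ((v rho)^-1)%:E * I <= ((`|K| * ((v rho)^-1 * wball rho)) `^ r)%:E.
  rewrite -poweR_EFin.
  have -> : ((v rho)^-1)%:E * I = ((((v rho)^-1)%:E * I) `^ r^-1) `^ r.
    by rewrite -poweRrM mulVf ?gt_eqF// poweRe1.
  apply: le_poweR; [exact: ltW|exact: poweR_ge0|].
  by apply: (le_trans h); rewrite -?EFinM lee_fin ler_wpM2r// ler_norm.
have := lee_wpmul2l (x := (v rho)%:E) _ h; rewrite lee_fin => /(_ (ltW v0)).
rewrite muleA -EFinM mulfV ?gt_eqF// mul1e => /le_trans; apply.
have W0 := ltW (wball_gt0 rho0); have vV0 : (0 <= (v rho)^-1)%R by rewrite invr_ge0 ltW.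
rewrite -EFinM lee_fin (powRM _ (normr_ge0 _) Wv0) (powRM _ vV0 W0).
rewrite mulrCA -mulrA ler_wpM2l ?powR_ge0// mulrA ler_wpM2r ?powR_ge0//.
rewrite -powR_inv1 ?(ltW v0)// -powRrM mulN1r -{1}(powRr1 (ltW v0)).
by rewrite -powRD// (gt_eqF v0) implybT.
Qed.

(** Reverse Hoelder inequalities below the critical index: the supremum is
    approached by admissible exponents, and Hoelder's inequality lowers them. *)
Lemma reverse_hoelder_below (r : R) : (1 < r < rw)%R ->
  exists2 K : R, (0 <= K)%R & forall rho, (0 < rho)%R ->
    \int[L]_(x in B rho) (u x `^ r)%:E <=
    (K * v rho `^ (1 - r) * wball rho `^ r)%:E.
Proof.
move=> /andP[r1 rrw]; have r0 : (0 < r)%R by exact: lt_trans r1.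
have : r%:E < critical_index w by rewrite hrw lte_fin.
move=> /ereal_sup_gt[_ [s [s1 rhs] <-]]; rewrite lte_fin => rs.
have [K K0 hK] := reverse_hoelder_exact s1 rhs.
have s0 : (0 < s)%R by exact: lt_trans s1.
pose q := (s / r)%R.
have q1 : (1 < q)%R by rewrite ltr_pdivlMr// mul1r.
have q0 : (0 < q)%R by exact: lt_trans q1.
exists (K `^ q^-1)%R; first exact: powR_ge0.
move=> rho rho0; have v0 := vol_gt0 hsigma rho0; have W0 := wball_gt0 rho0.
set I := \int[L]_(x in B rho) _.
have I0 : 0 <= I by apply: integral_ge0 => x _; rewrite lee_fin powR_ge0.
have := @hoelder_poweR R _ H L (B rho) (mB rho) q (fun x => (u x `^ r)%:E)
  (cst 1%R) q1 (measurable_funTS (mupow r)) (measurable_cst _).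
have -> : \int[L]_(x in B rho) ((u x `^ r)%:E * (cst 1%R x)%:E) = I.
  by apply: eq_integral => x _; rewrite mule1.
have -> : \int[L]_(x in B rho) ((cst 1%R x : R) `^ (q / (q - 1)))%:E = (v rho)%:E.
  rewrite (eq_integral (cst 1)); last by move=> x _; rewrite /= powR1.
  by rewrite (integral_cst L (mB rho)) mul1e; exact: (cball_vol hsigma rho0).
have -> : \int[L]_(x in B rho) ((u x `^ r)%:E `^ q) =
    \int[L]_(x in B rho) (u x `^ s)%:E.
  by apply: eq_integral => x _; rewrite poweR_EFin -powRrM /q mulrC divfK// gt_eqF.
have h1 x : B rho x -> 0 <= (u x `^ r)%:E by rewrite lee_fin powR_ge0.
have h2 x : B rho x -> (0 <= (cst 1%R x : R))%R by [].
move=> /(_ h1 h2) h.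
have {}h : I `^ q <= (v rho `^ (q - 1) * (K * v rho `^ (1 - s) * wball rho `^ s))%:E.
  apply: (le_trans h); rewrite poweR_EFin EFinM.
  by apply: lee_wpmul2l; [rewrite lee_fin powR_ge0|exact: hK].
have -> : I = (I `^ q) `^ q^-1 by rewrite -poweRrM mulfV ?gt_eqF// poweRe1.
apply: (le_trans (le_poweR _ (poweR_ge0 _ _) h)); first by rewrite invr_ge0 ltW.
rewrite poweR_EFin lee_fin.
rewrite (powRM _ (powR_ge0 _ _) (mulr_ge0 (mulr_ge0 K0 (powR_ge0 _ _)) (powR_ge0 _ _))).
rewrite (powRM _ (mulr_ge0 K0 (powR_ge0 _ _)) (powR_ge0 _ _)) (powRM _ K0 (powR_ge0 _ _)).
rewrite -!powRrM (_ : (s * q^-1 = r)%R); last first.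
  by rewrite /q invf_div mulrC divfK// gt_eqF.
rewrite mulrA [X in (X * _ <= _)%R]mulrCA; rewrite ler_wpM2r ?powR_ge0//.
rewrite ler_wpM2l ?powR_ge0// -powRD; last by rewrite (gt_eqF v0) implybT.
rewrite (_ : ((q - 1) * q^-1 + (1 - s) * q^-1 = 1 - r)%R)//.
by rewrite /q; field; rewrite !gt_eqF.
Qed.

Lemma wball_mono r s : (0 < r)%R -> (r <= s)%R -> (wball r <= wball s)%R.
Proof.
move=> r0 rs; rewrite -lee_fin -!wballE//; last exact: lt_le_trans rs.
apply: ge0_subset_integral => //; first exact: measurable_funTS.
by move=> x _; rewrite lee_fin.
exact: cball_subset.
Qed.

Let int_small r s : (0 < r)%R -> (r <= s)%R ->
  \int[L]_(x in B s) (\1_(B r) x * u x)%:E = (wball r)%:E.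
Proof.
move=> r0 rs; rewrite -wballE// /eW [LHS]integral_mkcond [RHS]integral_mkcond.
apply: eq_integral => x _; rewrite !patchE indicE.
case: (boolP (x \in B r)) => [|_].
  by rewrite inE => /(cball_subset rs) xs; rewrite mem_set// mul1r.
by case: ifP => _; rewrite ?mul0r.
Qed.

(** The mean inequality for the indicator function of the smaller ball. *)
Lemma wball_doubling r s : (0 < r)%R -> (r <= s)%R ->
  (wball s <= C * (s / r) `^ (Q%:R * zeta) * wball r)%R.
Proof.
move=> r0 rs; have s0 := lt_le_trans r0 rs.
have := muckenhoupt_mean_set zeta1 hmean s0 (mB r).
rewrite int_small// (_ : B r `&` B s = B r); last exact/setIidl/cball_subset.
have -> : L (B r) `^ zeta = (v r `^ zeta)%:E.
  by rewrite -poweR_EFin; congr (_ `^ _); exact: (cball_vol hsigma r0).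
rewrite wballE// -!EFinM lee_fin => h.
have vr := vol_gt0 hsigma r0; have vs := vol_gt0 hsigma s0.
rewrite -(ler_pM2l (powR_gt0 zeta vr)); apply: (le_trans h).
rewrite le_eqVlt; apply/orP; left; apply/eqP.
have -> : (v s = (s / r) ^+ Q * v r)%R.
  by rewrite -(vol_ratio hsigma s0 r0) divfK// gt_eqF.
rewrite powRM ?exprn_ge0 ?divr_ge0 ?ltW//.
rewrite -powR_mulrn ?divr_ge0 ?ltW// -powRrM; ring.
Qed.

(** Hoelder's inequality on the smaller ball and the reverse Hoelder inequality
    of exponent delta on the larger one. *)
Lemma wball_decay (delta : R) : (1 < delta < rw)%R ->
  exists2 K : R, (0 <= K)%R & forall r s, (0 < r)%R -> (r <= s)%R ->
    (wball r <= K * (r / s) `^ (Q%:R * ((delta - 1) / delta)) * wball s)%R.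
Proof.
move=> hd; have [K K0 hK] := reverse_hoelder_below hd.
have /andP[d1 _] := hd; have d0 : (0 < delta)%R by exact: lt_trans d1.
exists (K `^ delta^-1)%R; first exact: powR_ge0.
move=> r s r0 rs; have s0 := lt_le_trans r0 rs.
have vr := vol_gt0 hsigma r0; have vs := vol_gt0 hsigma s0.
have Wr := wball_gt0 r0; have Ws := wball_gt0 s0.
have := @hoelder_poweR R _ H L (B r) (mB r) delta (fun x => (u x)%:E)
  (cst 1%R) d1 (measurable_funTS muE) (measurable_cst _).
have -> : \int[L]_(x in B r) ((u x)%:E * (cst 1%R x)%:E) = (wball r)%:E.
  by rewrite -wballE//; apply: eq_integral => x _; rewrite mule1.
have -> : \int[L]_(x in B r) ((cst 1%R x : R) `^ (delta / (delta - 1)))%:E = (v r)%:E.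
  rewrite (eq_integral (cst 1)); last by move=> x _; rewrite /= powR1.
  by rewrite (integral_cst L (mB r)) mul1e; exact: (cball_vol hsigma r0).
have h1 x : B r x -> 0 <= (u x)%:E by rewrite lee_fin.
have h2 x : B r x -> (0 <= (cst 1%R x : R))%R by [].
move=> /(_ h1 h2) h.
have {}h : (wball r `^ delta <=
    v r `^ (delta - 1) * (K * v s `^ (1 - delta) * wball s `^ delta))%R.
  rewrite -lee_fin EFinM -!poweR_EFin; apply: (le_trans h).
  apply: lee_wpmul2l; first exact: poweR_ge0.
  apply: le_trans (hK s s0).
  apply: ge0_subset_integral => //; first exact: measurable_funTS (mupow delta).
    by move=> x _; rewrite lee_fin powR_ge0.
  exact: cball_subset.
have -> : (wball r = (wball r `^ delta) `^ delta^-1)%R.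
  by rewrite -powRrM mulfV ?gt_eqF// powRr1// ltW.
apply: (@le_trans _ _ ((v r `^ (delta - 1) * (K * v s `^ (1 - delta) *
    wball s `^ delta)) `^ delta^-1)%R).
  by apply: ge0_ler_powR; rewrite ?nnegrE ?powR_ge0 ?invr_ge0 ?(ltW d0)// !mulr_ge0 ?powR_ge0.
rewrite (powRM _ (powR_ge0 _ _) (mulr_ge0 (mulr_ge0 K0 (powR_ge0 _ _)) (powR_ge0 _ _))).
rewrite (powRM _ (mulr_ge0 K0 (powR_ge0 _ _)) (powR_ge0 _ _)) (powRM _ K0 (powR_ge0 _ _)).
rewrite -!powRrM mulfV ?gt_eqF// powRr1 ?(ltW Ws)//.
rewrite le_eqVlt; apply/orP; left; apply/eqP.
have -> : ((r / s) `^ (Q%:R * ((delta - 1) / delta)) =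
    v r `^ ((delta - 1) * delta^-1) * v s `^ ((1 - delta) * delta^-1))%R.
  rewrite powRrM powR_mulrn ?divr_ge0 ?ltW// -(vol_ratio hsigma r0 s0).
  rewrite powRM ?invr_ge0 ?(ltW vr) ?(ltW vs)//; congr (_ * _)%R.
  rewrite -powR_inv1 ?(ltW vs)// -powRrM; congr (_ `^ _)%R; ring.
ring.
Qed.

End weight_growth_rates.

(** * Powers of the ratio of two weights *)

Section weight_ratio.
Context (R : realType).
Variables (W : R -> R) (a eta zeta K1 K2 : R).
Hypotheses (Wpos : forall r, 0 < r -> 0 < W r) (a0 : 0 <= a) (eta0 : 0 <= eta)
  (zeta0 : 0 <= zeta) (K10 : 0 <= K1) (K20 : 0 <= K2)
  (Wmono : forall r s, 0 < r -> r <= s -> W r <= W s)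
  (up : forall r s, 0 < r -> r <= s -> W s <= K1 * (s / r) `^ (a * zeta) * W r)
  (down : forall r s, 0 < r -> r <= s -> W r <= K2 * (r / s) `^ (a * eta) * W s).

(** The power weight theta of the kernel: its exponents at small and at large
    t are those of the growth of W downwards and upwards, in the order that is
    dictated by the sign of beta. *)
Definition kernel_power (e1 e2 beta t : R) : R :=
  if t <= 2^-1 then t `^ (a * e1 * beta) else t `^ (a * e2 * beta).

Let powV (x e : R) : 0 < x -> (x^-1) `^ e = x `^ (- e).
Proof. by move=> x0; rewrite -powR_inv1 ?ltW// -powRrM mulN1r. Qed.

Let upper (r s : R) : 0 < r -> 0 < s ->
  (4^-1 <= s / r -> W s / W r <= (K1 + 4 `^ (a * zeta)) * (s / r) `^ (a * zeta)) /\
  (s / r <= 1 -> W s / W r <= K2 * (s / r) `^ (a * eta)).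
Proof.
move=> r0 s0; have Wr := Wpos r0; have Ws := Wpos s0.
have x0 : 0 < s / r by rewrite divr_gt0.
split=> [x4|x1]; rewrite ler_pdivrMr//.
  have [rs|sr] := leP r s.
    apply: (le_trans (up r0 rs)); rewrite ler_wpM2r ?(ltW Wr)//.
    by rewrite ler_wpM2r ?powR_ge0// lerDl powR_ge0.
  have h : W s <= W r by apply: Wmono => //; exact: ltW.
  apply: (le_trans h); rewrite ler_peMl ?(ltW Wr)//.
  rewrite mulrDl; apply: (@le_trans _ _ (4 `^ (a * zeta) * (s / r) `^ (a * zeta))); last first.
    by rewrite lerDr mulr_ge0// powR_ge0.
  rewrite -powRM ?(ltW x0)//.
  apply: (@le_trans _ _ (1 `^ (a * zeta))); first by rewrite powR1.
  apply: ge0_ler_powR; rewrite ?nnegrE ?mulr_ge0 ?invr_ge0 ?(ltW s0) ?(ltW r0)//.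
  by move: x4; set x := s / r; lra.
by apply: down => //; rewrite -[r]mul1r -ler_pdivrMr.
Qed.

Let lower (r s : R) : 0 < r -> 0 < s ->
  (4^-1 <= s / r -> W r / W s <= (K2 + K1 * 4 `^ (a * zeta)) * (s / r) `^ (- (a * eta))) /\
  (s / r <= 1 -> W r / W s <= K1 * (s / r) `^ (- (a * zeta))).
Proof.
move=> r0 s0; have Wr := Wpos r0; have Ws := Wpos s0.
have x0 : 0 < s / r by rewrite divr_gt0.
have y0 : 0 < r / s by rewrite divr_gt0.
have xy e : (s / r) `^ (- e) = (r / s) `^ e by rewrite -powV// invf_div.
rewrite !xy; split=> [x4|x1]; rewrite ler_pdivrMr//.
  have [rs|sr] := leP r s.
    apply: (le_trans (down r0 rs)); rewrite ler_wpM2r ?(ltW Ws)//.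
    by rewrite ler_wpM2r ?powR_ge0// lerDl mulr_ge0// powR_ge0.
  apply: (le_trans (up s0 (ltW sr))); rewrite ler_wpM2r ?(ltW Ws)//.
  rewrite mulrDl; apply: (@le_trans _ _ (K1 * 4 `^ (a * zeta) * (r / s) `^ (a * eta))); last first.
    by rewrite lerDr mulr_ge0// powR_ge0.
  have ry : r / s <= 4.
    by rewrite -invf_div -[leRHS]invrK lef_pV2// posrE.
  rewrite -mulrA ler_wpM2l//.
  apply: (@le_trans _ _ (4 `^ (a * zeta))).
    by apply: ge0_ler_powR; rewrite ?nnegrE ?mulr_ge0 ?invr_ge0 ?(ltW s0) ?(ltW r0).
  rewrite ler_peMr ?powR_ge0//.
  apply: (@le_trans _ _ (1 `^ (a * eta))); first by rewrite powR1.
  apply: ge0_ler_powR; rewrite ?nnegrE ?mulr_ge0 ?invr_ge0 ?(ltW s0) ?(ltW r0)//.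
  by rewrite ler_pdivlMr// mul1r ltW.
by apply: up => //; rewrite -[r]mul1r -ler_pdivrMr.
Qed.

Let nonneg_case (beta e K t x y : R) : 0 <= beta -> 0 <= e -> 0 <= K -> 0 < t ->
  0 < x -> 0 <= y -> x <= 2 * t -> y <= K * x `^ (a * e) ->
  y `^ beta <= K `^ beta * 2 `^ (a * e * beta) * t `^ (a * e * beta).
Proof.
move=> b0 e0 K0 t0 x0 y0 xt yx.
apply: (@le_trans _ _ ((K * x `^ (a * e)) `^ beta)).
  by apply: ge0_ler_powR; rewrite ?nnegrE// mulr_ge0// powR_ge0.
rewrite powRM ?powR_ge0// -powRrM -[leRHS]mulrA ler_wpM2l ?powR_ge0//.
rewrite -powRM ?(ltW t0)//.
by apply: ge0_ler_powR; rewrite ?nnegrE ?mulr_ge0 ?(ltW x0) ?(ltW t0).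
Qed.

Let neg_case (beta e K t x y : R) : beta < 0 -> 0 <= e -> 0 <= K -> 0 < t ->
  0 < x -> 0 < y -> t / 2 <= x -> y^-1 <= K * x `^ (- (a * e)) ->
  y `^ beta <= K `^ (- beta) * 2 `^ (- (a * e * beta)) * t `^ (a * e * beta).
Proof.
move=> b0 e0 K0 t0 x0 y0 xt yx.
have g0 : 0 <= - beta by rewrite oppr_ge0 ltW.
have t2 : 0 < t / 2 by rewrite divr_gt0.
have -> : y `^ beta = (y^-1) `^ (- beta) by rewrite powV// opprK.
apply: (@le_trans _ _ ((K * x `^ (- (a * e))) `^ (- beta))).
  by apply: ge0_ler_powR; rewrite ?nnegrE ?invr_ge0 ?(ltW y0)// mulr_ge0// powR_ge0.
rewrite powRM ?powR_ge0// -powRrM -[leRHS]mulrA ler_wpM2l ?powR_ge0//.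
have -> : 2 `^ (- (a * e * beta)) * t `^ (a * e * beta) = (t / 2) `^ (a * e * beta).
  by rewrite powRM ?(ltW t0)// powV// mulrC.
rewrite mulrNN.
have -> : a * e * beta = - (a * e * - beta) by rewrite mulrN opprK.
rewrite !powRN lef_pV2 ?posrE ?powR_gt0//.
by apply: ge0_ler_powR; rewrite ?nnegrE ?mulr_ge0 ?invr_ge0 ?(ltW x0) ?(ltW t0).
Qed.

Lemma kernel_power_ge0 e1 e2 beta t : 0 <= kernel_power e1 e2 beta t.
Proof. by rewrite /kernel_power; case: ifP => _; exact: powR_ge0. Qed.

(** For t at most 1/2 the ball of radius s is the smaller one and its weight is
    bounded by the decay; for larger t the bound is the doubling property. *)
Lemma ratio_kernel_power_ge0 (beta : R) : 0 <= beta ->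
  exists2 K, 0 <= K & forall t r s, 0 < t -> 0 < r -> 0 < s ->
    t / 2 <= s / r <= 2 * t -> (W s / W r) `^ beta <= K * kernel_power eta zeta beta t.
Proof.
move=> b0; pose K3 := K1 + 4 `^ (a * zeta).
have K30 : 0 <= K3 by rewrite addr_ge0 ?powR_ge0.
exists (K2 `^ beta * 2 `^ (a * eta * beta) + K3 `^ beta * 2 `^ (a * zeta * beta)).
  by rewrite addr_ge0// mulr_ge0// powR_ge0.
move=> t r s t0 r0 s0 /andP[xt tx].
have x0 : 0 < s / r by rewrite divr_gt0.
have y0 : 0 <= W s / W r by rewrite divr_ge0// ltW ?Wpos.
have [u4 u1] := upper r0 s0; rewrite /kernel_power; case: ifPn => ht.
  have x1 : s / r <= 1 by move: tx ht; set x := s / r; lra.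
  apply: (le_trans (nonneg_case b0 eta0 K20 t0 x0 y0 tx (u1 x1))).
  by rewrite mulrDl lerDl !mulr_ge0// powR_ge0.
have x4 : 4^-1 <= s / r by apply: le_trans xt; move: ht; rewrite -ltNge; lra.
apply: (le_trans (nonneg_case b0 zeta0 K30 t0 x0 y0 tx (u4 x4))).
by rewrite mulrDl lerDr !mulr_ge0// powR_ge0.
Qed.

(** As beta is negative, the inverse of the ratio has to be bounded, and the two
    growth properties exchange their roles. *)
Lemma ratio_kernel_power_lt0 (beta : R) : beta < 0 ->
  exists2 K, 0 <= K & forall t r s, 0 < t -> 0 < r -> 0 < s ->
    t / 2 <= s / r <= 2 * t -> (W s / W r) `^ beta <= K * kernel_power zeta eta beta t.
Proof.
move=> b0; pose K3 := K2 + K1 * 4 `^ (a * zeta).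
have K30 : 0 <= K3 by rewrite addr_ge0 ?mulr_ge0 ?powR_ge0.
exists (K1 `^ (- beta) * 2 `^ (- (a * zeta * beta)) +
        K3 `^ (- beta) * 2 `^ (- (a * eta * beta))).
  by rewrite addr_ge0// mulr_ge0// powR_ge0.
move=> t r s t0 r0 s0 /andP[xt tx].
have x0 : 0 < s / r by rewrite divr_gt0.
have y0 : 0 < W s / W r by rewrite divr_gt0 ?Wpos.
have yV : (W s / W r)^-1 = W r / W s by rewrite invf_div.
have [u4 u1] := lower r0 s0; rewrite /kernel_power; case: ifPn => ht.
  have x1 : s / r <= 1 by move: tx ht; set x := s / r; lra.
  have := u1 x1; rewrite -yV => h.
  apply: (le_trans (neg_case b0 zeta0 K10 t0 x0 y0 xt h)).
  by rewrite mulrDl lerDl !mulr_ge0// powR_ge0.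
have x4 : 4^-1 <= s / r by apply: le_trans xt; move: ht; rewrite -ltNge; lra.
have := u4 x4; rewrite -yV => h.
apply: (le_trans (neg_case b0 eta0 K30 t0 x0 y0 xt h)).
by rewrite mulrDl lerDr !mulr_ge0// powR_ge0.
Qed.

End weight_ratio.

(** * Weighted and unweighted norms *)

Section norm_comparison.
Context (R : realType) (n : nat).
Local Open Scope ereal_scope.
Local Notation H := (heis R n).
Local Notation L := (@heis_lebesgue R n).
Local Notation Q := (hdim n).
Local Notation B rho := (@cball R n rho).
Local Notation v rho := (@vol R n rho).
Variable sigma : {finite_measure set H -> \bar R}.
Hypothesis hsigma : polar_measure sigma.
Variables (u : H -> R).
Hypotheses (mu : measurable_fun setT u) (u0 : forall x, (0 <= u x)%R).
Local Notation W := (wball u).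
Hypotheses (WE : forall rho, (0 < rho)%R -> eW u rho = (W rho)%:E)
  (Wpos : forall rho, (0 < rho)%R -> (0 < W rho)%R).

Let mB rho : measurable (B rho). Proof. exact: measurable_cball. Qed.

(** Passing from the weighted norm to an unweighted norm of higher exponent by
    Hoelder's inequality and the reverse Hoelder inequality of the weight. *)
Lemma weighted_norm_le (q m K : R) : (0 < q)%R -> (q < m)%R -> (0 <= K)%R ->
  (forall rho, (0 < rho)%R ->
    \int[L]_(x in B rho) (u x `^ ((m / q) / (m / q - 1)))%:E <=
    (K * v rho `^ (1 - (m / q) / (m / q - 1)) *
     W rho `^ ((m / q) / (m / q - 1)))%:E) ->
  exists2 K1 : R, (0 <= K1)%R & forall (rho : R) (D : set H) (h : H -> \bar R),
    (0 < rho)%R -> measurable D -> D `<=` B rho -> measurable_fun setT h ->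
    (forall x, 0 <= h x) ->
    (\int[L]_(x in D) (h x `^ q * (u x)%:E)) `^ q^-1 <=
    (K1 * v rho `^ (- m^-1) * W rho `^ q^-1)%:E *
    (\int[L]_(x in D) (h x `^ m)) `^ m^-1.
Proof.
move=> q0 qm K0 hK; have m0 : (0 < m)%R by exact: lt_trans qm.
set P := (m / q)%R in hK; set r := (P / (P - 1))%R in hK.
have P1 : (1 < P)%R by rewrite ltr_pdivlMr// mul1r.
have P0 : (0 < P)%R by exact: lt_trans P1.
have Pm1 : (0 < P - 1)%R by rewrite subr_gt0.
exists (K `^ ((P - 1) / m))%R; first exact: powR_ge0.
move=> rho D h rho0 mD DB mh h0.
have v0 := vol_gt0 hsigma rho0; have W0 := Wpos rho0.
set I := \int[L]_(x in D) _; set J := \int[L]_(x in D) _.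
have I0 : 0 <= I.
  by apply: integral_ge0 => x _; rewrite mule_ge0 ?poweR_ge0// lee_fin.
have J0 : 0 <= J by apply: integral_ge0 => x _; exact: poweR_ge0.
have mhq : measurable_fun D (fun x => h x `^ q).
  by apply: measurable_funTS; exact: (measurableT_comp (measurable_poweR _)).
have := @hoelder_poweR R _ H L D mD P (fun x => h x `^ q) u P1 mhq
  (measurable_funTS mu) (fun x _ => poweR_ge0 _ _) (fun x _ => u0 x).
have -> : \int[L]_(x in D) ((h x `^ q) `^ P) = J.
  by apply: eq_integral => x _; rewrite -poweRrM /P mulrC divfK// gt_eqF.
rewrite -/r -/I => hIJ.
have IJ : I `^ P <= ((K * v rho `^ (1 - r) * W rho `^ r) `^ (P - 1))%:E * J.
  apply: (le_trans hIJ); apply: lee_wpmul2r => //; rewrite -poweR_EFin.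
  apply: le_poweR; [exact: ltW|by apply: integral_ge0 => x _; rewrite lee_fin powR_ge0|].
  apply: le_trans (hK rho rho0); apply: ge0_subset_integral => //.
    by apply: measurable_funTS; apply/measurable_EFinP; exact: (measurableT_comp (measurable_powR _)).
  by move=> x _; rewrite lee_fin powR_ge0.
have -> : I `^ q^-1 = (I `^ P) `^ m^-1.
  by rewrite -poweRrM; congr (_ `^ _); rewrite /P; field; rewrite !gt_eqF.
apply: (le_trans (le_poweR _ (poweR_ge0 _ _) IJ)); first by rewrite invr_ge0 ltW.
rewrite poweRM ?lee_fin ?powR_ge0//; apply: lee_wpmul2r; first exact: poweR_ge0.
rewrite poweR_EFin lee_fin -powRrM.
rewrite (powRM _ (mulr_ge0 K0 (powR_ge0 _ _)) (powR_ge0 _ _)) (powRM _ K0 (powR_ge0 _ _)).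
rewrite -!powRrM.
have -> : ((1 - r) * ((P - 1) * m^-1) = - m^-1)%R.
  by rewrite /r; field; rewrite !gt_eqF.
have -> : (r * ((P - 1) * m^-1) = q^-1)%R.
  have mq : (0 < m - q)%R by rewrite subr_gt0.
  by rewrite /r /P; field; rewrite mulN1r (gt_eqF mq) (gt_eqF m0) (gt_eqF q0).
exact: lexx.
Qed.

(** The mean inequality for h ^ (qs / zeta), restricted to D. *)
Lemma unweighted_norm_le (zeta qs C : R) : (1 <= zeta)%R -> (0 < qs)%R -> (0 <= C)%R ->
  muckenhoupt_mean u zeta C ->
  forall (rho : R) (D : set H) (h : H -> R),
    (0 < rho)%R -> measurable D -> D `<=` B rho -> measurable_fun setT h ->
    (forall x, (0 <= h x)%R) ->
    \int[L]_(x in D) (h x `^ (qs / zeta))%:E <=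
    (C `^ zeta^-1 * v rho * W rho `^ (- zeta^-1))%:E *
    (\int[L]_(x in D) (h x `^ qs * u x)%:E) `^ zeta^-1.
Proof.
move=> zeta1 qs0 C0 hmean rho D h rho0 mD DB mh h0.
have z0 : (0 < zeta)%R by exact: lt_le_trans zeta1.
have v0 := vol_gt0 hsigma rho0; have W0 := Wpos rho0.
pose g x := (\1_D x * h x `^ (qs / zeta))%R.
have mg : measurable_fun setT g.
  apply: measurable_funM; first exact: measurable_indic.
  exact: (measurableT_comp (measurable_powR _)).
have g0 x : (0 <= g x)%R by rewrite mulr_ge0// powR_ge0.
have restr (f g' : H -> R) : (forall x, D x -> f x = g' x) ->
    (forall x, ~ D x -> f x = 0%R) ->
    \int[L]_(x in B rho) (f x)%:E = \int[L]_(x in D) (g' x)%:E.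
  move=> fD fnD; rewrite [LHS]integral_mkcond [RHS]integral_mkcond.
  apply: eq_integral => x _; rewrite !patchE.
  case: (boolP (x \in D)) => [/set_mem Dx|/negP nD].
    by rewrite mem_set ?fD//; exact: DB.
  by case: ifP => // _; rewrite fnD// => Dx; apply: nD; rewrite inE.
have := hmean rho g rho0 mg g0.
rewrite (restr g (fun x => h x `^ (qs / zeta))%R); last 2 first.
- by move=> x Dx; rewrite /g indicE mem_set// mul1r.
- by move=> x Dx; rewrite /g indicE memNset// mul0r.
rewrite (restr (fun x => g x `^ zeta * u x)%R (fun x => h x `^ qs * u x)%R); last 2 first.
- move=> x Dx; rewrite /g indicE mem_set// mul1r -powRrM divfK// gt_eqF//.
- by move=> x Dx; rewrite /g indicE memNset// mul0r powR0 ?mul0r// gt_eqF.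
rewrite WE//.
set I := \int[L]_(x in D) _; set J := \int[L]_(x in D) _ => hIJ.
have I0 : 0 <= I by apply: integral_ge0 => x _; rewrite lee_fin powR_ge0.
have J0 : 0 <= J.
  by apply: integral_ge0 => x _; rewrite lee_fin mulr_ge0// powR_ge0.
have {}hIJ : I `^ zeta <= (C * v rho `^ zeta * (W rho)^-1)%:E * J.
  have WV : 0 <= ((W rho)^-1)%:E by rewrite lee_fin invr_ge0 ltW.
  have := lee_wpmul2r WV hIJ.
  rewrite -muleA -EFinM mulfV ?gt_eqF// mule1 => /le_trans; apply.
  by rewrite muleAC -EFinM.
have -> : I = (I `^ zeta) `^ zeta^-1.
  by rewrite -poweRrM mulfV ?gt_eqF// poweRe1.
apply: (le_trans (le_poweR _ (poweR_ge0 _ _) hIJ)); first by rewrite invr_ge0 ltW.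
have Wi0 : (0 <= (W rho)^-1)%R by rewrite invr_ge0 ltW.
rewrite poweRM//; last by rewrite lee_fin !mulr_ge0// powR_ge0.
apply: lee_wpmul2r; first exact: poweR_ge0.
rewrite poweR_EFin lee_fin.
rewrite (powRM _ (mulr_ge0 C0 (powR_ge0 _ _)) Wi0) (powRM _ C0 (powR_ge0 _ _)).
rewrite -powRrM mulfV ?gt_eqF// powRr1 ?(ltW v0)//.
by rewrite -(powR_inv1 (ltW W0)) -powRrM mulN1r.
Qed.

(** Hoelder's inequality on the sphere removes O; what remains is the integral
    over a shell of the spherical means of f ^ m. *)
Lemma sphere_hoelder_shell (m : R) (O f : H -> R) (t a b : R) :
  (1 < m)%R -> (0 < t)%R ->
  measurable_fun setT O -> (forall y, (0 <= O y)%R) ->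
  measurable_fun setT f -> (forall y, (0 <= f y)%R) ->
  \int[L]_(x in [set x | (a < hnorm x <= b)%R])
    (\int[sigma]_(y in @hsphere R n) (O y * f (hdil (hnorm x / t) y))%:E) `^ m <=
  (\int[sigma]_(y in @hsphere R n) (O y `^ (m / (m - 1)))%:E) `^ (m - 1) *
  (sigma (@hsphere R n) *
   ((t ^+ Q)%:E * \int[L]_(x in [set x | (a < t * hnorm x <= b)%R]) (f x `^ m)%:E)).
Proof.
move=> m1 t0 mO O0 mf f0.
have mS := @measurable_hsphere R n.
set A := \int[sigma]_(y in _) _.
have A0 : 0 <= A by apply: integral_ge0 => y _; rewrite lee_fin powR_ge0.
pose fm x := (f x `^ m)%:E.
have mfm : measurable_fun setT fm.
  by apply/measurable_EFinP; exact: (measurableT_comp (measurable_powR _)).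
have fm0 x : 0 <= fm x by rewrite lee_fin powR_ge0.
pose g (r : R) : \bar R := (\1_(`]a, b]%classic : set R) r)%:E.
have mg : measurable_fun setT g.
  by apply/measurable_EFinP; exact: measurable_indic.
have g0 r : 0 <= g r by rewrite lee_fin.
have shellE (c : H -> R) (h : H -> \bar R) :
    \int[L]_(x in [set x | (a < c x <= b)%R]) h x = \int[L]_x (g (c x) * h x).
  rewrite integral_mkcond; apply: eq_integral => x _; rewrite patchE /g indicE.
  have -> : (c x \in (`]a, b]%classic : set R)) = (x \in [set x | (a < c x <= b)%R]).
    by apply/idP/idP; rewrite !inE/= in_itv.
  by case: ifP => _; rewrite ?mul1e ?mul0e.
rewrite shellE.
apply: (@le_trans _ _ (\int[L]_x (A `^ (m - 1) *
    (g (hnorm x) * sphere_integral sigma fm (hnorm x / t)%R)))).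
  apply: le_integral_pointwise => x _; first by rewrite mule_ge0 ?poweR_ge0.
  rewrite muleCA; apply: lee_wpmul2l => //.
  rewrite (eq_integral (fun y => (f (hdil (hnorm x / t) y))%:E * (O y)%:E)); last first.
    by move=> y _; rewrite -EFinM mulrC.
  apply: hoelder_poweR => //.
  - apply/measurable_EFinP/measurable_funTS.
    exact: (measurableT_comp mf (measurable_hdil _)).
  - exact: measurable_funTS.
  - by move=> y _; rewrite lee_fin.
rewrite ge0_integralZl ?poweR_ge0//; last 2 first.
- apply: emeasurable_funM.
    exact: (measurableT_comp mg (@measurable_hnorm R n)).
  have mq : measurable_fun setT (fun x : H => hnorm x / t)%R.
    by apply: measurable_funM => //; exact: measurable_hnorm.
  exact: (measurableT_comp (measurable_sphere_integral sigma mfm fm0) mq).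
- by move=> x _; rewrite mule_ge0 ?sphere_integral_ge0.
apply: lee_wpmul2l; first exact: poweR_ge0.
rewrite (integral_sphere_integral hsigma t0 mg g0 mfm fm0).
by rewrite -shellE.
Qed.

End norm_comparison.

(** * Dyadic scales *)

Section dyadic_logarithm.
Context (R : realType).

(** The fibres of a rounded measurable function are countably many measurable
    sets. *)
Lemma measurable_comp_int d (T : measurableType d) (f : T -> R) (h : int -> R) :
  measurable_fun setT f -> measurable_fun setT (fun t => h (Num.ceil (f t))).
Proof.
move=> mf _ Y _; rewrite setTI.
pose A (z : int) := f @^-1` (`]((z - 1)%:~R), z%:~R]%classic : set R).
have mA z : measurable (A z) by rewrite -[X in measurable X]setTI; apply: mf.
have AE t : A (Num.ceil (f t)) t.
  by rewrite /A/= in_itv/= ceil_itv.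
have Ainj z t : A z t -> Num.ceil (f t) = z.
  by rewrite /A/= in_itv/= => h1; apply/ceil_def.
rewrite (_ : _ @^-1` Y = \bigcup_i (A (Posz i) `&` [set _ | Y (h (Posz i))]) `|`
   \bigcup_i (A (Negz i) `&` [set _ | Y (h (Negz i))])); last first.
  apply/seteqP; split=> t /=.
    move=> Yt; case E : (Num.ceil (f t)) Yt => [i|i] Yt; [left|right];
      by exists i => //; split => //; rewrite -E.
  by move=> [[i _ [/Ainj ->]]|[i _ [/Ainj ->]]].
have mc (P : Prop) : measurable [set _ : T | P].
  have [p|p] := pselect P.
    by rewrite (_ : [set _ | P] = setT)//; apply/seteqP; split.
  by rewrite (_ : [set _ | P] = set0)//; apply/seteqP; split.
by apply: measurableU; apply: bigcupT_measurable => i; apply: measurableI.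
Qed.

Definition dlog (t : R) : int := Num.ceil (ln t / ln 2).

Lemma dlogP (t : R) : 0 < t -> 2 ^ (dlog t - 1) < t <= 2 ^ (dlog t).
Proof.
move=> t0; have l2 : 0 < ln 2 :> R by rewrite ln_gt0// ltr1n.
have powE (z : int) : 2 ^ z = expR (z%:~R * ln 2) :> R.
  by rewrite -powR_intmul// /powR gt_eqF.
have tE : t = expR (ln t / ln 2 * ln 2) by rewrite divfK ?gt_eqF// lnK.
rewrite !powE {2 3}tE ltr_expR ler_expR ltr_pM2r// ler_pM2r//.
exact: ceil_itv.
Qed.

End dyadic_logarithm.

(** * The estimate on one dyadic shell *)

Lemma ge0_ler_powRN (R : realType) (e x y : R) : 0 <= e -> 0 < x -> x <= y ->
  y `^ (- e) <= x `^ (- e).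
Proof.
move=> e0 x0 xy; have y0 := lt_le_trans x0 xy.
rewrite !powRN lef_pV2 ?posrE ?powR_gt0//.
by apply: ge0_ler_powR; rewrite ?nnegrE ?(ltW x0) ?(ltW y0).
Qed.

Section shell_estimate.
Context (R : realType) (n : nat).
Local Open Scope ereal_scope.
Local Notation H := (heis R n).
Local Notation L := (@heis_lebesgue R n).
Local Notation leb := (@lebesgue_measure R).
Local Notation Q := (hdim n).
Local Notation B rho := (@cball R n rho).
Local Notation v rho := (@vol R n rho).
Local Notation S := (@hsphere R n).
Variable sigma : {finite_measure set H -> \bar R}.
Hypothesis hsigma : polar_measure sigma.
Variables (u : H -> R).
Hypotheses (mu : measurable_fun setT u) (u0 : forall x, (0 <= u x)%R).
Local Notation W := (wball u).
Hypotheses (WE : forall rho, (0 < rho)%R -> eW u rho = (W rho)%:E)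
  (Wpos : forall rho, (0 < rho)%R -> (0 < W rho)%R)
  (Wmono : forall r s, (0 < r)%R -> (r <= s)%R -> (W r <= W s)%R).

Lemma dyadic_shellE (k : int) :
  @dyadic_shell R n k = [set x | (2 ^ (k - 1) < hnorm x <= 2 ^ k)%R].
Proof.
apply/seteqP; split=> x /=; rewrite /dyadic_shell /dyadic_ball/=.
  by move=> [xk /negP]; rewrite -ltNge => -> /=.
by move=> /andP[kx xk]; split => //; apply/negP; rewrite -ltNge.
Qed.

Lemma measurable_dyadic_shell (k : int) : measurable (@dyadic_shell R n k).
Proof.
rewrite dyadic_shellE (_ : [set x | _] = [set x : H | hnorm x \in `](2 ^ (k - 1))%R, (2 ^ k)%R]]).
  exact: measurable_hnorm_itv.
by apply/seteqP; split=> x /=; rewrite in_itv.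
Qed.

Lemma dyadic_shell_sub (k : int) : @dyadic_shell R n k `<=` B (2 ^ k)%R.
Proof. by rewrite dyadic_shellE => x /= /andP[]. Qed.

Variables (qs zeta m beta C Kr : R) (theta : R -> R).
Hypotheses (zeta1 : (1 <= zeta)%R) (qs0 : (0 < qs)%R) (mE : m = (qs / zeta)%R)
  (m1 : (1 < m)%R) (C0 : (0 <= C)%R) (hmean : muckenhoupt_mean u zeta C)
  (Kr0 : (0 <= Kr)%R) (theta0 : forall t, (0 <= theta t)%R)
  (hratio : forall t r s, (0 < t)%R -> (0 < r)%R -> (0 < s)%R ->
     (t / 2 <= s / r <= 2 * t)%R -> ((W s / W r) `^ beta <= Kr * theta t)%R).
Variable O : H -> R.
Hypotheses (mO : measurable_fun setT O) (O0 : forall y, (0 <= O y)%R)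
  (OLp : \int[sigma]_(y in S) (O y `^ (m / (m - 1)))%:E < +oo).

Definition shell_norm (f : H -> R) (i : int) : R :=
  fine ((\int[L]_(x in @dyadic_shell R n i) (f x `^ qs * u x)%:E) `^ qs^-1).

(** The exponent beta - 1/qs is alphas / Q, so these are the terms of the Herz
    norm of f, before they are raised to the power p. *)
Definition herz_term (f : H -> R) (i : int) : R :=
  (W (2 ^ i) `^ (beta - qs^-1) * shell_norm f i)%R.

Let z0 : (0 < zeta)%R. Proof. exact: lt_le_trans zeta1. Qed.
Let m0 : (0 < m)%R. Proof. exact: lt_trans m1. Qed.
Let pow2_gt0 (i : int) : (0 < 2 ^ i :> R)%R. Proof. exact: exprz_gt0. Qed.

Lemma herz_term_ge0 f i : (0 <= herz_term f i)%R.
Proof. by rewrite mulr_ge0 ?powR_ge0// fine_ge0// poweR_ge0. Qed.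

(* If 2^(j-1) < t <= 2^j, then 2^(k-1) < t|x| <= 2^k puts x in one of the two
   shells of index k - j and k - j + 1. *)
Let dilated_shell_sub (t : R) (k : int) : (0 < t)%R ->
  [set x : H | (2 ^ (k - 1) < t * hnorm x <= 2 ^ k)%R] `<=`
  @dyadic_shell R n (k - dlog t) `|` @dyadic_shell R n (k - dlog t + 1).
Proof.
move=> t0 x /= /andP[kx xk]; have /andP[j1 j2] := dlogP t0.
set j := dlog t in j1 j2 *.
have n2 : (2 != 0 :> R)%R by [].
have x0 : (0 < hnorm x)%R.
  by rewrite -(pmulr_rgt0 _ t0); apply: lt_trans kx.
have lo : (2 ^ (k - j - 1) < hnorm x)%R.
  rewrite -(ltr_pM2l (pow2_gt0 j)) -expfzDr// addrA addrCA subrr addr0.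
  by apply: (lt_le_trans kx); rewrite ler_pM2r.
have hi : (hnorm x <= 2 ^ (k - j + 1))%R.
  rewrite -(ler_pM2l (pow2_gt0 (j - 1))) -expfzDr//.
  rewrite (_ : (j - 1 + (k - j + 1) = k)%R); last by ring.
  by apply: le_trans xk; rewrite ler_pM2r// ltW.
rewrite !dyadic_shellE/=; have [h|h] := leP (hnorm x) (2 ^ (k - j))%R.
  by left; rewrite lo.
by right; rewrite addrK h.
Qed.

Section one_function.
Variable f : H -> R.
Hypotheses (mf : measurable_fun setT f) (f0 : forall y, (0 <= f y)%R)
  (fLq : forall i, \int[L]_(x in @dyadic_shell R n i) (f x `^ qs * u x)%:E < +oo).

Let mfu : measurable_fun setT (fun x => (f x `^ qs * u x)%:E : \bar R).
Proof.
apply/measurable_EFinP; apply: measurable_funM => //.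
exact: (measurableT_comp (measurable_powR _)).
Qed.

Let fu0 x : 0 <= (f x `^ qs * u x)%:E.
Proof. by rewrite lee_fin mulr_ge0// powR_ge0. Qed.

Lemma shell_normE i :
  \int[L]_(x in @dyadic_shell R n i) (f x `^ qs * u x)%:E = (shell_norm f i `^ qs)%:E.
Proof.
rewrite -poweR_EFin /shell_norm fineK.
  by rewrite -poweRrM mulVf ?gt_eqF// poweRe1//; exact: integral_ge0.
by rewrite fin_num_poweR// ge0_fin_numE//; exact: integral_ge0.
Qed.

Let shell_norm_ge0 i : (0 <= shell_norm f i)%R.
Proof. by rewrite fine_ge0// poweR_ge0. Qed.

(* Superadditivity of the power qs joins the norms on the two shells. *)
Let two_shells (t : R) (k : int) : (0 < t)%R ->
  \int[L]_(x in [set x : H | (2 ^ (k - 1) < t * hnorm x <= 2 ^ k)%R]) (f x `^ qs * u x)%:E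
  <= ((shell_norm f (k - dlog t) + shell_norm f (k - dlog t + 1)) `^ qs)%:E.
Proof.
move=> t0; set i := (k - dlog t)%R.
have mC := measurable_dyadic_shell.
have mD : measurable [set x : H | (2 ^ (k - 1) < t * hnorm x <= 2 ^ k)%R].
  rewrite (_ : [set x | _] = (fun x : H => t * hnorm x)%R @^-1`
      (`](2 ^ (k - 1))%R, (2 ^ k)%R]%classic : set R)); last first.
    by apply/seteqP; split=> x /=; rewrite in_itv.
  rewrite -[X in measurable X]setTI.
  have mt : measurable_fun setT (fun x : H => t * hnorm x)%R.
    by apply: measurable_funM => //; exact: measurable_hnorm.
  exact: mt.
apply: (@le_trans _ _ (\int[L]_(x in @dyadic_shell R n i `|` @dyadic_shell R n (i + 1))
    (f x `^ qs * u x)%:E)).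
  apply: ge0_subset_integral => //; first exact: measurableU.
    exact: measurable_funTS.
  exact: dilated_shell_sub.
rewrite ge0_integral_setU//; last 2 first.
- exact: measurable_funTS.
- rewrite disj_set2E; apply/eqP/seteqP; split=> x //=.
  rewrite !dyadic_shellE/= addrK => -[/andP[_ h1] /andP[h2 _]].
  by move: (lt_le_trans h2 h1); rewrite ltxx.
rewrite !shell_normE -EFinD lee_fin.
set a := shell_norm f i; set b := shell_norm f (i + 1).
have a0 : (0 <= a)%R := shell_norm_ge0 i.
have b0 : (0 <= b)%R := shell_norm_ge0 (i + 1).
have qs1 : (1 <= qs)%R.
  have qsE : (qs = m * zeta)%R by rewrite mE divfK ?gt_eqF.
  by rewrite qsE mulr_ege1// ltW.
have split1 : ((a + b) `^ qs = (a + b) `^ (qs - 1) * a + (a + b) `^ (qs - 1) * b)%R.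
  by rewrite -mulrDr [RHS]mulrC mulr_powRB1// addr_ge0.
rewrite split1; apply: lerD.
  rewrite -(mulr_powRB1 a0 qs0) mulrC ler_wpM2r//.
  by apply: ge0_ler_powR; rewrite ?nnegrE ?subr_ge0 ?addr_ge0// lerDl.
rewrite -(mulr_powRB1 b0 qs0) mulrC ler_wpM2r//.
by apply: ge0_ler_powR; rewrite ?nnegrE ?subr_ge0 ?addr_ge0// lerDr.
Qed.

Let sphere_const : R :=
  fine ((\int[sigma]_(y in S) (O y `^ (m / (m - 1)))%:E) `^ (m - 1) * sigma S).

Let sphere_constE :
  (\int[sigma]_(y in S) (O y `^ (m / (m - 1)))%:E) `^ (m - 1) * sigma S =
  sphere_const%:E.
Proof.
rewrite /sphere_const fineK// fin_numM//.
  rewrite fin_num_poweR// ge0_fin_numE//; apply: integral_ge0 => y _.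
  by rewrite lee_fin powR_ge0.
exact: fin_num_measure (@measurable_hsphere R n).
Qed.

Let sphere_const_ge0 : (0 <= sphere_const)%R.
Proof. by rewrite -lee_fin -sphere_constE mule_ge0// poweR_ge0. Qed.

Definition shell_const : R :=
  ((sphere_const * (C `^ zeta^-1 * 2 ^+ Q)) `^ m^-1 * Kr)%R.

Lemma shell_const_ge0 : (0 <= shell_const)%R.
Proof. by rewrite mulr_ge0// powR_ge0. Qed.

(* The weight factor of one shell, with the exponent -1/qs split as
   -beta + (beta - 1/qs) and W_k / W_i controlled by the kernel power. *)
Let weight_shift (t : R) (k i l : int) : (0 < t)%R -> (i <= l)%R ->
  (t / 2 <= 2 ^ k / 2 ^ i <= 2 * t)%R ->
  (W (2 ^ l) `^ (- qs^-1) * shell_norm f i <=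
   Kr * theta t * W (2 ^ k) `^ (- beta) * herz_term f i)%R.
Proof.
move=> t0 il tki.
have Wi := Wpos (pow2_gt0 i); have Wl := Wpos (pow2_gt0 l).
have Wk := Wpos (pow2_gt0 k).
have Wil : (W (2 ^ i) <= W (2 ^ l))%R.
  by apply: Wmono => //; rewrite ler_eXz2l// ltr1n.
apply: (@le_trans _ _ (W (2 ^ i) `^ (- qs^-1) * shell_norm f i)%R).
  apply: ler_wpM2r; first exact: shell_norm_ge0.
  by apply: ge0_ler_powRN; rewrite ?invr_ge0 ?(ltW qs0).
have -> : (W (2 ^ i) `^ (- qs^-1) = W (2 ^ i) `^ (- beta) * W (2 ^ i) `^ (beta - qs^-1))%R.
  rewrite -powRD; last by rewrite (gt_eqF Wi) implybT.
  by congr (_ `^ _)%R; ring.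
rewrite /herz_term [leRHS]mulrA; apply: ler_wpM2r; first exact: shell_norm_ge0.
apply: ler_wpM2r; first exact: powR_ge0.
have -> : (W (2 ^ i) `^ (- beta) =
    (W (2 ^ k) / W (2 ^ i)) `^ beta * W (2 ^ k) `^ (- beta))%R.
  rewrite powRM ?invr_ge0 ?(ltW Wi) ?(ltW Wk)// mulrAC -powRD; last first.
    by rewrite (gt_eqF Wk) implybT.
  by rewrite subrr powRr0 mul1r -(powR_inv1 (ltW Wi)) -powRrM mulN1r.
by rewrite ler_wpM2r ?powR_ge0// hratio.
Qed.

(** After Hoelder's inequality on the sphere, the shell of index k is seen through
    the dilation by t as a subset of the two shells where f is measured.  The
    mean inequality on the ball of radius 2 ^ l, which contains them, restores the
    weight; the powers of t cancel against the ratio of volumes, and the ratio of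
    weights is bounded by theta t. *)
Lemma shell_estimate (t : R) (k : int) : (0 < t)%R ->
  \int[L]_(x in @dyadic_shell R n k)
    (\int[sigma]_(y in S) (O y * f (hdil (hnorm x / t) y))%:E) `^ m <=
  ((theta t * (shell_const * v (2 ^ k) `^ m^-1 * W (2 ^ k) `^ (- beta) *
     (herz_term f (k - dlog t) + herz_term f (k - dlog t + 1)))) `^ m)%:E.
Proof.
move=> t0; rewrite dyadic_shellE.
apply: (le_trans (sphere_hoelder_shell hsigma _ _ m1 t0 mO O0 mf f0)).
rewrite muleA sphere_constE; set D := [set x | _].
have /andP[j1 j2] := dlogP t0.
set i := (k - dlog t)%R; set l := (i + 1)%R.
set N := (shell_norm f i + shell_norm f l)%R.
have N0 : (0 <= N)%R by rewrite addr_ge0.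
have mt : measurable_fun setT (fun x : H => t * hnorm x)%R.
  by apply: measurable_funM => //; exact: measurable_hnorm.
have mD : measurable D.
  rewrite (_ : D = (fun x : H => t * hnorm x)%R @^-1`
      (`](2 ^ (k - 1))%R, (2 ^ k)%R]%classic : set R)); last first.
    by apply/seteqP; split=> x /=; rewrite in_itv.
  by rewrite -[X in measurable X]setTI; exact: mt.
have n2 : (2 != 0 :> R)%R by [].
have DB : D `<=` B (2 ^ l)%R.
  move=> x /(dilated_shell_sub t0)[|] /dyadic_shell_sub//.
  by apply: cball_subset; rewrite ler_eXz2l ?ltr1n// lerDl.
have := unweighted_norm_le hsigma u0 WE Wpos zeta1 qs0 C0 hmean (pow2_gt0 l) mD DB mf f0.
rewrite -mE => hD.
have {}hD : \int[L]_(x in D) (f x `^ m)%:E <=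
    (C `^ zeta^-1 * v (2 ^ l) * W (2 ^ l) `^ (- zeta^-1) * N `^ m)%:E.
  apply: (le_trans hD); rewrite [leRHS]EFinM; apply: lee_wpmul2l.
    rewrite lee_fin mulr_ge0 ?powR_ge0// mulr_ge0 ?powR_ge0// ltW//.
    exact: (vol_gt0 hsigma).
  apply: (@le_trans _ _ ((N `^ qs)%:E `^ zeta^-1)).
    apply: le_poweR; [by rewrite invr_ge0 ltW|exact: integral_ge0|].
    exact: two_shells.
  by rewrite poweR_EFin -powRrM -mE.
apply: (@le_trans _ _ (sphere_const%:E * ((t ^+ Q)%:E *
    (C `^ zeta^-1 * v (2 ^ l) * W (2 ^ l) `^ (- zeta^-1) * N `^ m)%:E))).
  apply: lee_wpmul2l; first by rewrite lee_fin.
  by apply: lee_wpmul2l => //; rewrite lee_fin exprn_ge0// ltW.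
rewrite -!EFinM lee_fin.
have vk := vol_gt0 hsigma (pow2_gt0 k); have vl := vol_gt0 hsigma (pow2_gt0 l).
have Wl := Wpos (pow2_gt0 l).
have volt : (t ^+ Q * v (2 ^ l) <= 2 ^+ Q * v (2 ^ k))%R.
  rewrite -ler_pdivlMr// -mulrA (vol_ratio hsigma (pow2_gt0 k) (pow2_gt0 l)).
  rewrite -exprMn lerXn2r ?nnegrE ?mulr_ge0 ?invr_ge0 ?(ltW t0) ?(ltW (pow2_gt0 _))//.
  rewrite mulrA ler_pdivlMr//; apply: (le_trans (ler_wpM2r (ltW (pow2_gt0 l)) j2)).
  rewrite -expfzDr// (_ : dlog t + l = 1 + k)%R; last by rewrite /l /i; ring.
  by rewrite expfzDr// expr1z.
pose X := ((sphere_const * (C `^ zeta^-1 * 2 ^+ Q)) `^ m^-1 * v (2 ^ k) `^ m^-1 *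
  (W (2 ^ l) `^ (- qs^-1) * N))%R.
have X0 : (0 <= X)%R by rewrite !mulr_ge0 ?powR_ge0.
apply: (@le_trans _ _ (X `^ m)%R).
  rewrite /X.
  rewrite (powRM _ (mulr_ge0 (powR_ge0 _ _) (powR_ge0 _ _)) (mulr_ge0 (powR_ge0 _ _) N0)).
  rewrite (powRM _ (powR_ge0 _ _) (powR_ge0 _ _)) (powRM _ (powR_ge0 _ _) N0).
  rewrite -!powRrM mulVf ?gt_eqF// !powRr1 ?(ltW vk) ?mulr_ge0 ?powR_ge0//.
  have -> : (- qs^-1 * m = - zeta^-1)%R by rewrite mE; field; rewrite !gt_eqF.
  set c := (C `^ zeta^-1)%R; set w' := (W (2 ^ l) `^ _)%R; set N' := (N `^ m)%R.
  rewrite (_ : t ^+ Q * (c * v (2 ^ l) * w' * N') = (c * w' * N') * (t ^+ Q * v (2 ^ l)))%R; last by ring.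
  rewrite (_ : sphere_const * (c * 2 ^+ Q) * v (2 ^ k) * (w' * N') =
    sphere_const * ((c * w' * N') * (2 ^+ Q * v (2 ^ k))))%R; last by ring.
  by rewrite ler_wpM2l// ler_wpM2l// !mulr_ge0 ?powR_ge0.
apply: ge0_ler_powR; rewrite ?nnegrE ?(ltW m0)//.
  rewrite mulr_ge0// mulr_ge0 ?addr_ge0 ?herz_term_ge0// mulr_ge0 ?powR_ge0//.
  by rewrite mulr_ge0 ?powR_ge0// shell_const_ge0.
rewrite /X /shell_const.
set c := (_ `^ m^-1)%R; set vv := (v _ `^ _)%R.
rewrite (_ : (theta t * (c * Kr * vv * W (2 ^ k) `^ (- beta) *
    (herz_term f i + herz_term f l)) =
  c * vv * (Kr * theta t * W (2 ^ k) `^ (- beta) * herz_term f i +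
            Kr * theta t * W (2 ^ k) `^ (- beta) * herz_term f l))%R); last by ring.
rewrite ler_wpM2l ?mulr_ge0 ?powR_ge0// mulrDr lerD//.
- apply: weight_shift => //; first by rewrite lerDl.
  rewrite invr_expz -expfzDr// (_ : k + - i = dlog t)%R; last by rewrite /i; ring.
  apply/andP; split.
    by rewrite ler_pdivrMr//; apply: (le_trans j2); rewrite ler_peMr ?ler1n// ltW.
  apply: ltW; rewrite -(ltr_pM2l (_ : 0 < 2^-1)%R)// mulrA mulVf// mul1r.
  by move: j1; rewrite expfzDr// mulrC exprN1.
- apply: weight_shift => //.
  rewrite invr_expz -expfzDr// (_ : k + - l = dlog t - 1)%R; last by rewrite /l /i; ring.
  apply/andP; split.
    rewrite ler_pdivrMr// -[X in (_ <= _ * X)%R]expr1z -expfzDr//.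
    by rewrite subrK.
  by apply: (le_trans (ltW j1)); rewrite ler_peMl ?ler1n// ltW.
Qed.

End one_function.
End shell_estimate.

(** * Summation over the dyadic scales *)

Section dyadic_convolution.
Context (R : realType).
Local Open Scope ereal_scope.
Local Notation leb := (@lebesgue_measure R).

(** Young's inequality for a convolution over the dyadic scales: Jensen's
    inequality for the measure phi dt, then summation under the integral sign,
    where each translate of b has the same sum. *)
Lemma convolution_sum (p : R) (phi : R -> R) (b : int -> R) :
  (1 <= p)%R -> measurable_fun setT phi -> (forall t, 0 <= phi t)%R ->
  (forall i, 0 <= b i)%R ->
  \esum_(k in [set: int]) (\int[leb]_(t in `]0%R, +oo[)
     ((phi t)%:E * (b (k - dlog t) + b (k - dlog t + 1))%:E)) `^ p <=
  (\int[leb]_(t in `]0%R, +oo[) (phi t)%:E) `^ (p - 1) *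
  ((\int[leb]_(t in `]0%R, +oo[) (phi t)%:E) *
   ((2 `^ p * 2)%:E * \esum_(i in [set: int]) (b i `^ p)%:E)).
Proof.
move=> p1 mphi phi0 b0; have p0 : (0 < p)%R by exact: lt_le_trans p1.
set M := \int[leb]_(t in _) (phi t)%:E.
set sum := \esum_(i in [set: int]) (b i `^ p)%:E.
have sum0 : 0 <= sum by apply: esum_ge0 => i _; rewrite lee_fin powR_ge0.
pose g (k : int) (t : R) := (b (k - dlog t) + b (k - dlog t + 1))%R.
have g0 k t : (0 <= g k t)%R by rewrite addr_ge0.
have mlog : measurable_fun setT (fun t : R => ln t / ln 2)%R.
  by apply: measurable_funM => //; exact: measurable_ln.
have mg k : measurable_fun setT (g k).
  exact: (measurable_comp_int (fun j : int => b (k - j) + b (k - j + 1))%R mlog).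
have mgE k : measurable_fun setT (fun t => (g k t)%:E : \bar R).
  exact/measurable_EFinP.
have mgp k : measurable_fun setT (fun t => (g k t `^ p)%:E : \bar R).
  by apply/measurable_EFinP; exact: (measurableT_comp (measurable_powR _)).
have shift (c : int) : \esum_(k in [set: int]) (b (k + c) `^ p)%:E = sum.
  rewrite /sum [RHS](reindex_esum [set: int] [set: int] (fun k : int => k + c)%R)//.
  split=> //.
  - by move=> x y _ _ /addIr.
  - by move=> y _; exists (y - c)%R => //; rewrite subrK.
have fin_sum (X : set int) (c : int) : finite_set X ->
    \sum_(k \in X) (b (k + c) `^ p)%:E <= sum.
  move=> finX; rewrite -(shift c); apply: ereal_sup_ubound.
  by exists X => //; split.
apply: ge_ereal_sup => _ [X [finX _] <-].
have pw (x y : R) : (0 <= x)%R -> (0 <= y)%R ->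
    ((x + y) `^ p <= 2 `^ p * (x `^ p + y `^ p))%R.
  move=> x0 y0; wlog xy : x y x0 y0 / (x <= y)%R.
    move=> h; have [xy|/ltW yx] := leP x y; first exact: h.
    by rewrite addrC [X in (_ <= _ * X)%R]addrC; apply: h.
  apply: (@le_trans _ _ ((2 * y) `^ p)%R).
    apply: ge0_ler_powR; rewrite ?nnegrE ?addr_ge0 ?mulr_ge0 ?(ltW p0)//; lra.
  by rewrite powRM// ler_wpM2l ?powR_ge0// lerDr powR_ge0.
apply: (@le_trans _ _ (\sum_(k \in X) (M `^ (p - 1) *
    \int[leb]_(t in `]0%R, +oo[) ((phi t)%:E * (g k t `^ p)%:E)))).
  apply: lee_fsum => // k _.
  have := @jensen_poweR R _ _ leb `]0%R, +oo[%classic (measurable_itv _) p phi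
    (fun t => (g k t)%:E) p1 (measurable_funTS mphi).
  apply.
  - exact: (measurable_funTS (mgE k)).
  - by move=> t _; exact: phi0.
  - by move=> t _; rewrite lee_fin.
rewrite -ge0_mule_fsumr; last first.
  move=> k; apply: integral_ge0 => t _; rewrite mule_ge0 ?lee_fin ?powR_ge0//.
apply: lee_wpmul2l; first exact: poweR_ge0.
rewrite -ge0_integral_fsum//; last 2 first.
- move=> k; apply: measurable_funTS; apply: (emeasurable_funM _ (mgp k)).
  by apply/measurable_EFinP.
- by move=> k t _; rewrite mule_ge0 ?lee_fin ?powR_ge0.
rewrite /M -ge0_integralZr//; last 3 first.
- exact/measurable_EFinP/measurable_funTS.
- by move=> t _; rewrite lee_fin.
- by rewrite mule_ge0// lee_fin mulr_ge0// powR_ge0.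
apply: le_integral_pointwise => t _.
  by apply: fsume_ge0 => k _; rewrite mule_ge0 ?lee_fin ?powR_ge0.
rewrite -ge0_mule_fsumr; last by move=> k; rewrite lee_fin powR_ge0.
apply: lee_wpmul2l; first by rewrite lee_fin.
apply: (@le_trans _ _ (\sum_(k \in X) ((2 `^ p)%:E *
    ((b (k + - dlog t) `^ p)%:E + (b (k + (- dlog t + 1)) `^ p)%:E)))).
  apply: lee_fsum => // k _; rewrite -EFinD -EFinM lee_fin /g addrA.
  exact: pw.
rewrite -ge0_mule_fsumr; last by move=> k; rewrite adde_ge0 ?lee_fin ?powR_ge0.
rewrite EFinM -muleA; apply: lee_wpmul2l; first by rewrite lee_fin powR_ge0.
rewrite fsbig_split//= mule_natl mule2n; apply: leeD; exact: fin_sum.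
Qed.

End dyadic_convolution.

Section hausdorff_shells.
Context (R : realType) (n : nat).
Local Open Scope ereal_scope.
Local Notation H := (heis R n).
Local Notation L := (@heis_lebesgue R n).
Local Notation leb := (@lebesgue_measure R).
Local Notation Q := (hdim n).
Local Notation B rho := (@cball R n rho).
Local Notation v rho := (@vol R n rho).
Local Notation S := (@hsphere R n).
Variable sigma : {finite_measure set H -> \bar R}.
Hypothesis hsigma : polar_measure sigma.
Variables (u : H -> R).
Hypotheses (mu : measurable_fun setT u) (u0 : forall x, (0 <= u x)%R).
Local Notation W := (wball u).
Hypotheses (WE : forall rho, (0 < rho)%R -> eW u rho = (W rho)%:E)
  (Wpos : forall rho, (0 < rho)%R -> (0 < W rho)%R)
  (Wmono : forall r s, (0 < r)%R -> (r <= s)%R -> (W r <= W s)%R).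
Variables (q qs zeta m beta C Kr K1 : R) (theta : R -> R).
Hypotheses (zeta1 : (1 <= zeta)%R) (q0 : (0 < q)%R) (qs0 : (0 < qs)%R)
  (mE : m = (qs / zeta)%R)
  (m1 : (1 < m)%R) (C0 : (0 <= C)%R) (hmean : muckenhoupt_mean u zeta C)
  (Kr0 : (0 <= Kr)%R) (theta0 : forall t, (0 <= theta t)%R)
  (theta_gt0 : forall t, (0 < t)%R -> (0 < theta t)%R)
  (mtheta : measurable_fun setT theta)
  (hratio : forall t r s, (0 < t)%R -> (0 < r)%R -> (0 < s)%R ->
     (t / 2 <= s / r <= 2 * t)%R -> ((W s / W r) `^ beta <= Kr * theta t)%R).
Hypotheses (K10 : (0 <= K1)%R)
  (hK1 : forall (rho : R) (D : set H) (h : H -> \bar R),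
    (0 < rho)%R -> measurable D -> D `<=` B rho -> measurable_fun setT h ->
    (forall x, 0 <= h x) ->
    (\int[L]_(x in D) (h x `^ q * (u x)%:E)) `^ q^-1 <=
    (K1 * v rho `^ (- m^-1) * W rho `^ q^-1)%:E *
    (\int[L]_(x in D) (h x `^ m)) `^ m^-1).
Variable O : H -> R.
Hypotheses (mO : measurable_fun setT O) (O0 : forall y, (0 <= O y)%R)
  (OLp : \int[sigma]_(y in S) (O y `^ (m / (m - 1)))%:E < +oo).
Variable phi : R -> R.
Hypotheses (mphi : measurable_fun setT phi) (phi0 : forall t, (0 <= phi t)%R).

Definition kernel_density (t : R) : R := (phi t * theta t * `|t|^-1)%R.

Hypothesis phi_lty : \int[leb]_(t in `]0%R, +oo[) (kernel_density t)%:E < +oo.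

Variable f : H -> R.
Hypotheses (mf : measurable_fun setT f) (f0 : forall y, (0 <= f y)%R)
  (fLq : forall i, \int[L]_(x in @dyadic_shell R n i) (f x `^ qs * u x)%:E < +oo).

(** The operator with nonnegative Borel data: all estimates are made for it, and
    it dominates the modulus of the Hausdorff operator up to a factor 2. *)
Definition abs_hausdorff (x : H) : \bar R :=
  \int[L]_y (phi (hnorm x / hnorm y) / hnorm y ^+ Q *
             O (hdil (hnorm y)^-1 y) * f y)%:E.

Let mquot : measurable_fun setT (fun z : H * H => hnorm z.1 / hnorm z.2)%R.
Proof.
apply: measurable_funM.
  exact: (measurableT_comp (@measurable_hnorm R n) measurable_fst).
apply: (measurableT_comp (@measurable_invr R)).
exact: (measurableT_comp (@measurable_hnorm R n) measurable_snd).
Qed.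

Lemma abs_hausdorff_ge0 x : 0 <= abs_hausdorff x.
Proof.
apply: integral_ge0 => y _.
by rewrite lee_fin !mulr_ge0// invr_ge0 exprn_ge0// hnorm_ge0.
Qed.

Lemma measurable_abs_hausdorff : measurable_fun setT abs_hausdorff.
Proof.
pose K (z : H * H) := (phi (hnorm z.1 / hnorm z.2) / hnorm z.2 ^+ Q *
   O (hdil (hnorm z.2)^-1 z.2) * f z.2)%:E.
apply: (@measurable_fun_integral2 _ _ H H R L setT K) => //.
- apply/measurable_EFinP; apply: measurable_funM.
    apply: measurable_funM.
      apply: measurable_funM; first exact: (measurableT_comp mphi).
      apply: (measurableT_comp (@measurable_invr R)); apply: measurable_funX.
      exact: (measurableT_comp (@measurable_hnorm R n) measurable_snd).
    apply: (measurableT_comp mO).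
    exact: (measurableT_comp (@measurable_direction R n) measurable_snd).
  exact: (measurableT_comp mf measurable_snd).
- by move=> z; rewrite lee_fin !mulr_ge0// invr_ge0 exprn_ge0// hnorm_ge0.
Qed.

Let G (s : R) : \bar R := \int[sigma]_(y in S) (O y * f (hdil s y))%:E.

Let mG : measurable_fun setT G.
Proof.
apply: (@measurable_fun_integral2 _ _ (measurableTypeR R) H R sigma S
  (fun z => (O z.2 * f (hdil z.1 z.2))%:E)) => //.
- exact: measurable_hsphere.
- apply/measurable_EFinP; apply: measurable_funM.
    exact: (measurableT_comp mO measurable_snd).
  exact: (measurableT_comp mf (@measurable_hdil2 R n)).
- by move=> z; rewrite lee_fin mulr_ge0.
Qed.

Let G0 s : 0 <= G s.
Proof. by apply: integral_ge0 => y _; rewrite lee_fin mulr_ge0. Qed.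

Let mdensity : measurable_fun setT kernel_density.
Proof.
apply: measurable_funM; first exact: measurable_funM.
by apply: (measurableT_comp (@measurable_invr R)).
Qed.

Let density0 t : (0 <= kernel_density t)%R.
Proof. by rewrite !mulr_ge0// invr_ge0. Qed.

Local Notation b := (herz_term u qs beta f).
Local Notation Ks := (shell_const sigma zeta m C Kr O).

Let m0 : (0 < m)%R. Proof. exact: lt_trans m1. Qed.

(** The norm of the operator on one shell, as a dyadic convolution: Minkowski's
    inequality in t, with the estimate of each t on that shell. *)
Lemma hausdorff_shell_bound (k : int) :
  (W (2 ^ k) `^ (beta - q^-1))%:E *
  (\int[L]_(x in @dyadic_shell R n k) (abs_hausdorff x `^ q * (u x)%:E)) `^ q^-1 <=
  (K1 * Ks)%:E * \int[leb]_(t in `]0%R, +oo[)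
    ((kernel_density t)%:E * (b (k - dlog t) + b (k - dlog t + 1))%:E).
Proof.
have pk : (0 < 2 ^ k :> R)%R by exact: exprz_gt0.
have Wk := Wpos pk; have vk := vol_gt0 hsigma pk.
have mk := @measurable_dyadic_shell R n k.
pose bb (t : R) := (b (k - dlog t) + b (k - dlog t + 1))%R.
have bb0 t : (0 <= bb t)%R by rewrite addr_ge0// herz_term_ge0.
have mlog : measurable_fun setT (fun t : R => ln t / ln 2)%R.
  by apply: measurable_funM => //; exact: measurable_ln.
have mbb : measurable_fun setT bb.
  exact: (measurable_comp_int (fun j : int => b (k - j) + b (k - j + 1))%R mlog).
pose c := (Ks * v (2 ^ k) `^ m^-1 * W (2 ^ k) `^ (- beta))%R.
have Ks0 : (0 <= Ks)%R by apply: shell_const_ge0.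
have c0 : (0 <= c)%R by rewrite !mulr_ge0 ?powR_ge0.
pose Hh (z : H * R) := G (hnorm z.1 / z.2)%R * ((theta z.2)^-1)%:E.
have mHh : measurable_fun setT (Hh : H * measurableTypeR R -> \bar R).
  apply: emeasurable_funM.
    apply: (measurableT_comp mG); apply: measurable_funM.
      exact: (measurableT_comp (@measurable_hnorm R n) measurable_fst).
    exact: (measurableT_comp (@measurable_invr R) measurable_snd).
  apply/measurable_EFinP; apply: (measurableT_comp (@measurable_invr R)).
  exact: (measurableT_comp mtheta measurable_snd).
have Hh0 z : 0 <= Hh z by rewrite mule_ge0// lee_fin invr_ge0.
have section_le t : `]0%R, +oo[%classic t ->
    \int[L]_(x in @dyadic_shell R n k) (Hh (x, t) `^ m) <= ((c * bb t) `^ m)%:E.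
  rewrite /= in_itv/= andbT => t0; have th0 := theta_gt0 t0.
  have := shell_estimate hsigma mu u0 WE Wpos Wmono zeta1 qs0 mE m1 C0 hmean
    Kr0 theta0 hratio mO O0 OLp mf f0 fLq k t0.
  rewrite -/(bb t) -/c => h.
  rewrite (eq_integral (fun x => ((theta t)^-1 `^ m)%:E * G (hnorm x / t)%R `^ m)); last first.
    by move=> x _; rewrite /Hh poweRM// ?lee_fin ?invr_ge0// poweR_EFin muleC.
  rewrite ge0_integralZl//; last 3 first.
  - apply: measurable_funTS; apply: (measurableT_comp (measurable_poweR _)).
    apply: (measurableT_comp mG); apply: measurable_funM => //.
    exact: measurable_hnorm.
  - by move=> x _; exact: poweR_ge0.
  - by rewrite lee_fin powR_ge0.
  apply: (le_trans (lee_wpmul2l _ h)); first by rewrite lee_fin powR_ge0.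
  have thV0 : (0 <= (theta t)^-1)%R by rewrite invr_ge0.
  rewrite -EFinM lee_fin -(powRM _ thV0 (mulr_ge0 (theta0 t) (mulr_ge0 c0 (bb0 t)))).
  by rewrite mulKf// gt_eqF.
have md : measurable_fun setT (fun t => c * bb t)%R by exact: measurable_funM.
have := @minkowski_integral R _ _ H (measurableTypeR R) L leb
  (@dyadic_shell R n k) `]0%R, +oo[%classic mk (measurable_itv _) m kernel_density
  (fun t => c * bb t)%R Hh (ltW m1) mdensity md mHh density0
  (fun t => mulr_ge0 c0 (bb0 t)) Hh0 phi_lty section_le.
set A := \int[leb]_(t in _) (kernel_density t * (c * bb t))%:E => hA.
have AE : A = c%:E * \int[leb]_(t in `]0%R, +oo[) ((kernel_density t)%:E * (bb t)%:E).
  rewrite -ge0_integralZl//; last 2 first.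
  - by apply: measurable_funTS; apply: emeasurable_funM; exact/measurable_EFinP.
  - by move=> t _; exact: (mulr_ge0 (density0 t) (bb0 t)).
  by apply: eq_integral => t _; rewrite -!EFinM mulrCA.
have A0 : 0 <= A.
  by apply: integral_ge0 => t _; exact: (mulr_ge0 (density0 t) (mulr_ge0 c0 (bb0 t))).
have Fm : (\int[L]_(x in @dyadic_shell R n k) (abs_hausdorff x `^ m)) `^ m^-1 <= A.
  rewrite -[A]poweRe1// -(mulfV (negbT (gt_eqF m0))) poweRrM.
  apply: le_poweR; [by rewrite invr_ge0 ltW|by apply: integral_ge0 => x _; exact: poweR_ge0|].
  apply: le_trans hA; apply: le_integral_pointwise => x; first by move=> _; exact: poweR_ge0.
  rewrite dyadic_shellE/= => /andP[xk _].
  have x0 : (0 < hnorm x)%R by apply: lt_trans xk; exact: exprz_gt0.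
  rewrite /abs_hausdorff (hausdorff_polar hsigma x0 mphi phi0 mO O0 mf f0).
  rewrite le_eqVlt; apply/orP; left; apply/eqP; congr (_ `^ _).
  apply: eq_integral => t; rewrite inE/= in_itv/= andbT => t0.
  rewrite /Hh /kernel_density gtr0_norm// [RHS]muleA [RHS]muleAC -EFinM -/(G _).
  congr (_%:E * _).
  by have := theta_gt0 t0 => th; field; rewrite !gt_eqF.
apply: (@le_trans _ _ ((W (2 ^ k) `^ (beta - q^-1))%:E *
    ((K1 * v (2 ^ k) `^ (- m^-1) * W (2 ^ k) `^ q^-1)%:E * A))).
  apply: lee_wpmul2l; first by rewrite lee_fin powR_ge0.
  apply: (le_trans (hK1 pk mk (@dyadic_shell_sub R n k) measurable_abs_hausdorff abs_hausdorff_ge0)).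
  by apply: lee_wpmul2l => //; rewrite lee_fin !mulr_ge0// powR_ge0.
rewrite AE 2!muleA -!EFinM le_eqVlt; apply/orP; left; apply/eqP; congr (_%:E * _).
rewrite /c.
have e1 : (W (2 ^ k) `^ (beta - q^-1) * W (2 ^ k) `^ q^-1 * W (2 ^ k) `^ (- beta) = 1)%R.
  rewrite -!powRD ?(gt_eqF Wk) ?implybT// -[RHS](powRr0 (W (2 ^ k))).
  by congr (_ `^ _)%R; ring.
have e2 : (v (2 ^ k) `^ (- m^-1) * v (2 ^ k) `^ m^-1 = 1)%R.
  by rewrite -powRD ?(gt_eqF vk) ?implybT// addNr powRr0.
set w1 := (W _ `^ (beta - _))%R in e1 *; set w2 := (W _ `^ q^-1)%R in e1 *.
set w3 := (W _ `^ (- beta))%R in e1 *; set v1 := (v _ `^ (- _))%R in e2 *.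
set v2 := (v _ `^ m^-1)%R in e2 *.
transitivity (K1 * Ks * (w1 * w2 * w3) * (v1 * v2))%R; first by ring.
by rewrite e1 e2 !mulr1.
Qed.

End hausdorff_shells.

(** * Complex values *)

Section complex_valued.
Context (R : realType).
Local Notation normc := ComplexField.Normc.normc.

Lemma normcE (z : R[i]) :
  normc z = Num.sqrt (complex.Re z ^+ 2 + complex.Im z ^+ 2).
Proof. by case: z. Qed.

Lemma normc_ge0 (z : R[i]) : 0 <= normc z.
Proof. by rewrite normcE sqrtr_ge0. Qed.

Lemma normc_le (z : R[i]) : normc z <= `|complex.Re z| + `|complex.Im z|.
Proof.
rewrite normcE -[leRHS]ger0_norm ?addr_ge0// -sqrtr_sqr ler_wsqrtr//.
rewrite sqrrD !real_normK ?num_real// -addrA lerD2l lerDr.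
by rewrite mulrn_wge0// mulr_ge0.
Qed.

Lemma normc_Re (z : R[i]) : `|complex.Re z| <= normc z.
Proof. by rewrite normcE -sqrtr_sqr ler_wsqrtr// lerDl sqr_ge0. Qed.

Lemma normc_Im (z : R[i]) : `|complex.Im z| <= normc z.
Proof. by rewrite normcE -sqrtr_sqr ler_wsqrtr// lerDr sqr_ge0. Qed.

Definition modulus {T : Type} (a b : T -> R) (x : T) : R :=
  Num.sqrt (a x ^+ 2 + b x ^+ 2).

Lemma modulus_ge0 {T : Type} (a b : T -> R) x : 0 <= modulus a b x.
Proof. exact: sqrtr_ge0. Qed.

Lemma measurable_modulus d (T : measurableType d) (a b : T -> R) :
  measurable_fun setT a -> measurable_fun setT b ->
  measurable_fun setT (modulus a b).
Proof.
move=> ma mb; rewrite (_ : modulus a b = fun x => (a x ^+ 2 + b x ^+ 2) `^ 2^-1).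
  apply: (measurableT_comp (measurable_powR _)).
  by apply: measurable_funD; exact: measurable_funX.
by apply/funext => x; rewrite powR12_sqrt// addr_ge0// sqr_ge0.
Qed.

End complex_valued.

Lemma abse_fine_le (R : realType) (x : \bar R) : (`|fine x|%:E <= `|x|)%E.
Proof. by case: x => [r| |]//=; rewrite normr0 leey. Qed.

Lemma esum_mule_le (R : realType) (T : choiceType) (c : R) (a b : T -> \bar R) :
  0 <= c -> (forall i, 0 <= a i)%E -> (forall i, b i <= c%:E * a i)%E ->
  (\esum_(i in [set: T]) b i <= c%:E * \esum_(i in [set: T]) a i)%E.
Proof.
move=> c0 a0 ba; apply: ge_ereal_sup => _ [X [finX _] <-].
apply: (@le_trans _ _ (\sum_(i \in X) (c%:E * a i))%E).
  by apply: lee_fsum => // i _; exact: ba.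
rewrite -ge0_mule_fsumr//; apply: lee_wpmul2l; first by rewrite lee_fin.
by apply: ereal_sup_ubound; exists X.
Qed.

Lemma le_esum_term (R : realType) (T : choiceType) (a : T -> \bar R) (k : T) :
  (a k <= \esum_(i in [set: T]) a i)%E.
Proof.
apply: ereal_sup_ubound; exists [set k]; last by rewrite fsbig_set1.
by split.
Qed.

(** * Compact annuli *)

Section annuli.
Context (R : realType) (n : nat).
Local Open Scope ereal_scope.
Local Notation H := (heis R n).
Local Notation L := (@heis_lebesgue R n).

Definition annulus (M : nat) : set H :=
  [set x | (2 ^ (- M%:Z) < hnorm x <= 2 ^ M%:Z)%R].

Lemma measurable_annulus M : measurable (annulus M).
Proof.
rewrite (_ : annulus M = [set x : H | hnorm x \in `](2 ^ (- M%:Z))%R, (2 ^ M%:Z)%R]]).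
  exact: measurable_hnorm_itv.
by apply/seteqP; split=> x /=; rewrite in_itv.
Qed.

Lemma annulusS M : annulus M.+1 =
  annulus M `|` (@dyadic_shell R n M.+1%:Z `|` @dyadic_shell R n (- M%:Z)).
Proof.
have n2 : (1 <= 2 :> R)%R by rewrite ler1n.
have le2 (i j : int) : (i <= j)%R -> (2 ^ i <= 2 ^ j :> R)%R.
  by move=> ij; rewrite ler_weXz2l.
have e1 : (M.+1%:Z - 1 = M%:Z)%R by rewrite intS addrC addKr.
have e2 : (- M%:Z - 1 = - M.+1%:Z)%R by rewrite intS opprD addrC.
rewrite !dyadic_shellE e1 e2 /annulus; apply/seteqP; split=> x /=.
  move=> /andP[h1 h2].
  have [h3|h3] := leP (hnorm x) (2 ^ (- M%:Z))%R.
    by right; right; rewrite h1.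
  have [h4|h4] := leP (hnorm x) (2 ^ M%:Z)%R; first by left.
  by right; left; rewrite h2.
have lM : (2 ^ (- M.+1%:Z) <= 2 ^ (- M%:Z) :> R)%R by apply: le2; lia.
have lM' : (2 ^ M%:Z <= 2 ^ M.+1%:Z :> R)%R by apply: le2; lia.
have lM2 : (2 ^ (- M%:Z) <= 2 ^ M%:Z :> R)%R by apply: le2; lia.
move=> [/andP[h1 h2]|[/andP[h1 h2]|/andP[h1 h2]]]; apply/andP; split.
- exact: le_lt_trans h1.
- exact: le_trans lM'.
- by apply: (le_lt_trans lM); exact: le_lt_trans h1.
- by [].
- by [].
- by apply: (le_trans h2); exact: le_trans lM'.
Qed.

Lemma integral_annulus_lty (h : H -> \bar R) : measurable_fun setT h ->
  (forall x, 0 <= h x) ->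
  (forall k, \int[L]_(x in @dyadic_shell R n k) h x < +oo) ->
  forall M, \int[L]_(x in annulus M) h x < +oo.
Proof.
move=> mh h0 hk; elim=> [|M IHM].
  rewrite (_ : annulus 0 = set0) ?integral_set0//.
  apply/seteqP; split=> x //=; rewrite /annulus/= oppr0 => /andP[h1 h2].
  by move: (lt_le_trans h1 h2); rewrite ltxx.
have sub2 (A B : set H) : measurable A -> measurable B ->
    \int[L]_(x in A `|` B) h x <= \int[L]_(x in A) h x + \int[L]_(x in B) h x.
  move=> mA mB; have -> : A `|` B = A `|` (B `\` A).
    apply/seteqP; split=> x /= [Ax|]; [by left| |by left|by move=> []; right].
    by move=> Bx; have [Ax|nAx] := pselect (A x); [left|right].
  rewrite ge0_integral_setU//.
  - apply: leeD => //; apply: ge0_subset_integral => //.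
    + exact: measurableD.
    + exact: measurable_funTS.
  - exact: measurableD.
  - exact: measurable_funTS.
  - by apply/disj_setPS => x [Ax [_ nAx]].
rewrite annulusS.
have ma := measurable_annulus M; have m1 := @measurable_dyadic_shell R n M.+1%:Z.
have m2 := @measurable_dyadic_shell R n (- M%:Z).
apply: (le_lt_trans (sub2 _ _ ma (measurableU _ _ m1 m2))).
rewrite lte_add_pinfty//; apply: (le_lt_trans (sub2 _ _ m1 m2)).
by rewrite lte_add_pinfty.
Qed.

(** A compact set that misses the origin lies in an annulus: its image under
    the fourth power of the norm is a compact set of positive reals. *)
Lemma hcompact_annulus (K : set H) : hcompact K -> ~ K (@hzero R n) ->
  exists M, K `<=` annulus M.
Proof.
move=> cK K0.
pose g (z : 'rV[R]_(n + n) * R) : R :=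
  ((\sum_(i < n + n) z.1 ord0 i ^+ 2) ^+ 2 + z.2 ^+ 2)%R.
have gE x : (g (heis_top x) = hnorm x ^+ 4)%R.
  rewrite -powR_mulrn ?hnorm_ge0// /hnorm -powRrM mulVf// powRr1; last first.
    by rewrite addr_ge0// sqr_ge0.
  rewrite /g /heis_top/=; congr (_ ^+ 2 + _)%R.
  by apply: eq_bigr => i _; rewrite mxE.
have cg : continuous g.
  have c1 i : continuous (fun z : 'rV[R]_(n + n) * R => z.1 ord0 i).
    move=> z; apply: (@continuous_comp _ _ _ fst (fun M : 'rV[R]_(n + n) => M ord0 i)).
      exact: cvg_fst.
    exact: coord_continuous.
  have cX (f : 'rV[R]_(n + n) * R -> R) : continuous f -> continuous (fun z => f z ^+ 2)%R.
    by move=> cf z; exact: (cvgM (cf z) (cf z)).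
  move=> z; apply: cvgD; last by apply: cX => ?; exact: cvg_snd.
  apply: (cX (fun z => \sum_(i < n + n) z.1 ord0 i ^+ 2)%R) => z'.
  by apply: cvg_big => [|i _]; [exact: add_continuous|exact: (cX _ (c1 i))].
have cgK : compact (g @` (@heis_top R n @` K)).
  by apply: continuous_compact => //; exact: continuous_subspaceT.
have gK x : K x -> (g @` (@heis_top R n @` K)) (hnorm x ^+ 4)%R.
  by move=> Kx; exists (heis_top x); [exists x|exact: gE].
have [b [_ bK]] := compact_bounded cgK.
have {}bK x : K x -> (hnorm x ^+ 4 <= `|b| + 1)%R.
  move=> Kx; have hb : (b < `|b| + 1)%R by rewrite ltr_pwDr// ler_norm.
  by have /= := bK _ hb _ (gK _ Kx); rewrite ger0_norm ?exprn_ge0 ?hnorm_ge0.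
have [e e0 eK] : exists2 e : R, (0 < e)%R & forall x, K x -> (e <= hnorm x ^+ 4)%R.
  have nz : ~ (g @` (@heis_top R n @` K)) 0%R.
    move=> [_ [x Kx <-]]; rewrite gE => /eqP; rewrite expf_eq0/= => /eqP x0.
    by apply: K0; rewrite -(hnorm_eq0 x0).
  have oC : open (~` (g @` (@heis_top R n @` K))).
    by apply: closed_openC; apply: compact_closed => //; exact: Rhausdorff.
  have /nbhs_ballP[e /= e0 eb] := open_nbhs_nbhs (conj oC nz).
  exists e => // x Kx; rewrite leNgt; apply/negP => xe.
  apply: (eb (hnorm x ^+ 4)%R); last exact: gK.
  by rewrite /ball/= sub0r normrN ger0_norm// exprn_ge0// hnorm_ge0.
pose M := maxn (Num.bound (`|b| + 1)%R) (Num.bound (e^-1)%R).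
have pow2 (k : nat) : (k%:R < 2 ^+ k :> R)%R.
  by rewrite -natrX ltr_nat ltn_expl.
exists M => x Kx; rewrite /annulus/=.
have M1 : (`|b| + 1 < 2 ^+ M)%R.
  apply: (@lt_trans _ _ M%:R); last exact: pow2.
  apply: (@lt_le_trans _ _ (Num.bound (`|b| + 1)%R)%:R).
    by apply: archi_boundP; rewrite addr_ge0.
  by rewrite ler_nat leq_maxl.
have M2 : (e^-1 < 2 ^+ M)%R.
  apply: (@lt_trans _ _ M%:R); last exact: pow2.
  apply: (@lt_le_trans _ _ (Num.bound (e^-1)%R)%:R).
    by apply: archi_boundP; rewrite invr_ge0 ltW.
  by rewrite ler_nat leq_maxr.
have two1 : (1 <= 2 ^+ M :> R)%R by rewrite exprn_ege1// ler1n.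
have x0 := hnorm_ge0 x.
(* The fourth powers compare with the powers of 2, hence so do the norms. *)
rewrite -exprnN -exprnP; apply/andP; split.
  rewrite -(ltr_pXn2r (n := 4))// ?nnegrE ?invr_ge0 ?exprn_ge0//.
  apply: lt_le_trans (eK _ Kx); rewrite exprVn -[e]invrK ltf_pV2 ?posrE ?invr_gt0 ?exprn_gt0//.
  by apply: (lt_le_trans M2); rewrite -[leLHS]expr1 ler_weXn2l.
rewrite -(ler_pXn2r (n := 4))// ?nnegrE ?exprn_ge0//.
apply: (le_trans (bK _ Kx)); apply: (le_trans (ltW M1)).
by rewrite -[leLHS]expr1 ler_weXn2l.
Qed.

(** A point is a compact set. *)
Lemma annulus_cover (x : H) : (0 < hnorm x)%R -> exists M, annulus M x.
Proof.
move=> x0; have [||M hM] := hcompact_annulus (K := [set x]).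
- by rewrite /hcompact image_set1; exact: compact_set1.
- move=> /= xz; move: x0; rewrite -xz.
  rewrite /hnorm big1 => [|i _]; last by rewrite /hcoord tnth_mktuple expr0n.
  by rewrite !expr0n/= addr0 powR0 ?ltxx.
- by exists M; exact: hM.
Qed.

End annuli.

(** * Borel versions *)

Section herz_norms.
Context (R : realType) (n : nat).
Local Open Scope ereal_scope.
Local Notation H := (heis R n).
Local Notation L := (@heis_lebesgue R n).
Local Notation Q := (hdim n).
Local Notation normc := ComplexField.Normc.normc.
Variables (w u : H -> R).
Hypotheses (w0 : forall x, (0 <= w x)%R) (mu : measurable_fun setT u)
  (u0 : forall x, (0 <= u x)%R) (wu : {ae L, forall x, w x = u x}).
Local Notation W := (wball u).
Hypotheses (WE : forall rho, (0 < rho)%R -> eW u rho = (W rho)%:E)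
  (Wpos : forall rho, (0 < rho)%R -> (0 < W rho)%R).

Lemma wmeasure_ball (k : int) : wmeasure w (@dyadic_ball R n k) = (W (2 ^ k))%:E.
Proof.
rewrite -WE; last exact: exprz_gt0.
apply: ge0_ae_eq_integral_measurable_r.
- exact: (@measurable_cball R n (2 ^ k)%R).
- exact/measurable_funTS/measurable_EFinP.
- by move=> x _; rewrite lee_fin.
- by move=> x _; rewrite lee_fin.
- by apply: filterS wu => x ->.
Qed.

Let shell_patchE (q : R) (f : H -> R[i]) (k : int) x : (0 < q)%R ->
  (normc (patch (fun=> 0%R) (@dyadic_shell R n k) f x) `^ q * w x)%:E =
  ((fun x => (normc (f x) `^ q * w x)%:E) \_ (@dyadic_shell R n k)) x.
Proof.
move=> q0; rewrite /patch; case: ifP => // _.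
rewrite (_ : normc _ = 0%R) ?powR0 ?mul0r ?gt_eqF//.
exact: ComplexField.Normc.normc0.
Qed.

Lemma wLnorm_shell_le (q : R) (g : H -> R[i]) (h : H -> \bar R) (k : int) :
  (0 < q)%R -> measurable_fun setT h -> (forall x, 0 <= h x) ->
  {ae L, forall x, (normc (g x))%:E <= h x} ->
  wLnorm q w (patch (fun=> 0%R) (@dyadic_shell R n k) g) <=
  (\int[L]_(x in @dyadic_shell R n k) (h x `^ q * (u x)%:E)) `^ q^-1.
Proof.
move=> q0 mh h0 gh; rewrite /wLnorm; apply: le_poweR.
- by rewrite invr_ge0 ltW.
- by apply: integral_ge0 => x _; rewrite lee_fin mulr_ge0 ?powR_ge0.
rewrite [leRHS]integral_mkcond; apply: ae_le_integral_measurable_r.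
- apply/(measurable_restrictT _ (@measurable_dyadic_shell R n k))/measurable_funTS.
  apply: emeasurable_funM; last exact/measurable_EFinP.
  exact: (measurableT_comp (measurable_poweR _)).
- by move=> x; rewrite lee_fin mulr_ge0 ?powR_ge0.
- by move=> x; rewrite patchE; case: ifP => // _; rewrite mule_ge0 ?poweR_ge0// lee_fin.
move: gh wu; apply: filterS2 => x gx wx.
rewrite shell_patchE// /patch; case: ifP => // _.
rewrite EFinM wx; apply: lee_wpmul2r; first by rewrite lee_fin.
by rewrite -poweR_EFin; apply: le_poweR => //; [exact: ltW|rewrite lee_fin normc_ge0].
Qed.

Lemma wLnorm_shellE (q : R) (f : H -> R[i]) (a b : H -> R) (k : int) :
  (0 < q)%R -> measurable_fun setT a -> measurable_fun setT b ->
  {ae L, forall x, complex.Re (f x) = a x} ->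
  {ae L, forall x, complex.Im (f x) = b x} ->
  wLnorm q w (patch (fun=> 0%R) (@dyadic_shell R n k) f) =
  (\int[L]_(x in @dyadic_shell R n k) (modulus a b x `^ q * u x)%:E) `^ q^-1.
Proof.
move=> q0 ma mb fa fb; rewrite /wLnorm; congr (_ `^ _).
rewrite [RHS]integral_mkcond; apply: ge0_ae_eq_integral_measurable_r => //.
- apply/(measurable_restrictT _ (@measurable_dyadic_shell R n k))/measurable_funTS.
  apply/measurable_EFinP; apply: measurable_funM => //.
  apply: (measurableT_comp (measurable_powR _)); exact: measurable_modulus.
- by move=> x _; rewrite lee_fin mulr_ge0 ?powR_ge0.
- by move=> x _; rewrite patchE; case: ifP => // _; rewrite lee_fin mulr_ge0 ?powR_ge0.
move: fa fb wu; apply: filterS3 => x fax fbx wx _.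
rewrite shell_patchE// /patch; case: ifP => // _.
by rewrite normcE fax fbx wx.
Qed.

End herz_norms.

Section hausdorff_versions.
Context (R : realType) (n : nat).
Local Open Scope ereal_scope.
Local Notation H := (heis R n).
Local Notation L := (@heis_lebesgue R n).
Local Notation leb := (@lebesgue_measure R).
Local Notation Q := (hdim n).
Local Notation normc := ComplexField.Normc.normc.
Variable sigma : {finite_measure set H -> \bar R}.
Hypothesis hsigma : polar_measure sigma.
Variables (Phi : H -> R) (phi : R -> R).
Hypotheses (PhiE : forall x, Phi x = phi (hnorm x)).
Variables (phi' : R -> R) (N : set R).
Hypotheses (mphi' : measurable_fun setT phi') (phi'0 : forall t, (0 <= phi' t)%R)
  (mN : measurable N) (N0 : leb N = 0)
  (phiE : forall r, (0 < r)%R -> ~ N r -> phi r = phi' r).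
Variables (Omega f : H -> R[i]) (Oa Ob fa fb : H -> R).
Hypotheses (mOa : measurable_fun setT Oa) (mOb : measurable_fun setT Ob)
  (mfa : measurable_fun setT fa) (mfb : measurable_fun setT fb)
  (OaE : {ae sigma, forall y, complex.Re (Omega y) = Oa y})
  (ObE : {ae sigma, forall y, complex.Im (Omega y) = Ob y})
  (faE : {ae L, forall y, complex.Re (f y) = fa y})
  (fbE : {ae L, forall y, complex.Im (f y) = fb y}).

Let c (x y : H) : R := phi' (hnorm x / hnorm y) / hnorm y ^+ Q.
Let dir (y : H) : H := hdil (hnorm y)^-1 y.

Let Phi' (x : H) : R := phi' (hnorm x).
Let Omega' (y : H) : R[i] := (Oa y +i* Ob y)%C.
Let f' (y : H) : R[i] := (fa y +i* fb y)%C.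
Local Notation F := (abs_hausdorff (modulus Oa Ob) phi' (modulus fa fb)).

Let kRe (z : H * H) : R :=
  (c z.1 z.2 * (Oa (dir z.2) * fa z.2 - Ob (dir z.2) * fb z.2))%R.
Let kIm (z : H * H) : R :=
  (c z.1 z.2 * (Oa (dir z.2) * fb z.2 + Ob (dir z.2) * fa z.2))%R.

Let integrandE x y : hausdorff_integrand Phi' Omega' f' x y =
  (kRe (x, y) +i* kIm (x, y))%C.
Proof.
rewrite /hausdorff_integrand /Phi' hnorm_hdil ?invr_ge0 ?hnorm_ge0//.
rewrite (mulrC (hnorm y)^-1%R) -/(c x y) -/(dir y) /Omega' /f' /kRe /kIm/=.
by apply/eqP; rewrite eq_complex/=; apply/andP; split; apply/eqP; ring.
Qed.

Let normc_integrandE x y :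
  (normc (hausdorff_integrand Phi' Omega' f' x y) =
   phi' (hnorm x / hnorm y) / hnorm y ^+ Q * modulus Oa Ob (dir y) *
   modulus fa fb y)%R.
Proof.
rewrite /hausdorff_integrand /Phi' hnorm_hdil ?invr_ge0 ?hnorm_ge0//.
rewrite (mulrC (hnorm y)^-1%R) -/(c x y) -/(dir y).
have c0 : (0 <= c x y)%R by rewrite mulr_ge0// invr_ge0 exprn_ge0// hnorm_ge0.
rewrite !ComplexField.Normc.normcM !normcE/=.
by rewrite expr0n/= addr0 sqrtr_sqr ger0_norm.
Qed.

Let mc : measurable_fun setT (fun z : H * H => c z.1 z.2).
Proof.
have mh1 : measurable_fun setT (fun z : H * H => hnorm z.1).
  exact: (measurableT_comp (@measurable_hnorm R n) measurable_fst).
have mh2 : measurable_fun setT (fun z : H * H => hnorm z.2).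
  exact: (measurableT_comp (@measurable_hnorm R n) measurable_snd).
have mi := @measurable_invr R.
apply: measurable_funM.
  apply: (measurableT_comp mphi'); apply: measurable_funM => //.
  exact: (measurableT_comp mi).
by apply: (measurableT_comp mi); exact: measurable_funX.
Qed.

Let mdir2 (h : H -> R) : measurable_fun setT h ->
  measurable_fun setT (fun z : H * H => h (dir z.2)).
Proof.
move=> mh; apply: (measurableT_comp mh).
exact: (measurableT_comp (@measurable_direction R n) measurable_snd).
Qed.

Let msnd2 (h : H -> R) : measurable_fun setT h ->
  measurable_fun setT (fun z : H * H => h z.2).
Proof. by move=> mh; exact: (measurableT_comp mh measurable_snd). Qed.

Let mkRe : measurable_fun setT kRe.
Proof.
apply: measurable_funM => //; apply: measurable_funB; apply: measurable_funM;
  by [exact: mdir2|exact: msnd2].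
Qed.

Let mkIm : measurable_fun setT kIm.
Proof.
apply: measurable_funM => //; apply: measurable_funD; apply: measurable_funM;
  by [exact: mdir2|exact: msnd2].
Qed.

(** Off the null sets of radii, directions and points where the given functions
    differ from their Borel versions, the integrand is a Borel function. *)
Lemma integrand_ae (x : H) : (0 < hnorm x)%R -> {ae L, forall y,
  hausdorff_integrand Phi Omega f x y = hausdorff_integrand Phi' Omega' f' x y}.
Proof.
move=> x0.
have n2 : L.-negligible [set y | (0 < hnorm y)%R /\ N (hnorm x / hnorm y)%R].
  apply/negligibleP; last exact: (quotient_negligible hsigma).
  rewrite (_ : [set y | _] = [set y : H | hnorm y \in `]0%R, +oo[] `&`
    (fun y : H => hnorm x / hnorm y)%R @^-1` N); last first.
    by apply/seteqP; split=> y /=; rewrite in_itv/= andbT.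
  apply: measurableI; first exact: measurable_hnorm_itv.
  rewrite -[X in measurable X]setTI.
  have mq : measurable_fun setT (fun y : H => hnorm x / hnorm y)%R.
    apply: measurable_funM => //.
    exact: (measurableT_comp (@measurable_invr R) (@measurable_hnorm R n)).
  exact: mq.
have n3 (P : set H) : {ae sigma, forall y, P y} ->
    L.-negligible (~` [set y | P (dir y)]).
  move=> [M [mM M0 sM]]; exists [set y | M (dir y)]; split.
  - rewrite (_ : [set y | _] = dir @^-1` M)// -[X in measurable X]setTI.
    by apply: (@measurable_direction R n).
  - exact: (direction_negligible hsigma).
  - by move=> y /=; exact: sM.
have := negligibleU (negligibleU (ae_hnorm_gt0 hsigma (fun y h => h)) n2) (negligibleU (negligibleU (n3 _ OaE) (n3 _ ObE))
  (negligibleU faE fbE)).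
apply: negligibleS => y /=; apply: contra_notP => /not_orP[/not_orP[h1 h2]].
move=> /not_orP[/not_orP[h3 h4] /not_orP[h5 h6]].
have y0 : (0 < hnorm y)%R by exact: contrapT.
have yx0 : (0 < hnorm x / hnorm y)%R by rewrite divr_gt0.
have nN : ~ N (hnorm x / hnorm y)%R by move=> h; apply: h2.
rewrite /hausdorff_integrand PhiE /Phi' hnorm_hdil ?invr_ge0 ?hnorm_ge0//.
rewrite (mulrC (hnorm y)^-1%R) phiE// -/(c x y) -/(dir y) /Omega' /f'.
have [<- <-] : complex.Re (Omega (dir y)) = Oa (dir y) /\
    complex.Im (Omega (dir y)) = Ob (dir y).
  by split; apply: contrapT.
have [<- <-] : complex.Re (f y) = fa y /\ complex.Im (f y) = fb y.
  by split; apply: contrapT.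
by case: (Omega (dir y)) => ? ?; case: (f y) => ? ?.
Qed.

Lemma integral_normc_integrand (x : H) : (0 < hnorm x)%R ->
  \int[L]_y (normc (hausdorff_integrand Phi Omega f x y))%:E = F x.
Proof.
move=> x0; apply: ge0_ae_eq_integral_measurable_r => //.
- apply/measurable_EFinP; apply: measurable_funM.
    apply: measurable_funM; first exact: (measurableT_comp mc (@pair1_measurable _ _ H H x)).
    apply: (measurableT_comp (measurable_modulus mOa mOb)).
    exact: (@measurable_direction R n).
  exact: measurable_modulus.
- by move=> y _; rewrite lee_fin normc_ge0.
- move=> y _; rewrite lee_fin !mulr_ge0 ?modulus_ge0// invr_ge0 exprn_ge0//.
  exact: hnorm_ge0.
- move: (integrand_ae x0); apply: filterS => y -> _.
  by rewrite normc_integrandE.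
Qed.

Lemma hausdorff_abs_integrable (x : H) : (0 < hnorm x)%R -> F x < +oo ->
  abs_integrable (hausdorff_integrand Phi Omega f x).
Proof.
move=> x0 Fx; split; last by rewrite integral_normc_integrand.
split.
- exists (fun y => kRe (x, y)); first exact: (measurableT_comp mkRe (@pair1_measurable _ _ H H x)).
  by move: (integrand_ae x0); apply: filterS => y ->; rewrite integrandE.
- exists (fun y => kIm (x, y)); first exact: (measurableT_comp mkIm (@pair1_measurable _ _ H H x)).
  by move: (integrand_ae x0); apply: filterS => y ->; rewrite integrandE.
Qed.

Let hausdorff_ReE x : (0 < hnorm x)%R ->
  complex.Re (hausdorff Phi Omega f x) = fine (\int[L]_y (kRe (x, y))%:E).
Proof.
move=> x0; rewrite /hausdorff /cintegral/= /Rintegral; congr fine.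
apply: ae_eq_integral_measurable_r.
  by apply/measurable_EFinP; exact: (measurableT_comp mkRe (@pair1_measurable _ _ H H x)).
by move: (integrand_ae x0); apply: filterS => y ->; rewrite integrandE.
Qed.

Let hausdorff_ImE x : (0 < hnorm x)%R ->
  complex.Im (hausdorff Phi Omega f x) = fine (\int[L]_y (kIm (x, y))%:E).
Proof.
move=> x0; rewrite /hausdorff /cintegral/= /Rintegral; congr fine.
apply: ae_eq_integral_measurable_r.
  by apply/measurable_EFinP; exact: (measurableT_comp mkIm (@pair1_measurable _ _ H H x)).
by move: (integrand_ae x0); apply: filterS => y ->; rewrite integrandE.
Qed.

Let mint (k : H * H -> R) : measurable_fun setT k ->
  measurable_fun setT (fun x => fine (\int[L]_y (k (x, y))%:E)).
Proof.
move=> mk; apply: (measurableT_comp (fine_measurable measurableT)) => //.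
rewrite (_ : (fun x => _) = (fun x => \int[L]_y ((EFin \o k)^\+ (x, y)) -
    \int[L]_y ((EFin \o k)^\- (x, y)))); last first.
  apply/funext => x; rewrite integralE; congr (_ - _); apply: eq_integral => y _;
    by rewrite !unlock.
have mk' : measurable_fun setT (EFin \o k) by exact/measurable_EFinP.
apply: emeasurable_funB.
- apply: (@measurable_fun_integral2 _ _ H H R L setT) => //.
  exact: measurable_funepos.
- apply: (@measurable_fun_integral2 _ _ H H R L setT) => //.
  exact: measurable_funeneg.
Qed.

Lemma hausdorff_ae_measurable : ae_measurableC L (hausdorff Phi Omega f).
Proof.
split.
- by eexists; [exact: (mint mkRe)|exact: (ae_hnorm_gt0 hsigma hausdorff_ReE)].
- by eexists; [exact: (mint mkIm)|exact: (ae_hnorm_gt0 hsigma hausdorff_ImE)].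
Qed.

(** The modulus of a complex number is at most the sum of those of its real and
    imaginary parts, whence the factor 2. *)
Lemma normc_hausdorff_le (x : H) : (0 < hnorm x)%R ->
  (normc (hausdorff Phi Omega f x))%:E <= 2%:E * F x.
Proof.
move=> x0; apply: (le_trans (y := (`|complex.Re (hausdorff Phi Omega f x)| +
    `|complex.Im (hausdorff Phi Omega f x)|)%:E)).
  by rewrite lee_fin normc_le.
rewrite mule_natl mule2n EFinD hausdorff_ReE// hausdorff_ImE//.
apply: leeD; apply: (le_trans (abse_fine_le _)).
- apply: (le_trans (le_abse_integral _ _ _)) => //.
    by apply/measurable_EFinP; exact: (measurableT_comp mkRe (@pair1_measurable _ _ H H x)).
  apply: le_integral_pointwise => y _ //=; rewrite -normc_integrandE lee_fin.
  by rewrite (le_trans _ (normc_Re _))// integrandE.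
- apply: (le_trans (le_abse_integral _ _ _)) => //.
    by apply/measurable_EFinP; exact: (measurableT_comp mkIm (@pair1_measurable _ _ H H x)).
  apply: le_integral_pointwise => y _ //=; rewrite -normc_integrandE lee_fin.
  by rewrite (le_trans _ (normc_Im _))// integrandE.
Qed.

End hausdorff_versions.

(** * Boundedness between Herz spaces *)

Section herz_bound.
Context (R : realType) (n : nat).
Local Open Scope ereal_scope.
Local Notation H := (heis R n).
Local Notation L := (@heis_lebesgue R n).
Local Notation leb := (@lebesgue_measure R).
Local Notation Q := (hdim n).
Local Notation B rho := (@cball R n rho).
Local Notation v rho := (@vol R n rho).
Local Notation S := (@hsphere R n).
Local Notation normc := ComplexField.Normc.normc.
Variable sigma : {finite_measure set H -> \bar R}.
Hypothesis hsigma : polar_measure sigma.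
Variables (w u : H -> R).
Hypotheses (w0 : forall x, (0 <= w x)%R) (mu : measurable_fun setT u)
  (u0 : forall x, (0 <= u x)%R) (wu : {ae L, forall x, w x = u x})
  (upos : {ae L, forall x, u x != 0%R}).
Local Notation W := (wball u).
Hypotheses (WE : forall rho, (0 < rho)%R -> eW u rho = (W rho)%:E)
  (Wpos : forall rho, (0 < rho)%R -> (0 < W rho)%R)
  (Wmono : forall r s, (0 < r)%R -> (r <= s)%R -> (W r <= W s)%R).
Variables (p q qs zeta m beta alpha alphas C Kr K1 : R) (theta : R -> R).
Hypotheses (p1 : (1 <= p)%R) (zeta1 : (1 <= zeta)%R) (q0 : (0 < q)%R)
  (qs0 : (0 < qs)%R) (mE : m = (qs / zeta)%R)
  (m1 : (1 < m)%R) (C0 : (0 <= C)%R) (hmean : muckenhoupt_mean u zeta C)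
  (Kr0 : (0 <= Kr)%R) (theta0 : forall t, (0 <= theta t)%R)
  (theta_gt0 : forall t, (0 < t)%R -> (0 < theta t)%R)
  (mtheta : measurable_fun setT theta)
  (hratio : forall t r s, (0 < t)%R -> (0 < r)%R -> (0 < s)%R ->
     (t / 2 <= s / r <= 2 * t)%R -> ((W s / W r) `^ beta <= Kr * theta t)%R).
Hypotheses (K10 : (0 <= K1)%R)
  (hK1 : forall (rho : R) (D : set H) (h : H -> \bar R),
    (0 < rho)%R -> measurable D -> D `<=` B rho -> measurable_fun setT h ->
    (forall x, 0 <= h x) ->
    (\int[L]_(x in D) (h x `^ q * (u x)%:E)) `^ q^-1 <=
    (K1 * v rho `^ (- m^-1) * W rho `^ q^-1)%:E *
    (\int[L]_(x in D) (h x `^ m)) `^ m^-1).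
Hypotheses (alphasE : (alphas / Q%:R = beta - qs^-1)%R)
  (alphaE : (alpha / Q%:R = beta - q^-1)%R).
Variables (Phi : H -> R) (phi : R -> R).
Hypotheses (PhiE : forall x, Phi x = phi (hnorm x)).
Variables (phi' : R -> R) (N : set R).
Hypotheses (mphi' : measurable_fun setT phi') (phi'0 : forall t, (0 <= phi' t)%R)
  (mN : measurable N) (N0 : leb N = 0)
  (phiE : forall r, (0 < r)%R -> ~ N r -> phi r = phi' r)
  (phi_lty : \int[leb]_(t in `]0%R, +oo[) (kernel_density theta phi' t)%:E < +oo).
Variables (Omega : H -> R[i]) (Oa Ob : H -> R).
Hypotheses (mOa : measurable_fun setT Oa) (mOb : measurable_fun setT Ob)
  (OaE : {ae sigma, forall y, complex.Re (Omega y) = Oa y})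
  (ObE : {ae sigma, forall y, complex.Im (Omega y) = Ob y})
  (OLp : \int[sigma]_(y in S) (modulus Oa Ob y `^ (m / (m - 1)))%:E < +oo).

Let p0 : (0 < p)%R. Proof. exact: lt_le_trans p1. Qed.
Let pV0 : (0 <= p^-1)%R. Proof. by rewrite invr_ge0 ltW. Qed.

(** The terms of the Herz norm of the image form a dyadic convolution of those of
    f, so Young's inequality bounds the norm.  Its finiteness makes the weighted
    q-th power of the dominating function integrable on annuli; as the weight is
    positive almost everywhere, that function is finite almost everywhere, which
    is the absolute convergence, and compact sets that miss the origin lie in
    annuli, which is the local integrability. *)
Lemma herz_of_borel_bound : hausdorff_bounded Phi Omega w alphas p qs alpha p q.
Proof.
pose O := modulus Oa Ob.
have mO : measurable_fun setT O by exact: measurable_modulus.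
have O0 y : (0 <= O y)%R by exact: modulus_ge0.
pose Ks := shell_const sigma zeta m C Kr O.
have Ks0 : (0 <= Ks)%R by exact: shell_const_ge0.
have := phi_lty; set I := \int[leb]_(t in _) _ => Ilty.
have density0 t : (0 <= kernel_density theta phi' t)%R.
  by rewrite !mulr_ge0// invr_ge0.
have mdensity : measurable_fun setT (kernel_density theta phi').
  apply: measurable_funM; first exact: measurable_funM.
  by apply: (measurableT_comp (@measurable_invr R)).
have I0 : 0 <= I by apply: integral_ge0 => t _; rewrite lee_fin.
pose M : R := fine I.
have M0 : (0 <= M)%R by exact: fine_ge0.
have IE : I = M%:E by rewrite fineK// ge0_fin_numE.
pose A : R := (M `^ (p - 1) * (M * (2 `^ p * 2)))%R.
have A0 : (0 <= A)%R by rewrite !mulr_ge0 ?powR_ge0.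
pose c : R := (2 * (K1 * Ks))%R.
have c0 : (0 <= c)%R := mulr_ge0 (ler0n _ 2) (mulr_ge0 K10 Ks0).
have pVn0 : (p^-1 != 0)%R by rewrite invr_eq0 gt_eqF.
exists (c * A `^ p^-1)%R => f [[[[fa mfa faE] [fb mfb fbE]] _] flty].
pose fn := modulus fa fb.
have mfn : measurable_fun setT fn by exact: measurable_modulus.
have fn0 y : (0 <= fn y)%R by exact: modulus_ge0.
pose F : H -> \bar R := abs_hausdorff O phi' fn.
have mF : measurable_fun setT F by exact: measurable_abs_hausdorff.
have F0 x : 0 <= F x by exact: abs_hausdorff_ge0.
pose b := herz_term u qs beta fn.
have b0 i : (0 <= b i)%R by exact: herz_term_ge0.
have pow2_gt0 (k : int) : (0 < 2 ^ k :> R)%R by exact: exprz_gt0.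
pose J k := \int[L]_(x in @dyadic_shell R n k) (fn x `^ qs * u x)%:E.
have J0 k : 0 <= J k by apply: integral_ge0 => x _; rewrite lee_fin mulr_ge0// powR_ge0.
have wE (a e : R) k : (a / Q%:R = e)%R ->
    wmeasure w (@dyadic_ball R n k) `^ (a * p / Q%:R) = ((W (2 ^ k) `^ e) `^ p)%:E.
  by move=> <-; rewrite (wmeasure_ball w0 mu u0 wu WE) poweR_EFin -powRrM mulrAC.
have fE : herz_norm alphas p qs w f =
    (\esum_(k in [set: int]) ((W (2 ^ k) `^ (beta - qs^-1)) `^ p)%:E *
       (J k `^ qs^-1) `^ p) `^ p^-1.
  rewrite /herz_norm; congr (_ `^ _); apply: eq_esum => k _.
  by rewrite (wE _ _ _ alphasE) (wLnorm_shellE w0 mu u0 wu k qs0 mfa mfb faE fbE).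
have term0 k : 0 <= ((W (2 ^ k) `^ (beta - qs^-1)) `^ p)%:E * (J k `^ qs^-1) `^ p.
  by rewrite mule_ge0 ?poweR_ge0// lee_fin powR_ge0.
have Jlty k : J k < +oo.
  have := flty; rewrite fE => /lty_poweRy-/(_ pVn0).
  rewrite !ltey; apply: contra_neq => Joo; apply/eqP; rewrite -leye_eq.
  apply: le_trans (le_esum_term _ k).
  by rewrite Joo !poweRyr ?invr_eq0 ?gt_eqF// gt0_muley// lte_fin !powR_gt0// Wpos.
have bE k : ((W (2 ^ k) `^ (beta - qs^-1)) `^ p)%:E * (J k `^ qs^-1) `^ p = (b k `^ p)%:E.
  rewrite /b /herz_term powRM ?powR_ge0//; last by rewrite fine_ge0// poweR_ge0.
  rewrite EFinM; congr (_ * _); rewrite -poweR_EFin /shell_norm fineK//.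
  rewrite ge0_fin_numE; last exact: poweR_ge0.
  by apply: poweR_lty; exact: (Jlty k).
have {}fE : herz_norm alphas p qs w f = (\esum_(k in [set: int]) (b k `^ p)%:E) `^ p^-1.
  by rewrite fE; congr (_ `^ _); apply: eq_esum => k _.
have sumlty : \esum_(k in [set: int]) (b k `^ p)%:E < +oo.
  by have := flty; rewrite fE => /lty_poweRy; exact.
pose X k := \int[leb]_(t in `]0%R, +oo[)
  ((kernel_density theta phi' t)%:E * (b (k - dlog t) + b (k - dlog t + 1))%:E).
have X0 k : 0 <= X k.
  by apply: integral_ge0 => t _; rewrite mule_ge0// lee_fin// addr_ge0.
have sumX : \esum_(k in [set: int]) X k `^ p <=
    A%:E * \esum_(k in [set: int]) (b k `^ p)%:E.
  apply: (le_trans (convolution_sum p1 mdensity density0 b0)).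
  by rewrite -/I IE poweR_EFin /A !EFinM !muleA.
have Xlty k : X k < +oo.
  apply: (@lty_poweRy _ _ p); first by rewrite gt_eqF.
  apply: (le_lt_trans (le_esum_term (fun k => X k `^ p) k)).
  apply: (le_lt_trans sumX); rewrite lte_mul_pinfty//.
pose G : H -> \bar R := fun x => 2%:E * F x.
have mG : measurable_fun setT G by exact: measurable_funeM.
have G0 x : 0 <= G x by rewrite mule_ge0.
pose Y k := \int[L]_(x in @dyadic_shell R n k) (G x `^ q * (u x)%:E).
have YX k : (W (2 ^ k) `^ (beta - q^-1))%:E * Y k `^ q^-1 <= c%:E * X k.
  have YE : Y k `^ q^-1 =
      2%:E * (\int[L]_(x in @dyadic_shell R n k) (F x `^ q * (u x)%:E)) `^ q^-1.
    rewrite /Y (eq_integral (fun x => (2 `^ q)%:E * (F x `^ q * (u x)%:E))); last first.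
      by move=> x _; rewrite /G poweRM// muleA.
    rewrite ge0_integralZl//; last 3 first.
    - exact: (@measurable_dyadic_shell R n k).
    - apply: measurable_funTS; apply: emeasurable_funM; last exact/measurable_EFinP.
      exact: (measurableT_comp (measurable_poweR _)).
    - by move=> x _; rewrite mule_ge0 ?poweR_ge0// lee_fin.
    rewrite poweRM ?lee_fin ?powR_ge0//; last first.
      by apply: integral_ge0 => x _; rewrite mule_ge0 ?poweR_ge0// lee_fin.
    by rewrite poweR_EFin -powRrM mulfV ?gt_eqF// powRr1.
  have := hausdorff_shell_bound hsigma mu u0 WE Wpos Wmono zeta1 qs0 mE m1 C0
    hmean Kr0 theta0 theta_gt0 mtheta hratio K10 hK1 mO O0 OLp mphi' phi'0
    phi_lty mfn fn0 Jlty k.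
  move=> h; rewrite YE muleCA /c EFinM -muleA.
  by apply: lee_wpmul2l.
have Y0 k : 0 <= Y k.
  by apply: integral_ge0 => x _; rewrite mule_ge0 ?poweR_ge0// lee_fin.
have Ylty k : Y k < +oo.
  have qVn0 : (q^-1 != 0)%R by rewrite invr_eq0 gt_eqF.
  have h : (W (2 ^ k) `^ (beta - q^-1))%:E * Y k `^ q^-1 < +oo.
    by apply: (le_lt_trans (YX k)); rewrite lte_mul_pinfty.
  move: h; rewrite !ltey; apply: contra_neq => Yoo.
  by rewrite Yoo poweRyr// gt0_muley// lte_fin powR_gt0// Wpos.
have mGu : measurable_fun setT (fun x => G x `^ q * (u x)%:E).
  apply: emeasurable_funM; last exact/measurable_EFinP.
  exact: (measurableT_comp (measurable_poweR _)).
have Gu0 x : 0 <= G x `^ q * (u x)%:E by rewrite mule_ge0 ?poweR_ge0// lee_fin.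
have Glty := integral_annulus_lty mGu Gu0 Ylty.
have aeH := ae_hnorm_gt0 hsigma.
have aeG : {ae L, forall x, (0 < hnorm x)%R -> G x < +oo}.
  have /ae_foralln aeM : forall M0, {ae L, forall x, annulus M0 x -> G x `^ q * (u x)%:E < +oo}.
    move=> i; have mi := @measurable_annulus R n i.
    have /integrable_ae : L.-integrable (annulus i) (fun x => G x `^ q * (u x)%:E).
      apply/integrableP; split; first exact: measurable_funTS.
      by rewrite (eq_integral (fun x => G x `^ q * (u x)%:E))// => x _; rewrite gee0_abs.
    move=> /(_ mi); apply: filterS => x h /h; rewrite ge0_fin_numE//.
  move: aeM upos; apply: filterS2 => x Mx ux /annulus_cover[i xi].
  have := Mx i xi; rewrite !ltey; apply: contra_neq => ->.
  by rewrite poweRyr ?gt_eqF// gt0_mulye// lte_fin lt0r ux u0.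
have HG x : (0 < hnorm x)%R -> (normc (hausdorff Phi Omega f x))%:E <= G x.
  exact: (normc_hausdorff_le hsigma PhiE mphi' phi'0 mN N0 phiE mOa mOb mfa mfb OaE ObE faE fbE).
have hle : herz_norm alpha p q w (hausdorff Phi Omega f) <=
    (c * A `^ p^-1)%:E * herz_norm alphas p qs w f.
  have S0 : 0 <= \esum_(k in [set: int]) (b k `^ p)%:E.
    by apply: esum_ge0 => k _; rewrite lee_fin powR_ge0.
  have -> : (c * A `^ p^-1)%:E * herz_norm alphas p qs w f =
      ((c `^ p)%:E * (A%:E * \esum_(k in [set: int]) (b k `^ p)%:E)) `^ p^-1.
    rewrite fE 2?poweRM ?lee_fin ?powR_ge0 ?mule_ge0//.
    by rewrite muleA -EFinM -powRrM mulfV ?gt_eqF// powRr1.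
  rewrite /herz_norm; apply: le_poweR => //.
    by apply: esum_ge0 => k _; rewrite mule_ge0 ?poweR_ge0.
  apply: (@le_trans _ _ ((c `^ p)%:E * \esum_(k in [set: int]) X k `^ p)); last first.
    by apply: lee_wpmul2l => //; rewrite lee_fin powR_ge0.
  apply: esum_mule_le; [exact: powR_ge0|by move=> k; exact: poweR_ge0|move=> k].
  rewrite (wE _ _ _ alphaE) -!poweR_EFin -!poweRM ?lee_fin ?powR_ge0 ?poweR_ge0//.
  apply: le_poweR; [exact: ltW|by rewrite mule_ge0 ?poweR_ge0// lee_fin powR_ge0|].
  apply: le_trans (YX k); apply: lee_wpmul2l; first by rewrite lee_fin powR_ge0.
  apply: (wLnorm_shell_le w0 mu u0 wu) => //.
  exact: aeH.
split => //.
- move: (aeH _ (fun x => id)) aeG; apply: filterS2 => x x0 /(_ x0) Gx.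
  apply: (hausdorff_abs_integrable hsigma PhiE mphi' phi'0 mN N0 phiE mOa mOb mfa mfb OaE ObE faE fbE x0).
  move: Gx; rewrite !ltey; apply: contra_neq => Foo.
  by rewrite /G /F Foo gt0_muley// lte_fin.
split; last first.
  by apply: (le_lt_trans hle); rewrite lte_mul_pinfty// lee_fin mulr_ge0// powR_ge0.
split.
  exact: (hausdorff_ae_measurable hsigma PhiE mphi' mN N0 phiE mOa mOb mfa mfb OaE ObE faE fbE).
move=> K cK K0; have [i Ki] := hcompact_annulus cK K0.
apply: le_lt_trans (Glty i).
rewrite integral_mkcond [leRHS]integral_mkcond; apply: ae_le_integral_measurable_r.
- exact/(measurable_restrictT _ (@measurable_annulus R n i))/measurable_funTS.
- move=> x; rewrite patchE; case: ifP => // _.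
  by rewrite lee_fin mulr_ge0 ?powR_ge0.
- by move=> x; rewrite patchE; case: ifP.
move: (aeH _ HG) wu; apply: filterS2 => x Hx wx.
rewrite /patch; case: ifPn => [|_]; last by case: ifP.
rewrite inE => /Ki Kix; rewrite mem_set// EFinM wx.
apply: lee_wpmul2r; first by rewrite lee_fin.
by rewrite -poweR_EFin; apply: le_poweR => //; [exact: ltW|rewrite lee_fin normc_ge0].
Qed.

End herz_bound.

(** * The integral condition and the exponents *)

Section kernel_condition.
Context (R : realType).
Local Open Scope ereal_scope.
Local Notation leb := (@lebesgue_measure R).
Variables (a e1 e2 beta : R).
Local Notation theta := (kernel_power a e1 e2 beta).

Lemma measurable_kernel_power : measurable_fun setT theta.
Proof.
apply: measurable_fun_ifT; [|exact: measurable_powR..].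
exact: measurable_fun_ler.
Qed.

Lemma kernel_power_gt0 t : (0 < t)%R -> (0 < theta t)%R.
Proof. by move=> t0; rewrite /kernel_power; case: ifP => _; exact: powR_gt0. Qed.

Variables (phi phi' : R -> R) (N : set R).
Hypotheses (phi0 : forall t, (0 < t)%R -> (0 <= phi t)%R)
  (mphi' : measurable_fun setT phi') (phi'0 : forall t, (0 <= phi' t)%R)
  (mN : measurable N) (N0 : leb N = 0)
  (phiE : forall r, (0 < r)%R -> ~ N r -> phi r = phi' r).

(** The given integrals are those of the density of the Borel version of phi, up
    to the null set where the versions differ and the point 1/2. *)
Lemma kernel_density_lty :
  \int[leb]_(t in `]0%R, 2^-1%R[) (phi t / t `^ (1 - a * e1 * beta))%:E +
  \int[leb]_(t in `]2^-1%R, +oo[) (phi t / t `^ (1 - a * e2 * beta))%:E < +oo ->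
  \int[leb]_(t in `]0%R, +oo[) (kernel_density theta phi' t)%:E < +oo.
Proof.
have mK : measurable_fun setT (fun t => (kernel_density theta phi' t)%:E).
  apply/measurable_EFinP; apply: measurable_funM.
    by apply: measurable_funM => //; exact: measurable_kernel_power.
  by apply: (measurableT_comp (@measurable_invr R)).
have K0 t : 0 <= (kernel_density theta phi' t)%:E.
  by rewrite lee_fin !mulr_ge0// ?invr_ge0// kernel_power_ge0.
have powE (x t : R) : (0 < t)%R -> ((t `^ (1 - x))^-1 = t `^ x * `|t|^-1)%R.
  move=> t0; rewrite -powRN opprB powRD; last by rewrite (gt_eqF t0) implybT.
  by rewrite powRN powRr1 ?ltW// gtr0_norm.
have half0 : (0 < 2^-1 :> R)%R by rewrite invr_gt0.
have E (D : set R) (e : R) : measurable D ->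
    (forall t, D t -> (0 < t)%R) -> (forall t, D t -> theta t = t `^ (a * e * beta))%R ->
    \int[leb]_(t in D) (phi t / t `^ (1 - a * e * beta))%:E =
    \int[leb]_(t in D) (kernel_density theta phi' t)%:E.
  move=> mD D0 DE; apply: ge0_ae_eq_integral_measurable_r => //.
  - exact: measurable_funTS.
  - by move=> t Dt; rewrite lee_fin mulr_ge0 ?phi0 ?D0// invr_ge0 powR_ge0.
  exists N; split => // t /= /not_implyP[Dt h]; apply: contrapT => Nt; apply: h.
  rewrite /kernel_density -(phiE (D0 _ Dt) Nt) DE// powE ?D0//.
  by rewrite mulrA.
rewrite (E _ e1)//; last 2 first.
- by move=> t /=; rewrite in_itv/= => /andP[].
- by move=> t /=; rewrite in_itv/= /kernel_power => /andP[_ /ltW ->].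
rewrite (E _ e2)//; last 2 first.
- by move=> t /=; rewrite in_itv/= andbT; exact: lt_trans.
- by move=> t /=; rewrite in_itv/= andbT /kernel_power leNgt => ->.
rewrite integral_itv_bndo_bndc; last exact: measurable_funTS.
move=> h; apply: le_lt_trans h.
have -> : `]0%R, +oo[%classic = `]0%R, 2^-1%R] `|` `]2^-1%R, +oo[ :> set R.
  apply/seteqP; split=> t /=; rewrite !in_itv/= !andbT.
    by move=> t0; have [h|h] := leP t 2^-1%R; [left; rewrite t0|right].
  by move=> [/andP[]//|]; exact: lt_trans.
rewrite ge0_integral_setU//; first exact: measurable_funTS.
apply/disj_setPS => t [] /=; rewrite !in_itv/= andbT => /andP[_ h1] h2.
by move: (lt_le_trans h2 h1); rewrite ltxx.
Qed.

End kernel_condition.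

Section assembly.
Context (R : realType) (n : nat).
Local Notation H := (heis R n).
Local Notation L := (@heis_lebesgue R n).
Local Notation Q := (hdim n).
Local Notation S := (@hsphere R n).
Local Notation leb := (@lebesgue_measure R).
Local Notation normc := ComplexField.Normc.normc.
Variable sigma : {finite_measure set H -> \bar R}.
Hypothesis hsigma : polar_measure sigma.

(** The hypothesis on qs says that m / q exceeds the conjugate of the critical
    index, so that the conjugate of m / q, the exponent of the reverse Hoelder
    inequality, lies below that index. *)
Lemma reverse_hoelder_exponent (q qs zeta rw : R) : 1 <= q -> 1 <= zeta ->
  1 < rw -> q * zeta * rw / (rw - 1) < qs ->
  let m := qs / zeta in
  [/\ 1 < m, q < m & 1 < (m / q) / (m / q - 1) < rw].
Proof.
move=> q1 z1 rw1 hqs m.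
have q0 : 0 < q by exact: lt_le_trans q1.
have z0 : 0 < zeta by exact: lt_le_trans z1.
have rw0 : 0 < rw - 1 by rewrite subr_gt0.
have h : rw / (rw - 1) < m / q.
  rewrite /m ltr_pdivlMr// ltr_pdivlMr//; apply: le_lt_trans hqs.
  by rewrite le_eqVlt; apply/orP; left; apply/eqP; field; rewrite gt_eqF.
set x := m / q in h *.
have x1 : 1 < x.
  by apply: lt_trans h; rewrite ltr_pdivlMr// mul1r ltrBlDr ltrDl.
have qm : q < m by rewrite -[q]mul1r -ltr_pdivlMr.
split => //; first exact: le_lt_trans qm.
have x0 : 0 < x - 1 by rewrite subr_gt0.
apply/andP; split.
  by rewrite ltr_pdivlMr// mul1r ltrBlDr ltrDl.
rewrite ltr_pdivrMr//.
by move: h; rewrite ltr_pdivrMr//; lra.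
Qed.

(** The conjugate exponent of m is m / (m - 1). *)
Lemma sphere_Lp_modulus (m : R) (Omega : H -> R[i]) (Oa Ob : H -> R) : 1 < m ->
  measurable_fun setT Oa -> measurable_fun setT Ob ->
  {ae sigma, forall y, complex.Re (Omega y) = Oa y} ->
  {ae sigma, forall y, complex.Im (Omega y) = Ob y} ->
  sphere_Lp sigma (hoelder_conjugate m%:E) Omega ->
  (\int[sigma]_(y in S) (modulus Oa Ob y `^ (m / (m - 1)))%:E < +oo)%E.
Proof.
move=> m1 mOa mOb OaE ObE [_].
have m0 : 0 < m by exact: lt_trans m1.
have s0 : 0 < m / (m - 1) by rewrite divr_gt0// subr_gt0.
have -> : hoelder_conjugate m%:E = (m / (m - 1))%:E.
  rewrite /hoelder_conjugate/= eqe gt_eqF//= -EFinB inver gt_eqF ?subr_gt0//.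
rewrite unlock => /lty_poweRy; rewrite invr_eq0 gt_eqF// => /(_ isT).
apply: le_lt_trans.
have mO : measurable_fun setT (fun y => (modulus Oa Ob y `^ (m / (m - 1)))%:E).
  apply/measurable_EFinP; apply: (measurableT_comp (measurable_powR _)).
  exact: measurable_modulus.
rewrite (_ : integral _ setT _ = \int[sigma]_x (modulus Oa Ob x `^ (m / (m - 1)))%:E)%E.
  apply: ge0_subset_integral => //; first exact: measurable_hsphere.
  by move=> y _; rewrite lee_fin powR_ge0.
apply: ge0_ae_eq_integral_measurable_r => //.
- by move=> y _; exact: poweR_ge0.
- by move=> y _; rewrite lee_fin powR_ge0.
move: OaE ObE; apply: filterS2 => y a b _.
by rewrite abse_EFin ger0_norm ?normc_ge0// poweR_EFin normcE a b.
Qed.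

End assembly.


Theorem theorem3p4 (R : realType) (n : nat) (hn : (0 < n)%N)
  (sigma : {measure set (heis R n) -> \bar R}) (hsigma : polar_measure sigma)
  (Phi : heis R n -> R) (phi : R -> R)
  (hPhi_meas : ae_measurable (@heis_lebesgue R n) Phi)
  (hPhi_ge0 : forall x, 0 <= Phi x)
  (hPhi_radial : forall x, Phi x = phi (hnorm x))
  (Omega : heis R n -> R[i])
  (hOmega_meas : ae_measurableC sigma Omega)
  (hOmega_neq0 : {ae sigma, forall y, hsphere y -> Omega y <> 0})
  (w : heis R n -> R) (hw : weight w)
  (p qs q zeta alpha alphas : R)
  (hp : 1 <= p) (hqs : 1 <= qs) (hq : 1 <= q) (hzeta : 1 <= zeta)
  (halphas : alphas < 0)
  (hexp : qs^-1 + alphas / (hdim n)%:R = q^-1 + alpha / (hdim n)%:R)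
  (hAp : muckenhoupt zeta w)
  (rw : R) (hrw : critical_index w = rw%:E)
  (hqs_gt : q * zeta * rw / (rw - 1) < qs)
  (hOmega : sphere_Lp sigma (hoelder_conjugate (qs / zeta)%:E) Omega)
  (delta : R) (hdelta : 1 < delta < rw) :
  (0 <= qs^-1 + alphas / (hdim n)%:R ->
   (\int[@lebesgue_measure R]_(t in `]0%R, 2^-1%R[)
      (phi t / t `^ (1 - (hdim n)%:R * ((delta - 1) / delta)
                         * (qs^-1 + alphas / (hdim n)%:R)))%:E
    + \int[@lebesgue_measure R]_(t in `]2^-1%R, +oo[)
      (phi t / t `^ (1 - (hdim n)%:R * zeta
                         * (qs^-1 + alphas / (hdim n)%:R)))%:E < +oo)%E ->
   hausdorff_bounded Phi Omega w alphas p qs alpha p q)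
  /\
  (qs^-1 + alphas / (hdim n)%:R < 0 ->
   (\int[@lebesgue_measure R]_(t in `]0%R, 2^-1%R[)
      (phi t / t `^ (1 - (hdim n)%:R * zeta
                         * (qs^-1 + alphas / (hdim n)%:R)))%:E
    + \int[@lebesgue_measure R]_(t in `]2^-1%R, +oo[)
      (phi t / t `^ (1 - (hdim n)%:R * ((delta - 1) / delta)
                         * (qs^-1 + alphas / (hdim n)%:R)))%:E < +oo)%E ->
   hausdorff_bounded Phi Omega w alphas p qs alpha p q).
Proof.
have [nu nuE] := finite_measure_pack (lty_fin_num_fun (polar_sphere_lty hsigma)).
subst sigma.
have [g mg wg] := hw.1; have w0 := hw.2.
pose u (x : heis R n) : R := Num.max (g x) 0.
have mu : measurable_fun setT u.
  by apply: measurable_maxr => //; exact: measurable_cst.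
have u0 x : 0 <= u x by rewrite le_max lexx orbT.
have wu : {ae @heis_lebesgue R n, forall x, w x = u x}.
  apply: filterS wg => x wgx; rewrite /u -wgx; apply/esym/max_idPl; exact: w0.
have [C C0 hmean] := muckenhoupt_meanP hsigma w0 mu u0 wu hzeta hAp.
have hd : 1 < rw by have /andP[] := hdelta; exact: lt_trans.
have [m1 qm hr] := reverse_hoelder_exponent hq hzeta hd hqs_gt.
set m := qs / zeta in m1 qm hr.
have q0 : 0 < q by exact: lt_le_trans hq.
have qs0 : 0 < qs by exact: lt_le_trans hqs.
have z0 : 0 <= zeta by exact: le_trans hzeta.
have WE := wballE hsigma w0 mu u0 wu hzeta C0 hmean hrw.
have Wpos := wball_gt0 hsigma w0 mu u0 wu hzeta C0 hmean hrw.
have Wmono := wball_mono hsigma w0 mu u0 wu hzeta C0 hmean hrw.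
have up := wball_doubling hsigma w0 mu u0 wu hzeta C0 hmean hrw.
have [D D0 down] := wball_decay hsigma w0 mu u0 wu hzeta C0 hmean hrw hdelta.
have upos := weight_pos_ae hsigma w0 mu u0 wu hzeta hmean hrw.
have [K K0 hRH] := reverse_hoelder_below hsigma w0 mu u0 wu hzeta C0 hmean hrw hr.
have [K1 K10 hK1] := weighted_norm_le hsigma mu u0 Wpos q0 qm K0 hRH.
have [[Oa mOa OaE] [Ob mOb ObE]] := hOmega_meas.
have OLp := sphere_Lp_modulus m1 mOa mOb OaE ObE hOmega.
have [phi' [mphi' phi'0 [N [mN N0' N0 phiE]]]] :=
  radial_ae_measurable hsigma hPhi_meas hPhi_ge0 hPhi_radial.
have phi0 t : 0 < t -> 0 <= phi t.
  by move=> t0; have [x xt] := hnorm_surj n (ltW t0); rewrite -xt -hPhi_radial.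
set beta := qs^-1 + alphas / (hdim n)%:R.
set eta := (delta - 1) / delta in down *.
have eta0 : 0 <= eta.
  have /andP[d1 _] := hdelta.
  by rewrite divr_ge0// ?subr_ge0 ltW// (lt_trans _ d1).
have alphasE : alphas / (hdim n)%:R = beta - qs^-1 by rewrite /beta addrC addKr.
have alphaE : alpha / (hdim n)%:R = beta - q^-1 by rewrite /beta hexp addrC addKr.
have Q0 : 0 <= (hdim n)%:R :> R by [].
have bounded e1 e2 Kr : 0 <= Kr ->
    (forall t r s, 0 < t -> 0 < r -> 0 < s -> t / 2 <= s / r <= 2 * t ->
       (wball u s / wball u r) `^ beta <= Kr * kernel_power (hdim n)%:R e1 e2 beta t) ->
    (\int[@lebesgue_measure R]_(t in `]0%R, 2^-1%R[)
       (phi t / t `^ (1 - (hdim n)%:R * e1 * beta))%:E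
     + \int[@lebesgue_measure R]_(t in `]2^-1%R, +oo[)
       (phi t / t `^ (1 - (hdim n)%:R * e2 * beta))%:E < +oo)%E ->
    hausdorff_bounded Phi Omega w alphas p qs alpha p q.
  move=> Kr0 ratio hphi.
  exact: (herz_of_borel_bound hsigma w0 mu u0 wu upos WE Wpos Wmono hp hzeta q0
    qs0 erefl m1 C0 hmean Kr0 (@kernel_power_ge0 _ _ _ _ _) (@kernel_power_gt0 _ _ _ _ _)
    (measurable_kernel_power _ _ _ _) ratio K10 hK1 alphasE alphaE hPhi_radial
    mphi' phi'0 mN N0 phiE (kernel_density_lty phi0 mphi' phi'0 mN N0 phiE hphi)
    mOa mOb OaE ObE OLp).
split=> beta0.
- have [Kr Kr0 ratio] := ratio_kernel_power_ge0 Wpos Q0 eta0 z0 C0 D0 Wmono up down beta0.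
  exact: bounded Kr0 ratio.
- have [Kr Kr0 ratio] := ratio_kernel_power_lt0 Wpos Q0 eta0 z0 C0 D0 up down beta0.
  exact: bounded Kr0 ratio.
Qed.
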